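(* Consider a generalized bicharacteristic $\gamma:\mathbb R\setminus B\to T^*\mathcal L$ that is nontrivial, i.e. whose cotangent component $(\tau,\xi)$ is not zero. Then $$\langle\delta_{\bar\gamma},a\rangle=\int_{\mathbb R\setminus B}a\big(\gamma(s)\big)\,ds,\qquad a\in C^0_c(T^*\hat{\mathcal L}),$$ yields a measure $\mu=\delta_{\bar\gamma}$ on $T^*\hat{\mathcal L}$ that fulfills, for some nonnegative measure $\nu$ on $\partial_\parallel T^*\mathcal L$, the transport equation $${}^t\!H_p\,\mu=-\int_{\rho\in\mathcal H_\parallel\cup\mathcal G_\parallel}\frac{\delta_{\rho^+}-\delta_{\rho^-}}{\langle\xi^+-\xi^-,\mathsf n_x\rangle_{T_x^*\mathcal M,T_x\mathcal M}}\,d\nu(\rho)$$ in the sense of distributions in $T^*\hat{\mathcal L}$.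
   Context: **Geometry.** $\mathcal M$ is a $C^2$ compact connected $d$-dimensional manifold with boundary, equipped with a $C^1$ Riemannian metric $g$. $\mathcal M$ is contained in an open $d$-dimensional manifold, $\hat{\mathcal M}$ is a compact neighborhood of $\mathcal M$ in it, and $g$ is extended to $\hat{\mathcal M}$ as a $C^1$ metric. $\mathcal L=\mathbb R\times\mathcal M$, $\hat{\mathcal L}=\mathbb R\times\hat{\mathcal M}$. Points of $T^*\hat{\mathcal L}$ are $\rho=(t,x,\tau,\xi)$. $T^*\mathcal L$ is the set of $\rho$ with $x\in\mathcal M$ (boundary included), $\partial T^*\mathcal L$ the set of $\rho$ with $x\in\partial\mathcal M$. $p(\rho)=-\tau^2+|\xi|_x^2$ with $|\xi|_x^2=g^{ij}(x)\xi_i\xi_j$, $\mathrm{Char}\,p=\{p=0\}$. For a function $h$, $H_h$ is its Hamiltonian vector field, $H_h(k)=\{h,k\}$; in particular $H_p=-2\tau\partial_t+2g^{ij}\xi_i\partial_{x_j}-\partial_{x_k}g^{ij}\,\xi_i\xi_j\,\partial_{\xi_k}$, a continuous vector field. **Boundary.** Near each boundary point one uses $C^2$ ''quasi-normal'' local coordinates $x=(x',z)$ of $\hat{\mathcal M}$ (they exist) with $\mathcal M=\{z\ge0\}$, $\partial\mathcal M=\{z=0\}$ locally and $g(x',0)=\sum_{i,j\le d-1}g_{ij}(x',0)dx^i\otimes dx^j+|dz|^2$; write $\xi=(\xi',\zeta)$. Then $H_pz=2g^{dj}\xi_j$ is $C^1$ (equal to $2\zeta$ at $z=0$), $H_p^2z=H_p(H_pz)$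 is continuous, $H_z=-\partial_\zeta$, and $H_z^2p=2g^{dd}$ (equal to $2$ at $z=0$). On $\partial T^*\mathcal L$ set $\Sigma(t,x',0,\tau,\xi',\zeta)=(t,x',0,\tau,\xi',-\zeta)$. Let $\partial_\parallel T^*\mathcal L=\{z=0,\zeta=0\}$, $\mathcal H_\parallel=\partial_\parallel T^*\mathcal L\cap\{p<0\}$, $\mathcal G_\partial=\mathcal G_\parallel=\partial_\parallel T^*\mathcal L\cap\{p=0\}$, $\mathcal H_\partial^\pm=\{z=0,\ p=0,\ \pm\zeta>0\}$, $\mathcal H_\partial=\mathcal H^+_\partial\cup\mathcal H^-_\partial$. For $\rho=(t,x',0,\tau,\xi',0)\in\mathcal H_\parallel$, $\rho^\pm=(t,x',0,\tau,\xi^\pm)\in\mathcal H_\partial^\pm$ with $\xi^\pm=(\xi',\pm\sqrt{-p(\rho)})$. $\mathcal G^{\mathrm g}_\partial=\mathcal G_\partial\cap\{H_p^2z<0\}$. **Measure equation.** $\langle{}^t\!H_p\mu,a\rangle=\langle\mu,H_pa\rangle$ for compactly supported test functions $a$ (of class $C^1$). $\mathsf n_x$ is the unit inward normal to $\partial\mathcal M$ at $x$; so for $\rho\in\mathcal H_\parallel$ the integrand acting on $a$ is $\big(a(\rho^+)-a(\rho^-)\big)/\big(2\sqrt{-p(\rho)}\big)$. For $\rho\in\mathcal G_\parallel$ the integrand acting on $a$ is by definition the limit of $\big(a(\rho_n^+)-a(\rho_n^-)\big)/\big(2\sqrt{-p(\rho_n)}\big)$ for sequences $(\rho_n)_n\subset\mathcal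 H_\parallel$ converging to $\rho$, i.e. $\partial_\zeta a(\rho)$ in quasi-normal coordinates. **Generalized bicharacteristics.** The gliding vector field on $\partial_\parallel T^*\mathcal L$ is $H_p^{\mathcal G}=H_p+\frac{H_p^2z}{H_z^2p}H_z$. Let $X^{\mathsf G}=H_p$ on $T^*\mathcal L\setminus\mathcal G^{\mathrm g}_\partial$ and $X^{\mathsf G}=H_p^{\mathcal G}$ on $\mathcal G_\partial^{\mathrm g}$. For an interval $J\subset\mathbb R$ and a discrete subset $B$ of $J$ (all points of $B$ isolated in $B$), $\gamma:J\setminus B\to\mathrm{Char}\,p\cap T^*\mathcal L$ is a generalized bicharacteristic if: (1) for $s\in J\setminus B$, $\gamma(s)\notin\mathcal H_\partial$, and $\gamma$ is differentiable at $s$ with $\gamma'(s)=X^{\mathsf G}(\gamma(s))$; (2) if $S\in B$, then $\gamma(s)\in T^*\mathcal L\setminus\partial T^*\mathcal L$ for $s\in J\setminus B$ sufficiently close to $S$, and: (a) if $[S-\varepsilon,S]\subset J$ for some $\varepsilon>0$, then $\gamma(S^-)=\lim_{s\to S^-}\gamma(s)$ exists in $\mathcal H_\partial^-$; (b) if $[S,S+\varepsilon]\subset J$ for some $\varepsilon>0$, then $\gamma(S^+)=\lim_{s\to S^+}\gamma(s)$ exists in $\mathcal H_\partial^+$; (c) if $[S-\varepsilon,S+\varepsilon]\subset J$ for some $\varepsilon>0$, then $\gamma(S^+)=\Sigma(\gamma(S^-))$. Along a generalized bicharacteristic $\tau$ is constant. Here $J=\mathbb R$, and $\bar\gamma$ is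 the closure of $\{\gamma(s);s\in\mathbb R\setminus B\}$. *)

(* Defs.v *)
From HB Require Import structures.
From mathcomp Require Import all_boot all_order all_algebra.
From mathcomp Require Import all_classical all_reals all_analysis.
Set Implicit Arguments.
Unset Strict Implicit.
Unset Printing Implicit Defensive.
Import Order.TTheory GRing.Theory Num.Theory.
Import numFieldNormedType.Exports.
Local Open Scope classical_set_scope.
Local Open Scope ring_scope.

(* Used for finite-dimensional V only, where continuity of all the partial
   maps y |-> 'd f y v is continuity of the differential. *)
Definition C1on (R : realType) (V W : normedModType R) (U : set V)
    (f : V -> W) : Prop :=
  forall x, U x -> (\forall y \near x, differentiable f y) /\
    forall v, {for x, continuous (fun y => 'd f y v)}.

Definition C2on (R : realType) (V W : normedModType R) (U : set V)
    (f : V -> W) : Prop :=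
  C1on U f /\ forall v, C1on U (fun y => 'd f y v).

(* Dimension n.+1; coordinates are row vectors (x', z), z being the last entry.
   [phi] and [psi] are meaningful on [dom] and [phi @` dom] only. *)
Record chart (R : realType) (n : nat) (T : topologicalType) := Chart {
  dom : set T;
  phi : T -> 'rV[R]_n.+1;
  psi : 'rV[R]_n.+1 -> T;
  dom_open : open dom;
  cod_open : open (phi @` dom);
  phiK : forall x, dom x -> psi (phi x) = x;
  phi_cont : forall x, dom x -> {for x, continuous phi};
  psi_cont : forall u, (phi @` dom) u -> {for u, continuous psi} }.

Definition C2compat (R : realType) (n : nat) (T : topologicalType)
    (c c' : chart R n T) : Prop :=
  C2on (phi c @` (dom c `&` dom c')) (phi c' \o psi c) /\
  C2on (phi c' @` (dom c `&` dom c')) (phi c \o psi c').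

Record manifold (R : realType) (n : nat) := Manifold {
  mcarrier :> ptopologicalType;
  atlas : set (chart R n mcarrier);
  mhausdorff : hausdorff_space mcarrier;
  msecond_countable : @second_countable mcarrier;
  atlas_cover : forall x : mcarrier, exists2 c, atlas c & dom c x;
  atlas_compat : forall c c', atlas c -> atlas c' -> C2compat c c';
  atlas_maximal : forall c,
    (forall c', atlas c' -> C2compat c c') -> atlas c }.

(* The Jacobian at x of the change of coordinates from c to c'. Vectors
   transform as v_c' = v_c *m J, hence covectors as xi_c = xi_c' *m J^T. *)
Definition trans_jac (R : realType) (n : nat) (N : manifold R n)
    (c c' : chart R n N) (x : N) : 'M[R]_n.+1 :=
  jacobian (phi c' \o psi c) (phi c x).

Definition pref_chart (R : realType) (n : nat) (N : manifold R n) (x : N) :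
  chart R n N := projT1 (cid2 (atlas_cover x)).

(* The fibre of T^*N over x is identified with R^(n.+1) through the chart
   [pref_chart x]: [ph_xi] is the list of components in that chart. The
   components in another chart are given by [lcoord]. *)
Record phase (R : realType) (n : nat) (N : manifold R n) := Phase {
  ph_t : R;
  ph_x : N;
  ph_tau : R;
  ph_xi : 'rV[R]_n.+1 }.

(* Local coordinates (t, x, tau, xi) on T^*(R x N). *)
Definition pcoord (R : realType) (n : nat) : normedModType R :=
  (R * 'rV[R]_n.+1 * R * 'rV[R]_n.+1)%type.

Section Coordinates.
Context {R : realType} {n : nat} (N : manifold R n).
Implicit Types (c : chart R n N) (q : pcoord R n) (rho : phase N).

Definition co_t q : R := q.1.1.1.
Definition co_x q : 'rV[R]_n.+1 := q.1.1.2.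
Definition co_tau q : R := q.1.2.
Definition co_xi q : 'rV[R]_n.+1 := q.2.

Definition lcoord c rho : pcoord R n :=
  let x := ph_x rho in
  (ph_t rho, phi c x, ph_tau rho,
   ph_xi rho *m (trans_jac c (pref_chart x) x)^T).

Definition pcod c : set (pcoord R n) := [set q | (phi c @` dom c) (co_x q)].

(* The inverse of [lcoord c], on [pcod c]. *)
Definition of_coord c q : phase N :=
  let x := psi c (co_x q) in
  Phase (co_t q) x (co_tau q) (co_xi q *m (trans_jac (pref_chart x) c x)^T).

Definition phase_open (O : set (phase N)) : Prop :=
  forall c, atlas c -> open (pcod c `&` of_coord c @^-1` O).

Lemma open_pcod c : open (pcod c).
Proof.
have : continuous co_x.
  by move=> q; apply: (cvg_comp _ _ (cvg_comp _ _ cvg_fst cvg_fst) cvg_snd).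
by move=> /continuousP; apply; exact: cod_open.
Qed.

Lemma phase_openT : phase_open setT.
Proof. by move=> c _; rewrite preimage_setT setIT; exact: open_pcod. Qed.

Lemma phase_openI : setI_closed phase_open.
Proof.
move=> A B oA oB c ac; rewrite preimage_setI setIIr.
by apply: openI; [exact: oA|exact: oB].
Qed.

Lemma phase_open_bigU (I : Type) (f : I -> set (phase N)) :
  (forall i, phase_open (f i)) -> phase_open (\bigcup_i f i).
Proof.
move=> of_ c ac; rewrite preimage_bigcup setI_bigcupr.
by apply: bigcup_open => i _; exact: of_.
Qed.

End Coordinates.

HB.instance Definition _ (R : realType) (n : nat) (N : manifold R n) :=
  gen_eqMixin (phase N).
HB.instance Definition _ (R : realType) (n : nat) (N : manifold R n) :=
  gen_choiceMixin (phase N).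
HB.instance Definition _ (R : realType) (n : nat) (N : manifold R n) :=
  isPointed.Build (phase N) (Phase 0 point 0 0).
HB.instance Definition _ (R : realType) (n : nat) (N : manifold R n) :=
  isOpenTopological.Build (phase N)
    (@phase_openT R n N) (@phase_openI R n N) (@phase_open_bigU R n N).

Definition zlast (R : realType) (n : nat) (u : 'rV[R]_n.+1) : R :=
  u ord0 ord_max.

(* A C^1 Riemannian metric on the open set U, given by its matrix [met c x] in
   each chart c at each point x. *)
Definition C1_metric (R : realType) (n : nat) (N : manifold R n) (U : set N)
    (met : chart R n N -> N -> 'M[R]_n.+1) : Prop :=
  [/\ forall c x, atlas c -> dom c x -> U x ->
        (met c x)^T = met c x /\
        forall v : 'rV[R]_n.+1, v != 0 -> 0 < (v *m met c x *m v^T) 0 0,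
      forall c, atlas c -> C1on (phi c @` (dom c `&` U)) (met c \o psi c) &
      forall c c' x, atlas c -> atlas c' -> dom c x -> dom c' x -> U x ->
        met c x = trans_jac c c' x *m met c' x *m (trans_jac c c' x)^T].

Definition boundary (T : topologicalType) (M : set T) : set T :=
  M `\` interior M.

(* Quasi-normal coordinates (x', z): M = {z >= 0} in the chart and, on the
   boundary, the metric is block diagonal with g_dd = 1. *)
Definition quasi_normal (R : realType) (n : nat) (N : manifold R n) (M : set N)
    (met : chart R n N -> N -> 'M[R]_n.+1) (c : chart R n N) : Prop :=
  [/\ atlas c,
      forall y, dom c y -> (M y <-> 0 <= zlast (phi c y)),
      forall y, dom c y -> (boundary M y <-> zlast (phi c y) = 0) &
      forall y j, dom c y -> boundary M y ->
        met c y j ord_max = (j == ord_max)%:R].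

(* [amb] is the open manifold, [Mhat] the compact neighbourhood of [M] in it.
   The metric is C^1 up to the edge of [Mhat], i.e. on an open set [mdom]
   containing [Mhat]. The last field contains the definition of a C^2 manifold
   with boundary (boundary charts M = {z >= 0}) together with the standard fact
   that such charts can always be chosen quasi-normal. *)
Record geometry (R : realType) (n : nat) := Geometry {
  amb :> manifold R n;
  Mset : set amb;
  Mhat : set amb;
  mdom : set amb;
  metric : chart R n amb -> amb -> 'M[R]_n.+1;
  M_compact : compact Mset;
  M_connected : connected Mset;
  Mhat_compact : compact Mhat;
  M_sub_Mhat : Mset `<=` interior Mhat;
  mdom_open : open mdom;
  Mhat_sub_mdom : Mhat `<=` mdom;
  metric_C1 : C1_metric mdom metric;
  bdry_chart : forall x, boundary Mset x ->
    exists2 c, quasi_normal Mset metric c & dom c x }.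

Section Hamiltonian.
Context {R : realType} {n : nat}.
Local Notation P := (pcoord R n).
Implicit Types (h k : P -> R) (q : P).

Definition e_t : P := (1, 0, 0, 0).
Definition e_x (j : 'I_n.+1) : P := (0, delta_mx 0 j, 0, 0).
Definition e_tau : P := (0, 0, 1, 0).
Definition e_xi (j : 'I_n.+1) : P := (0, 0, 0, delta_mx 0 j).

(* H_h, with the sign convention {tau, t} = {xi_j, x_j} = 1. *)
Definition Ham h q : P :=
  ('D_e_tau h q, \row_j 'D_(e_xi j) h q,
   - 'D_e_t h q, \row_j - 'D_(e_x j) h q).

(* {h, k}, as the derivative of k along H_h. *)
Definition poisson h k q : R := 'D_(Ham h q) k q.

Definition zfun q : R := zlast (co_x q).

End Hamiltonian.

Section Symbol.
Context {R : realType} {n : nat} (G : geometry R n).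
Local Notation phaseG := (phase G).
Implicit Types (c : chart R n G) (q : pcoord R n) (rho : phaseG).

Definition psym c q : R :=
  - co_tau q ^+ 2 +
  (co_xi q *m invmx (metric c (psi c (co_x q))) *m (co_xi q)^T) 0 0.

(* The value does not depend on the chart. *)
Definition p rho : R := let c := pref_chart (ph_x rho) in psym c (lcoord c rho).

(* The gliding vector field in a chart c where M = {z >= 0}. *)
Definition HamG c q : pcoord R n :=
  Ham (psym c) q +
  (poisson (psym c) (poisson (psym c) zfun) q /
   poisson zfun (poisson zfun (psym c)) q) *: Ham zfun q.

Definition Charp : set phaseG := [set rho | p rho = 0].
Definition TL : set phaseG := [set rho | Mset (ph_x rho)].
Definition TLhat : set phaseG := [set rho | Mhat (ph_x rho)].
Definition bTL : set phaseG := [set rho | boundary (@Mset R n G) (ph_x rho)].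

(* A quasi-normal chart around x if x is in the boundary of M. The objects
   below do not depend on which one is chosen. *)
Definition qn_chart (x : G) : chart R n G :=
  if pselect (boundary (@Mset R n G) x) is left bx
  then projT1 (cid2 (bdry_chart bx)) else pref_chart x.

(* Coordinates (t, x', z, tau, xi', zeta) in that chart. *)
Definition qcoord rho : pcoord R n := lcoord (qn_chart (ph_x rho)) rho.

Definition zeta rho : R := zlast (co_xi (qcoord rho)).

Definition set_zeta rho (r : R) : phaseG :=
  of_coord (qn_chart (ph_x rho))
    (co_t (qcoord rho), co_x (qcoord rho), co_tau (qcoord rho),
     \row_j (if j == ord_max then r else co_xi (qcoord rho) 0 j)).

Definition Sigma rho : phaseG := set_zeta rho (- zeta rho).

Definition bparTL : set phaseG := bTL `&` [set rho | zeta rho = 0].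
Definition Hpar : set phaseG := bparTL `&` [set rho | p rho < 0].
Definition Gpar : set phaseG := bparTL `&` [set rho | p rho = 0].
Definition Hbplus : set phaseG :=
  bTL `&` [set rho | p rho = 0 /\ 0 < zeta rho].
Definition Hbminus : set phaseG :=
  bTL `&` [set rho | p rho = 0 /\ zeta rho < 0].
Definition Hb : set phaseG := Hbplus `|` Hbminus.

Definition Hp2z rho : R :=
  let s := psym (qn_chart (ph_x rho)) in
  poisson s (poisson s zfun) (qcoord rho).

Definition Ggl : set phaseG := Gpar `&` [set rho | Hp2z rho < 0].

(* Meaningful for rho in [Hpar], where p rho < 0. *)
Definition rho_plus rho : phaseG := set_zeta rho (Num.sqrt (- p rho)).
Definition rho_minus rho : phaseG := set_zeta rho (- Num.sqrt (- p rho)).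

(* Components in [qn_chart x] of the unit inward normal vector at a boundary
   point x: the metric gradient of z divided by its length. *)
Definition normal (x : G) : 'rV[R]_n.+1 :=
  let gi := invmx (metric (qn_chart x) x) in
  (Num.sqrt (gi ord_max ord_max))^-1 *: row ord_max gi.

Definition normal_gap rho : R :=
  ((co_xi (qcoord (rho_plus rho)) - co_xi (qcoord (rho_minus rho)))
     *m (normal (ph_x rho))^T) 0 0.

Definition jump_quot (a : phaseG -> R) rho : R :=
  (a (rho_plus rho) - a (rho_minus rho)) / normal_gap rho.

(* The integrand of the right-hand side of the measure equation acting on a;
   on [Gpar] it is the limit of its values on [Hpar], which is
   the zeta-derivative of a in quasi-normal coordinates for a of class C^1. *)
Definition jump (a : phaseG -> R) rho : R :=
  if pselect (Hpar rho) then jump_quot a rho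
  else lim (jump_quot a @ within Hpar (nbhs rho)).

(* The derivative at s of gamma restricted to D, read in the chart c, is v. *)
Definition velocity (D : set R) (gamma : R -> phaseG) (s : R) c
    (v : pcoord R n) : Prop :=
  (fun s' => (s' - s)^-1 *: (lcoord c (gamma s') - lcoord c (gamma s)))
    @ within D s^' --> v.

Definition gen_bichar (J B : set R) (gamma : R -> phaseG) : Prop :=
  let D := J `\` B in
  [/\ is_interval J,
      B `<=` J,
      forall S, B S -> isolated B S &
      forall s, D s -> (Charp `&` TL) (gamma s)] /\
  (forall s, D s ->
    [/\ ~ Hb (gamma s),
        gamma @ within D (nbhs s) --> gamma s,
        ~ Ggl (gamma s) -> forall c, atlas c -> dom c (ph_x (gamma s)) ->
          velocity D gamma s c (Ham (psym c) (lcoord c (gamma s))) &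
        Ggl (gamma s) -> forall c, quasi_normal (@Mset R n G) (@metric R n G) c ->
          dom c (ph_x (gamma s)) ->
          velocity D gamma s c (HamG c (lcoord c (gamma s)))]) /\
  (forall S, B S ->
    [/\ \forall s \near S, D s -> (TL `\` bTL) (gamma s),
        (exists2 e : R, 0 < e & `[S - e, S] `<=` J) ->
          exists2 l, Hbminus l & gamma @ S^'- --> l,
        (exists2 e : R, 0 < e & `[S, S + e] `<=` J) ->
          exists2 l, Hbplus l & gamma @ S^'+ --> l &
        (exists2 e : R, 0 < e & `[S - e, S + e] `<=` J) ->
          forall l r, gamma @ S^'- --> l -> gamma @ S^'+ --> r ->
            r = Sigma l]).

Definition compact_supp (a : phaseG -> R) : Prop :=
  compact (closure [set rho | a rho != 0]).

Definition C0c (a : phaseG -> R) : Prop := continuous a /\ compact_supp a.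

Definition C1c (a : phaseG -> R) : Prop :=
  (forall c, atlas c -> C1on (pcod c) (a \o of_coord c)) /\ compact_supp a.

(* H_p a; the value does not depend on the chart. *)
Definition Hp (a : phaseG -> R) rho : R :=
  let c := pref_chart (ph_x rho) in
  poisson (psym c) (a \o of_coord c) (lcoord c rho).

Definition borel := g_sigma_algebraType (@open phaseG).

(* Nonnegative Radon measures on the closed subset F of the cotangent bundle,
   as Borel measures carried by F. *)
Definition radon_on (F : set phaseG) (mu : {measure set borel -> \bar R}) :
    Prop :=
  (forall K : set phaseG, compact K -> (mu K < +oo)%E) /\ mu (~` F) = 0%E.

Definition is_delta (B : set R) (gamma : R -> phaseG)
    (mu : {measure set borel -> \bar R}) : Prop :=
  radon_on TLhat mu /\
  forall a, C0c a ->
    lebesgue_measure.-integrable (~` B) (fun s => (a (gamma s))%:E) /\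
    (\int[mu]_(rho in TLhat) (a rho)%:E =
     \int[lebesgue_measure]_(s in ~` B) (a (gamma s))%:E)%E.

(* <tH_p mu, a> = - int jump(a) dnu for all test functions a. *)
Definition transport_eq (mu nu : {measure set borel -> \bar R}) : Prop :=
  forall a, C1c a ->
    [/\ mu.-integrable TLhat (fun rho => (Hp a rho)%:E),
        nu.-integrable (Hpar `|` Gpar) (fun rho => (jump a rho)%:E) &
        (\int[mu]_(rho in TLhat) (Hp a rho)%:E =
         - \int[nu]_(rho in Hpar `|` Gpar) (jump a rho)%:E)%E].

End Symbol.

(* Main.v *)
From HB Require Import structures.
Require Import Defs.
From mathcomp Require Import all_boot all_order all_algebra.
From mathcomp Require Import all_classical all_reals all_analysis measurable_realfun.
From mathcomp Require Import ring lra.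
Set Implicit Arguments.
Unset Strict Implicit.
Unset Printing Implicit Defensive.
Import Order.TTheory GRing.Theory Num.Theory.
Import numFieldNormedType.Exports.
Local Open Scope classical_set_scope.
Local Open Scope ring_scope.

(** Let [Gam] be the right-continuous extension of gamma to R; mu is the image
    of the Lebesgue measure under [Gam].

    In a quasi-normal chart put
      N(s) = (H_p z (Gam s) - \int_a^s H_p^2 z (Gam r) dr) / 2.
    Its derivative is 0 where gamma follows H_p and - H_p^2 z / 2 > 0 where
    gamma glides, and N jumps up by 2 zeta at a reflection; hence N is
    nondecreasing. Locally, nu is the image of the Stieltjes measure dN under
    the projection which sets zeta to 0.

    For a test function a, the function
      a(Gam s) - \int_a^s H_p a (Gam r) dr - \int_]a, s] jump a dN
    has derivative 0 off B and is continuous at the points of B, which are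
    isolated: it is constant. (No almost everywhere differentiation occurs,
    since the derivatives exist at every point off B.)

    Along gamma, tau is a nonzero constant and t is an affine function of s.
    The local identities can therefore be concatenated over R, and the sum of
    the pieces of nu is locally finite.

    The transition maps between quasi-normal charts have e_d as last row and
    last column of their Jacobian on the boundary, so that zeta, the jump and
    the sign of H_p^2 z at glancing points do not depend on the chart. *)

(** For a metric of class C^1 the field H_p is merely continuous: there is no flow, and only
    derivatives along the given curve can be used. The function H_p z contains no derivative of the
    metric, so it is of class C^1. Along the curve its derivative is H_p^2 z in free motion and 0 in
    gliding, the correction along H_z being the one that cancels it. N records this discrepancy; the
    factor 1/2 is the inverse of H_z^2 p = 2 at the boundary. The same density multiplies the
    zeta-derivative of a in the gliding field, while at a reflection the jump of N cancels the
    denominator of the jump quotient. A single measure dN therefore serves both regimes. The mean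
    value theorem in zeta turns the quotient on [Hpar] and the derivative on [Gpar] into one
    relatively continuous function, hence a Borel one. Points of B are isolated but may accumulate
    at a point off B. Derivatives along the curve are therefore put as closed inequalities, which
    survive the passage to the right limits defining [Gam]. Chart independence of H_p rests on the
    symmetry of the second derivatives of C^2 chart changes. *)

Ltac clear_foralls := repeat match goal with H : forall _, _ |- _ => clear H end.
Ltac qlra := clear_foralls; lra.
Ltac qnra := clear_foralls; nra.

(** * Functions of one variable and Stieltjes measures *)

Section OneVariable.
Context {R : realType}.
Implicit Types (F G : R -> R) (a b s : R).

(** Nonnegative lower Dini derivatives from both sides, relative to [A]. The form with [e] allows
    upward jumps at [s]. *)
Definition slope_ge0 (A : set R) F s :=
  forall e : R, 0 < e -> \forall s' \near s, A s' ->
    (s' <= s -> F s' <= F s + e * (s - s')) /\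
    (s <= s' -> F s <= F s' + e * (s' - s)).

(** Fix a slope loss [e]: the points reachable from [a] with that loss have a supremum, which is
    itself reachable and cannot be smaller than [b]. Then [e] tends to 0. *)
Lemma slope_ge0_le F a b : a <= b ->
  (forall s, a <= s <= b -> slope_ge0 `[a, b] F s) -> F a <= F b.
Proof.
move=> ab sl.
suff key (e : R) : 0 < e -> F a <= F b + e * (b - a).
  apply/ler_addgt0Pr => e e0.
  (* Adding 1 keeps the denominator positive when [a = b]. *)
  have d0 : 0 < b - a + 1 by qlra.
  apply: (le_trans (key _ (divr_gt0 e0 d0))).
  rewrite lerD2l mulrAC ler_pdivrMr //; qnra.
move=> e0.
pose A := [set x | a <= x <= b /\ F a <= F x + e * (x - a)].
have Aa : A a by rewrite /A /= lexx ab subrr mulr0 addr0.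
have hsA : has_sup A by split; [exists a | exists b => x [/andP[]]].
set c := sup A.
have ac : a <= c by apply: ub_le_sup => //; exact: hsA.2.
have cb : c <= b by apply: ge_sup; [exists a | move=> x [/andP[]]].
have cab : a <= c <= b by rewrite ac cb.
have [d /= d0 Hd] := (nbhs_ballP _ _).1 (sl c cab e e0).
have Ac : F a <= F c + e * (c - a).
  have [x [Ax xc]] : exists x, A x /\ c - d < x.
    have [x Ax] := sup_adherent d0 hsA; exists x; by [].
  have xlec : x <= c by apply: ub_le_sup => //; exact: hsA.2.
  have : ball c d x by rewrite /ball /= ger0_norm; qlra.
  move/Hd => /(_ _)[|/(_ xlec) h _]; first by rewrite /= in_itv /=; case: Ax.
  case: Ax => _; qnra.
have [cltb|bc] := ltP c b; last first.
  by have -> : b = c by apply/le_anti; rewrite cb bc.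
pose y := Num.min (c + d / 2) b.
have cy : c < y by rewrite /y lt_min cltb andbT; qlra.
have yb : y <= b by rewrite /y ge_min lexx orbT.
have yd : y <= c + d / 2 by rewrite /y ge_min lexx.
have : ball c d y by rewrite /ball /= ler0_norm; qlra.
move/Hd => /(_ _)[|_ /(_ (ltW cy)) h]; first by rewrite /= in_itv /=; apply/andP; split; qlra.
have : A y by split; [apply/andP; split; qlra | qnra].
by move/(ub_le_sup hsA.2); rewrite -/c leNgt cy.
Qed.

Lemma near_ball (P : set R) s : (\forall s' \near s, P s') ->
  exists2 d : R, 0 < d & forall r, `|s - r| < d -> P r.
Proof. by move=> /nbhs_ballP[d /= d0 h]; exists d. Qed.

Lemma ball_near (P : set R) s d : 0 < d -> (forall r, `|s - r| < d -> P r) ->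
  \forall s' \near s, P s'.
Proof. by move=> d0 h; apply/nbhs_ballP; exists d. Qed.

(** [slope_ge0_le] gives monotonicity on each punctured side, so at [s] only the one-sided limits
    have to be compared with [F s], without any rate. This is the information available at a
    reflection. *)
Lemma slope_ge0_isolated F a b s d : 0 < d -> a <= s <= b ->
  (forall r, a <= r <= b -> 0 < `|s - r| < d -> slope_ge0 `[a, b] F r) ->
  (forall e : R, 0 < e -> \forall r \near s, a <= r <= b ->
     (r < s -> F r <= F s + e) /\ (s < r -> F s <= F r + e)) ->
  slope_ge0 `[a, b] F s.
Proof.
move=> d0 /andP[as_ sb] sl lim e e0.
have mono c c' : a <= c -> c <= c' -> c' <= b ->
    (forall r, c <= r <= c' -> 0 < `|s - r| < d) -> F c <= F c'.
  move=> ac cc' c'b h; apply: slope_ge0_le => // r rc.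
  have rab : a <= r <= b by move/andP: rc => [? ?]; apply/andP; split; qlra.
  have := sl r rab (h r rc) => H e' e'0.
  apply: filterS (H e' e'0) => x /= Hx; rewrite in_itv /= => /andP[xc xc'].
  by apply: Hx; rewrite in_itv /=; apply/andP; split; qlra.
apply: (ball_near d0) => s' s'd; rewrite /= in_itv /= => /andP[as' s'b]; split.
  rewrite le_eqVlt => /predU1P[->|s's]; first by qnra.
  have es : 0 <= e * (s - s') by apply: mulr_ge0; qlra.
  suff : F s' <= F s by move=> ?; qlra.
  apply/ler_addgt0Pr => e' e'0.
  have [d' d'0 Hd'] := near_ball (lim e' e'0).
  (* An intermediate point, close enough to [s] for [lim]; monotonicity on [[s', y]] carries the
     estimate back to [s']. *)
  pose y := Num.max s' (s - d' / 2).
  have ys : y < s by rewrite /y gt_max s's /=; qlra.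
  have s'y : s' <= y by rewrite /y le_max lexx.
  have dy : s - d' / 2 <= y by rewrite /y le_max lexx orbT.
  have yd' : `|s - y| < d' by rewrite ger0_norm; qlra.
  have yab : a <= y <= b by apply/andP; split; qlra.
  have [h _] := Hd' y yd' yab.
  apply: le_trans (h ys); apply: mono => //; first by qlra.
  move=> r /andP[r1 r2]; move: s'd; rewrite !ger0_norm; [|qlra..].
  by move=> ?; apply/andP; split; qlra.
rewrite le_eqVlt => /predU1P[<-|s's]; first by qnra.
have es : 0 <= e * (s' - s) by apply: mulr_ge0; qlra.
suff : F s <= F s' by move=> ?; qlra.
apply/ler_addgt0Pr => e' e'0.
have [d' d'0 Hd'] := near_ball (lim e' e'0).
pose y := Num.min s' (s + d' / 2).
have ys : s < y by rewrite /y lt_min s's /=; qlra.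
have s'y : y <= s' by rewrite /y ge_min lexx.
have dy : y <= s + d' / 2 by rewrite /y ge_min lexx orbT.
have yd' : `|s - y| < d' by rewrite ler0_norm; qlra.
have yab : a <= y <= b by apply/andP; split; qlra.
have [_ h] := Hd' y yd' yab.
apply: le_trans (h ys) _; rewrite lerD2r; apply: mono => //; first by qlra.
move=> r /andP[r1 r2]; move: s'd; rewrite !ler0_norm; [|qlra..].
by move=> ?; apply/andP; split; qlra.
Qed.

Definition flat (A : set R) F s :=
  forall e : R, 0 < e -> \forall s' \near s, A s' -> `|F s' - F s| <= e * `|s' - s|.

(** Both [F] and [- F] satisfy the hypotheses of [slope_ge0_le], the exceptional points being
    absorbed by [slope_ge0_isolated]. *)
Lemma flat_eq F a b : a <= b ->
  (forall s, a <= s <= b -> flat `[a, b] F s \/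
     (exists2 d, 0 < d &
        forall r, a <= r <= b -> 0 < `|s - r| < d -> flat `[a, b] F r) /\
     (forall e : R, 0 < e -> \forall r \near s, a <= r <= b -> `|F r - F s| <= e)) ->
  F a = F b.
Proof.
move=> ab H.
have flat_slope G s : flat `[a, b] G s -> slope_ge0 `[a, b] G s.
  move=> fl e e0; apply: filterS (fl e e0) => s' /= + s'ab => /(_ s'ab) h.
  split=> ss'; move: h.
    rewrite (ler0_norm (_ : s' - s <= 0)) ?subr_le0 // ler_norml => /andP[? ?]; qnra.
  rewrite (ger0_norm (_ : 0 <= s' - s)) ?subr_ge0 // ler_norml => /andP[? ?]; qnra.
have flatN G s : flat `[a, b] G s -> flat `[a, b] (fun x => - G x) s.
  move=> fl e e0; apply: filterS (fl e e0) => s' /= h s'ab.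
  by rewrite -opprD normrN; exact: h.
apply/le_anti/andP; split; last (rewrite -lerN2; pose F' x := - F x;
    rewrite -/(F' a) -/(F' b)); apply: slope_ge0_le => // s sab.
  have [/flat_slope//|[[d d0 fl] lim]] := H s sab.
  apply: (slope_ge0_isolated d0) => // [r rab rs|e e0].
    exact/flat_slope/fl.
  apply: filterS (lim e e0) => r + rab => /(_ rab).
  by rewrite ler_norml => /andP[? ?]; split => _; qlra.
have [/flatN/flat_slope//|[[d d0 fl] lim]] := H s sab.
apply: (slope_ge0_isolated d0) => // [r rab rs|e e0].
  exact/flat_slope/flatN/fl.
apply: filterS (lim e e0) => r + rab => /(_ rab).
by rewrite /F' ler_norml => /andP[? ?]; split => _; qlra.
Qed.

(** Stated for an arbitrary measure: it is applied to Lebesgue measure with [h] and to the Stieltjes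
    measure with [j]. *)
Lemma Rintegral_near_cst (m : {measure set (measurableTypeR R) -> \bar R})
    (E : set R) (j : R -> R) (M j0 C e : R) : measurable E -> m E = M%:E ->
  measurable_fun E j -> (forall r, E r -> `|j r| <= C) ->
  (forall r, E r -> `|j r - j0| <= e) ->
  m.-integrable E (EFin \o j) /\ `|\int[m]_(r in E) j r - j0 * M| <= e * M.
Proof.
move=> mE mEM mj jC je.
have fin : (m E < +oo)%E by rewrite mEM ltry.
have ij : m.-integrable E (EFin \o j).
  apply: measurable_bounded_integrable => //.
  by exists C; split; [exact: num_real | move=> x Cx r Er; apply: le_trans (jC r Er) (ltW Cx)].
split=> //.
have ic (c : R) : m.-integrable E (EFin \o (fun=> c)).
  apply: measurable_bounded_integrable => //.
  by exists `|c|; split; [exact: num_real | move=> x cx r _ /=; exact: ltW].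
have -> : j0 * M = \int[m]_(r in E) j0 by rewrite Rintegral_cst // [m E]mEM.
rewrite -RintegralB //.
have id_ : m.-integrable E (EFin \o (fun r => j r - j0)).
  by rewrite (_ : _ \o _ = ((EFin \o j) \- (EFin \o (fun=> j0)))%E) //; exact: integrableB.
apply: le_trans (le_normr_Rintegral _ id_) _ => //.
have -> : e * M = \int[m]_(r in E) e by rewrite Rintegral_cst // [m E]mEM.
apply: le_Rintegral => //.
exact: integrable_norm id_.
Qed.

End OneVariable.

(** * Balance of a function against a Lebesgue and a Stieltjes integral *)

Section Balance.
Context {R : realType}.
Local Notation lam := (@lebesgue_measure R).
Local Notation oc c d := (`]c, d]%classic : set (measurableTypeR R)).

Definition approx1 (F : R -> R) (s l : R) := forall e : R, 0 < e ->
  \forall s' \near s, `|F s' - F s - l * (s' - s)| <= e * `|s' - s|.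

Variables (m : {measure set (measurableTypeR R) -> \bar R}).
Variables (a b C : R) (Z : set (measurableTypeR R)) (j h f N : R -> R).

(** [m] stands for dN, all of whose mass is on [Z]. The integrand [j] is controlled on [Z] only,
    because it will be the jump, which has no meaning away from the boundary. *)
Record balance_data : Prop := BalanceData {
  bal_ab : a <= b;
  bal_mZ : measurable Z;
  bal_mN : forall c d, a <= c -> c <= d -> d <= b ->
    m (oc c d `&` Z) = (N d - N c)%:E;
  bal_mj : measurable_fun (oc a b `&` Z) j;
  bal_jC : forall r, (oc a b `&` Z) r -> `|j r| <= C;
  bal_mh : measurable_fun (oc a b) h;
  bal_hC : forall r, oc a b r -> `|h r| <= C }.

Hypothesis D : balance_data.

(** Where [N' = 0], boundedness of [j] is enough. Its continuity is demanded only where gliding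
    gives [N] a nonzero slope. *)
Definition balance_regular s := exists f' N' : R,
  [/\ approx1 f s f', approx1 N s N',
      forall e : R, 0 < e -> \forall r \near s, `|h r - h s| <= e,
      f' = h s + N' * j s &
      N' = 0 \/ forall e : R, 0 < e -> \forall r \near s,
        (oc a b `&` Z) r -> `|j r - j s| <= e].

(** [fl] and [Nl] are left limits. As no other point of [Z] is near [s], the measure reduces there
    to an atom at [s]. *)
Definition balance_jump s := exists d fl Nl : R,
  [/\ 0 < d /\ Z s,
      forall r, a <= r <= b -> 0 < `|s - r| < d -> ~ Z r /\ balance_regular r,
      forall e : R, 0 < e -> \forall r \near s, r < s ->
        `|f r - fl| <= e /\ `|N r - Nl| <= e,
      forall e : R, 0 < e -> \forall r \near s, s < r -> `|f r - f s| <= e &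
      f s - fl = (N s - Nl) * j s].

Lemma bal_moc c d : measurable (oc c d). Proof. exact: measurable_itv. Qed.
Lemma bal_mocZ c d : measurable (oc c d `&` Z). Proof. by apply: measurableI; [exact: bal_moc|exact: bal_mZ D]. Qed.

Lemma bal_lam_oc c d : c <= d -> lam (oc c d) = (d - c)%:E.
Proof.
move=> cd; rewrite lebesgue_measure_itv /= lte_fin EFinD.
by case: ltgtP cd => // ->; rewrite -EFinD subrr.
Qed.

Lemma bal_sub c d : a <= c -> d <= b -> oc c d `<=` oc a b.
Proof.
have ab := bal_ab D.
move=> ac db r /=; rewrite !in_itv /= => /andP[cr rd].
by apply/andP; split; qlra.
Qed.

Lemma bal_Ih c d : a <= c -> c <= d -> d <= b -> forall h0 e : R,
  (forall r, c < r -> r <= d -> `|h r - h0| <= e) ->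
  `|\int[lam]_(r in oc c d) h r - h0 * (d - c)| <= e * (d - c).
Proof.
move=> ac cd db h0 e he.
apply: (@Rintegral_near_cst _ lam (oc c d) h (d - c) h0 C e _ _ _ _ _).2 => //.
- exact: bal_lam_oc.
- exact: measurable_funS (bal_moc a b) (bal_sub ac db) (bal_mh D).
- by move=> r /(bal_sub ac db)/(bal_hC D).
- by move=> r /=; rewrite in_itv /= => /andP[]; exact: he.
Qed.

Lemma bal_Ij c d : a <= c -> c <= d -> d <= b -> forall j0 e : R,
  (forall r, c < r -> r <= d -> Z r -> `|j r - j0| <= e) ->
  `|\int[m]_(r in oc c d `&` Z) j r - j0 * (N d - N c)| <= e * (N d - N c).
Proof.
move=> ac cd db j0 e je.
apply: (@Rintegral_near_cst _ m (oc c d `&` Z) j (N d - N c) j0 C e _ _ _ _ _).2 => //.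
- exact: bal_mocZ.
- exact: (bal_mN D).
- by apply: measurable_funS (bal_mocZ a b) _ (bal_mj D); apply: setSI; exact: bal_sub.
- by move=> r [/(bal_sub ac db) ? ?]; exact: (bal_jC D).
- by move=> r [] /=; rewrite in_itv /= => /andP[? ?] ?; exact: je.
Qed.

(* [bal_Phi] has derivative 0 at the regular points and is continuous at the jumps, hence constant. *)
Definition bal_Phi s := f s - \int[lam]_(r in oc a s) h r - \int[m]_(r in oc a s `&` Z) j r.

Lemma bal_PhiB c d : a <= c -> c <= d -> d <= b -> bal_Phi d - bal_Phi c =
  f d - f c - \int[lam]_(r in oc c d) h r - \int[m]_(r in oc c d `&` Z) j r.
Proof.
have ab := bal_ab D.
move=> ac cd db.
have U : oc a d = oc a c `|` oc c d.
  apply/seteqP; split=> r /=; rewrite !in_itv /=.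
    by move=> /andP[ar rd]; case: (leP r c) => rc; [left|right]; rewrite ?ar ?rc ?rd.
  by case=> /andP[? ?]; apply/andP; split; qlra.
have dis : [disjoint oc a c & oc c d].
  apply/disj_setPS => r /= []; rewrite !in_itv /= => /andP[_ rc] /andP[cr _].
  by move: (lt_le_trans cr rc); rewrite ltxx.
have ih : lam.-integrable (oc a c `|` oc c d) (EFin \o h).
  rewrite -U; apply: (@Rintegral_near_cst _ lam (oc a d) h (d - a) 0 C C _ _ _ _ _).1 => //.
  - by apply: bal_lam_oc; qlra.
  - by apply: measurable_funS (bal_moc a b) _ (bal_mh D); apply: bal_sub => //; qlra.
  - by move=> r /bal_sub; move/(_ (lexx _) db)/(bal_hC D).
  - by move=> r /bal_sub; rewrite subr0; move/(_ (lexx _) db)/(bal_hC D).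
have ij : m.-integrable ((oc a c `&` Z) `|` (oc c d `&` Z)) (EFin \o j).
  rewrite -setIUl -U.
  apply: (@Rintegral_near_cst _ m (oc a d `&` Z) j (N d - N a) 0 C C _ _ _ _ _).1 => //.
  - exact: bal_mocZ.
  - by apply: (bal_mN D); qlra.
  - by apply: measurable_funS (bal_mocZ a b) _ (bal_mj D); apply: setSI; apply: bal_sub => //; qlra.
  - by move=> r [/(bal_sub (lexx _) db) ? ?]; exact: (bal_jC D).
  - by move=> r [/(bal_sub (lexx _) db) ? ?]; rewrite subr0; exact: (bal_jC D).
rewrite /bal_Phi U setIUl Rintegral_setU // Rintegral_setU //; [qlra|exact: bal_mocZ|exact: bal_mocZ|].
by apply/disj_setPS => r [[r1 _] [r2 _]]; move/disj_setPS : dis; apply; split; [exact: r1|].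
Qed.

Lemma bal_C0 s : a <= s <= b -> a < b -> 0 <= C.
Proof.
move=> _ ab'; apply: le_trans (bal_hC D (_ : oc a b b)); rewrite ?normr_ge0 //=.
by rewrite in_itv /= ab' lexx.
Qed.

(** Over a short interval of length L, [f] grows by [f' * L], the first integral by [h s * L] and
    the second by [j s] times the increment of [N], all up to o(L); the relation between [f'], [h s]
    and [N'] cancels the main terms. *)
Lemma bal_flat_regular s : a < b -> a <= s <= b -> balance_regular s -> flat `[a, b] bal_Phi s.
Proof.
have ab := bal_ab D.
move=> ab' sab [f' [N' [fs Ns hs f'E jN]]] e e0.
have hC0 := bal_C0 sab ab'.
(* [K] adds up the coefficients of the final estimate: two errors [e1] from [f] and [h], and the
   bound of the next claim for the terms in [j]. *)
pose K := 3 + C + `|N'| + `|j s|.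
have K0 : 3 <= K by rewrite /K; have := normr_ge0 N'; have := normr_ge0 (j s); qlra.
pose e1 := Num.min 1 (e / K).
have e10 : 0 < e1 by rewrite /e1 lt_min ltr01 /=; apply: divr_gt0 => //; qlra.
have e11 : e1 <= 1 by rewrite /e1 ge_min lexx.
have e1K : e1 * K <= e by rewrite -ler_pdivlMr ?/e1 ?ge_min ?lexx ?orbT //; qlra.
(* If [N' = 0], the increment of [N] is o(L), so approximating [j] by 0 with the crude error [C]
   suffices. Otherwise [j] is continuous and [j s] approximates it with error [e1]. *)
have jN' : exists j0 ej : R, [/\ 0 <= ej, N' * j s = N' * j0,
    ej * (`|N'| + e1) + `|j0| * e1 <= e1 * (1 + C + `|N'| + `|j s|) &
    \forall r \near s, (oc a b `&` Z) r -> `|j r - j0| <= ej].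
  case: jN => [->|jc].
    exists 0, C; split=> //; rewrite ?mul0r ?normr0 //.
    - have := normr_ge0 (j s); rewrite add0r mul0r addr0; qnra.
    - by apply: (ball_near ltr01) => r _ /(bal_jC D); rewrite subr0.
  exists (j s), e1; split => //; [exact: ltW | have := normr_ge0 N'; qnra | exact: jc].
have [j0 [ej [ej0 j0E ejb jnear]]] := jN'.
have : \forall s' \near s, [/\ `|f s' - f s - f' * (s' - s)| <= e1 * `|s' - s|,
   `|N s' - N s - N' * (s' - s)| <= e1 * `|s' - s|, `|h s' - h s| <= e1 &
   (oc a b `&` Z) s' -> `|j s' - j0| <= ej].
  by near=> s'; split; near: s'; [exact: fs|exact: Ns|exact: hs|exact: jnear].
move=> /near_ball[d d0 Hd]; apply: (ball_near d0) => s' s'd.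
rewrite /= in_itv /= => s'ab.
have [fs' Ns' _ _] := Hd s' s'd.
have step c c' : a <= c -> c <= c' -> c' <= b ->
    (forall r, c < r -> r <= c' -> `|s - r| < d) ->
    `|f c' - f c - f' * (c' - c)| <= e1 * (c' - c) ->
    `|N c' - N c - N' * (c' - c)| <= e1 * (c' - c) ->
    `|bal_Phi c' - bal_Phi c| <= e * (c' - c).
  move=> ac cc' c'b near_s hf hN.
  rewrite bal_PhiB //.
  have h1 : forall r, c < r -> r <= c' -> `|h r - h s| <= e1.
    by move=> r cr rc'; have [] := Hd r (near_s r cr rc').
  have h2 : forall r, c < r -> r <= c' -> Z r -> `|j r - j0| <= ej.
    move=> r cr rc' Zr; have [_ _ _] := Hd r (near_s r cr rc'); apply; split => //=.
    by rewrite in_itv /=; apply/andP; split; qlra.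
  have {h1} := bal_Ih ac cc' c'b h1; have {h2} := bal_Ij ac cc' c'b h2.
  set I := \int[lam]_(r in _) _; set J := \int[m]_(r in _) _ => hJ hI.
  have D0 : 0 <= c' - c by qlra.
  have hN2 : N c' - N c <= (`|N'| + e1) * (c' - c).
    move: hN; rewrite ler_norml => /andP[_ hN].
    have : N' * (c' - c) <= `|N'| * (c' - c) by apply: ler_wpM2r => //; exact: ler_norm.
    qnra.
  have hj0 : `|j0 * (N c' - N c - N' * (c' - c))| <= `|j0| * (e1 * (c' - c)).
    by rewrite normrM; apply: ler_wpM2l.
  have hJ2 : ej * (N c' - N c) <= ej * ((`|N'| + e1) * (c' - c)) by apply: ler_wpM2l.
  have -> : f c' - f c - I - J = (f c' - f c - f' * (c' - c)) -
     (I - h s * (c' - c)) - (J - j0 * (N c' - N c)) - j0 * (N c' - N c - N' * (c' - c)).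
    by rewrite f'E j0E; ring.
  apply: le_trans (ler_normB _ _) _.
  apply: (@le_trans _ _ (e1 * (c' - c) + e1 * (c' - c) + ej * (N c' - N c) + `|j0| * (e1 * (c' - c)))).
    apply: lerD => //; apply: le_trans (ler_normB _ _) _; apply: lerD => //.
    by apply: le_trans (ler_normB _ _) _; apply: lerD.
  apply: (@le_trans _ _ ((2 * e1 + (ej * (`|N'| + e1) + `|j0| * e1)) * (c' - c))).
    by qnra.
  apply: ler_wpM2r => //; apply: le_trans e1K; rewrite /K; qnra.
move/andP: s'ab => [as' s'b]; move/andP: sab => [as_ sb].
have [ss'|s's] := leP s s'.
  rewrite (ger0_norm (_ : 0 <= s' - s)) ?subr_ge0 // in fs' Ns' *.
  apply: step => // r sr rs'; move: s'd; rewrite !ler0_norm; qlra.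
have nE : `|s' - s| = s - s' by rewrite ltr0_norm ?subr_lt0 // opprB.
rewrite nE in fs' Ns' *; rewrite [`|bal_Phi _ - _|]distrC.
have flip (F : R -> R) (l : R) : `|F s' - F s - l * (s' - s)| <= e1 * (s - s') ->
    `|F s - F s' - l * (s - s')| <= e1 * (s - s').
  by move=> H; have -> : F s - F s' - l * (s - s') = - (F s' - F s - l * (s' - s)); [ring|rewrite normrN].
apply: step; [exact: as'|exact: ltW|exact: sb| |exact: flip|exact: flip].
by move=> r sr rs'; move: s'd; rewrite !ger0_norm; qlra.
Unshelve. all: by end_near.
Qed.

(** At a jump [flat_eq] only asks for continuity of [bal_Phi]: on the left the atom contributes
    [(N s - Nl) * j s], which is the jump of [f], and on the right there is no mass nearby. *)
Lemma balance :
  (forall s, a <= s <= b -> balance_regular s \/ balance_jump s) ->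
  f b - f a = \int[lam]_(r in oc a b) h r + \int[m]_(r in oc a b `&` Z) j r.
Proof.
have ab := bal_ab D.
move=> H; have [ab'|ba] := ltP a b; last first.
  have <- : a = b by apply/le_anti; rewrite ab ba.
  by rewrite subrr (_ : oc a a = set0) ?set0I ?Rintegral_set0 ?addr0 // set_itvoc0.
suff : bal_Phi a = bal_Phi b.
  by move/esym/eqP; rewrite -subr_eq0 bal_PhiB // => /eqP; qlra.
apply: flat_eq => // s sab; case: (H s sab) => [/(bal_flat_regular ab' sab)|]; first by left.
move=> [d [fl [Nl [[d0 Zs] reg left right_ jumpE]]]]; right; split.
  by exists d => // r rab rs; apply: bal_flat_regular => //; exact: (reg r rab rs).2.
move=> e e0.
have hC0 := bal_C0 sab ab'.
(* The errors are [e1] from [f], [C * e1] from [h], the interval being shorter than [e1], and [e1]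
   times the absolute value of [j s] from [N]. *)
pose e1 := e / (3 + C + `|j s|).
have K0 : 0 < 3 + C + `|j s| by have := normr_ge0 (j s); qlra.
have e10 : 0 < e1 by apply: divr_gt0.
have e1K : e1 * (3 + C + `|j s|) = e by rewrite /e1 divfK // gt_eqF.
have [d1 d10 Hl] := near_ball (left e1 e10).
have [d2 d20 Hr] := near_ball (right_ e1 e10).
pose d' := Num.min (Num.min d e1) (Num.min d1 d2).
have d'0 : 0 < d' by rewrite /d' !lt_min d0 e10 d10 d20.
apply: (ball_near d'0) => r; rewrite /d' !lt_min => /andP[/andP[rd re] /andP[rd1 rd2]] rab.
move: sab rab => /andP[as_ sb] /andP[ar rb].
have hh c c' x : (oc a b `&` [set r | c < r /\ r <= c']) x -> `|h x - 0| <= C.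
  by rewrite subr0 => -[/(bal_hC D)].
have [rs|sr|->] := ltgtP r s; last by rewrite subrr normr0 ltW.
- have [hf hN] := Hl r rd1 rs.
  rewrite distrC bal_PhiB //; last exact: ltW.
  have h1 x : r < x -> x <= s -> `|h x - 0| <= C.
    by move=> rx xs; rewrite subr0; apply: (bal_hC D); rewrite /= in_itv /=; apply/andP; split; qlra.
  (* The tolerance is zero because [s] is the only point of [Z] in []r, s]]. *)
  have h2 x : r < x -> x <= s -> Z x -> `|j x - j s| <= 0.
    rewrite le_eqVlt => rx /predU1P[->|xs Zx]; first by rewrite subrr normr0.
    have [] := reg x _ _; first by apply/andP; split; qlra.
      by move: rd; rewrite !ger0_norm; [move=> ?; apply/andP; split; qlra|qlra|qlra].
    by move=> /(_ Zx).
  have := bal_Ih ar (ltW rs) sb h1; have := bal_Ij ar (ltW rs) sb h2.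
  set I := \int[lam]_(r in _) _; set J := \int[m]_(r in _) _.
  rewrite !mul0r subr0 normr_le0 subr_eq0 => /eqP -> hI.
  have -> : f s - f r - I - j s * (N s - N r) = - (f r - fl) - I + j s * (N r - Nl).
    have -> : f s = fl + (N s - Nl) * j s by rewrite -jumpE; ring.
    ring.
  apply: le_trans (ler_normD _ _) _; apply: le_trans (lerD (ler_normB _ _) (lexx _)) _.
  rewrite normrN normrM.
  have hI2 : C * (s - r) <= C * e1.
    by apply: ler_wpM2l => //; rewrite ltW //; move: re; rewrite ger0_norm //; qlra.
  have : `|j s| * `|N r - Nl| <= `|j s| * e1 by apply: ler_wpM2l.
  rewrite -e1K; qlra.
- have hf := Hr r rd2 sr.
  rewrite bal_PhiB //; last exact: ltW.
  have h1 x : s < x -> x <= r -> `|h x - 0| <= C.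
    by move=> rx xs; rewrite subr0; apply: (bal_hC D); rewrite /= in_itv /=; apply/andP; split; qlra.
  have h2 x : s < x -> x <= r -> Z x -> `|j x - 0| <= 0.
    move=> rx xs Zx.
    have [] := reg x _ _; first by apply/andP; split; qlra.
      by move: rd; rewrite !ler0_norm; [move=> ?; apply/andP; split; qlra|qlra|qlra].
    by move=> /(_ Zx).
  have := bal_Ih as_ (ltW sr) rb h1; have := bal_Ij as_ (ltW sr) rb h2.
  set I := \int[lam]_(r in _) _; set J := \int[m]_(r in _) _.
  rewrite !mul0r !subr0 normr_le0 => /eqP -> hI.
  rewrite subr0; apply: le_trans (ler_normB _ _) _.
  have hI2 : C * (r - s) <= C * e1.
    by apply: ler_wpM2l => //; rewrite ltW //; move: re; rewrite ler0_norm //; qlra.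
  rewrite -e1K; have : 0 <= e1 * `|j s| by apply: mulr_ge0 => //; exact: ltW.
  qlra.
Qed.

End Balance.

Lemma lebesgue_stieltjes_measure_ocitv (R : realType) (F : cumulative R R) (c d : R) :
  c <= d -> lebesgue_stieltjes_measure F `]c, d]%classic = (F d - F c)%:E.
Proof.
move=> cd; rewrite /lebesgue_stieltjes_measure /measure_extension /=.
rewrite measurable_mu_extE /=; last exact: is_ocitv.
by rewrite wlength_itv_bnd.
Qed.

(** * The Stieltjes measure of a nondecreasing function, carried by a given set *)

Section Stieltjes.
Context {R : realType}.
Variables (N : R -> R) (a b : R) (Z : set (measurableTypeR R)).
Hypotheses (ab : a <= b) (mZ : measurable Z).
Hypothesis Nnd : forall c d, a <= c -> c <= d -> d <= b -> N c <= N d.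
Hypothesis Nrc : forall s, a <= s -> s < b -> forall e : R, 0 < e ->
  \forall r \near s, s < r -> `|N r - N s| <= e.
Hypothesis Ncst : forall s, a < s -> s <= b -> ~ Z s ->
  \forall r \near s, a <= r <= b -> N r = N s.

(** Freezing [N] outside [[a, b]] produces a nondecreasing right-continuous function on the whole
    line, as the Stieltjes construction requires. *)
Let clamp (s : R) := Num.max a (Num.min s b).
Let F s := N (clamp s).

Let clamp_itv s : a <= clamp s <= b.
Proof. by rewrite /clamp le_max lexx /= ge_max ab ge_min lexx orbT. Qed.

Let clampE s : a <= s -> s <= b -> clamp s = s.
Proof. by move=> as_ sb; rewrite /clamp (min_idPl sb) (max_idPr as_). Qed.

Let Fnd : {homo F : x y / x <= y}.
Proof.
move=> x y xy; rewrite /F; have /andP[? ?] := clamp_itv x; have /andP[? ?] := clamp_itv y.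
apply: Nnd => //; rewrite /clamp ge_max le_max lexx /= le_max; apply/orP; right.
by rewrite le_min !ge_min xy lexx orbT.
Qed.

Let Frc : right_continuous F.
Proof.
move=> x; apply/cvgrPdist_le => /= e e0.
have [xa|ax] := ltP x a.
  near=> y; rewrite /F (_ : clamp y = clamp x) ?subrr ?normr0 ?ltW //.
  have ya : y < a by near: y; apply: nbhs_right_lt.
  by rewrite /clamp (max_idPl (_ : _ <= a)) ?(max_idPl (_ : _ <= a)) // ge_min ltW.
have [xb|bx] := ltP x b.
  near=> y.
  have xy : x < y by near: y; exact: nbhs_right_gt.
  have yb : y < b by near: y; exact: nbhs_right_lt.
  rewrite /F !clampE //; try lra.
  rewrite distrC; near: y; have := Nrc ax xb e0.
  by move=> H; rewrite near_withinE; exact: H.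
near=> y.
have xy : x < y by near: y; exact: nbhs_right_gt.
by rewrite /F (_ : clamp y = clamp x) ?subrr ?normr0 ?ltW // /clamp (min_idPr bx) (min_idPr (_ : b <= y)) //; lra.
Unshelve. all: by end_near. Qed.

Let Fcum := isCumulative.Build R _ R F Fnd Frc.
Let F' : cumulative R R := HB.pack F Fcum.
Local Notation m := (lebesgue_stieltjes_measure F').
Local Notation oc c d := (`]c, d]%classic : set (measurableTypeR R)).

Let moc c d : c <= d -> m (oc c d) = (F d - F c)%:E.
Proof. exact: lebesgue_stieltjes_measure_ocitv. Qed.

(** A Lindelof argument: every point off [Z] lies in an interval with rational ends on which [N] is
    constant. Such an interval has no mass, and there are countably many of them, enumerated here by
    [unpickle]. *)
Let null : m (oc a b `\` Z) = 0%E.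
Proof.
have mD : measurable (oc a b `\` Z) by apply: measurableD => //; exact: measurable_itv.
apply/negligibleP => //.
pose P (pq : rat * rat) := forall r s : R, a <= r <= b -> a <= s <= b ->
   ratr pq.1 <= r <= ratr pq.2 -> ratr pq.1 <= s <= ratr pq.2 -> N r = N s.
pose S (pq : rat * rat) := oc (Num.max a (ratr pq.1)) (Num.min b (ratr pq.2)).
pose E (k : nat) : set (measurableTypeR R) :=
  if unpickle k is Some pq then (if pselect (P pq) then S pq else set0) else set0.
suff nE : m.-negligible (\bigcup_k E k).
  apply: negligibleS nE.
  move=> x [/=]; rewrite in_itv /= => /andP[ax xb] Zx.
  have [d d0 Hd] := near_ball (Ncst ax xb Zx).
  have xd : x - d < x by lra.
  have dx : x < x + d by lra.
  have [p /[!in_itv] /= /andP[p1 p2]] := rat_in_itvoo xd.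
  have [q /[!in_itv] /= /andP[q1 q2]] := rat_in_itvoo dx.
  exists (pickle (p, q)); first exact: I.
  rewrite /E pickleK.
  case: (pselect (P (p, q))) => [Ppq|nP] /=.
    by rewrite /S /= in_itv /= gt_max ax p2 le_min xb ltW.
  exfalso; apply: nP.
  move=> r s rab sab /= /andP[? ?] /andP[? ?].
  by rewrite (Hd r) ?(Hd s) // ltr_norml; apply/andP; split; lra.
apply: negligible_bigcup => k; rewrite /E.
case: unpickle => [pq|]; last exact: negligible_set0.
case: (pselect (P pq)) => [Ppq|nP] /=; last exact: negligible_set0.
apply/negligibleP; first exact: measurable_itv.
rewrite /S; set u := Num.max _ _; set v := Num.min _ _.
have [uv|vu] := leP u v; last by rewrite (_ : oc u v = set0) ?measure0 // set_itv_ge // bnd_simp -leNgt ltW.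
suff Fuv : F v = F u by apply: (etrans (moc uv)); rewrite Fuv subrr.
have au : a <= u by rewrite /u le_max lexx.
have pu : ratr pq.1 <= u by rewrite /u le_max lexx orbT.
have vb : v <= b by rewrite /v ge_min lexx.
have vq : v <= ratr pq.2 by rewrite /v ge_min lexx orbT.
by rewrite /F !clampE //; [apply: Ppq; apply/andP; split; lra|lra..].
Qed.

(** By [null], restricting to [Z] loses no mass; afterwards the measure ignores the parameters to
    which no boundary point is attached. *)
Lemma stieltjes_measure_exists :
  exists2 m : {measure set (measurableTypeR R) -> \bar R},
    (m setT < +oo)%E /\ m (~` (oc a b `&` Z)) = 0%E &
  forall c d, a <= c -> c <= d -> d <= b -> m (oc c d `&` Z) = (N d - N c)%:E.
Proof.
have mab : measurable (oc a b `&` Z) by apply: measurableI => //; exact: measurable_itv.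
exists (mrestr m mab).
  split; last by rewrite /= /mrestr setICl measure0.
  rewrite /= /mrestr setTI; apply: (@le_lt_trans _ _ (m (oc a b))).
    by apply: le_measure; rewrite ?inE //; exact: measurable_itv.
  by rewrite moc // ltry.
move=> c d ac cd db; rewrite /= /mrestr.
have -> : oc c d `&` Z `&` (oc a b `&` Z) = oc c d `\` (oc a b `\` Z).
  apply/seteqP; split => r /=; rewrite !in_itv /=.
    by move=> [[? Zr] [? _]]; split => // -[].
  move=> [/andP[cr rd] H]; have rab : a < r <= b by apply/andP; split; lra.
  by rewrite cr rd rab; have [Zr|nZr] := pselect (Z r); [|case: H].
have mD : measurable (oc a b `\` Z) by apply: measurableD => //; exact: measurable_itv.
have mcd : measurable (oc c d) by exact: measurable_itv.
have fcd : (m (oc c d) < +oo)%E by rewrite moc // ltry.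
have h0 : m (oc c d `&` (oc a b `\` Z)) = 0%E.
  apply/eqP; rewrite -measure_le0 -null; apply: le_measure; rewrite ?inE //.
  by apply: measurableI.
transitivity (m (oc c d) - m (oc c d `&` (oc a b `\` Z)))%E; first exact: measureD.
rewrite h0 sube0 moc // /F !clampE //; lra.
Qed.

End Stieltjes.

(** * Differential calculus in several variables *)

Section C1Functions.
Context {R : realType}.
Implicit Types V W : normedModType R.

Lemma linear_ex (U V : lmodType R) (f : U -> V) : linear f ->
  exists L : {linear U -> V}, L = f :> (U -> V).
Proof.
move=> lin; pose lM := GRing.isLinear.Build _ _ _ _ _ lin.
by pose L : {linear U -> V} := HB.pack f lM; exists L.
Qed.

Lemma near_eq_is_diff V W (f g : V -> W) x : (\forall y \near x, f y = g y) ->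
  differentiable f x -> is_diff x g ('d f x).
Proof.
move=> fg df.
have gx : g x = f x by rewrite (nbhs_singleton fg).
have H : g \o shift x = cst (g x) + 'd f x +o_ 0 id.
  apply/eqaddoP => e e0.
  have := diff_locally df; move=> /eqaddoP /(_ e e0).
  have fg0 : \forall y \near (0 : V), f (y + x) = g (y + x).
    have c : y + x @[y --> (0 : V)] --> x.
      by rewrite -[X in _ --> X]add0r; apply: cvgD; [exact: cvg_id|exact: cvg_cst].
    exact: (c _ fg).
  move=> H; near=> y.
  have E : f (y + x) = g (y + x) by near: y.
  suff -> : (g \o shift x - (cst (g x) + 'd f x)) y = (f \o shift x - (cst (f x) + 'd f x)) y.
    by near: y; exact: H.
  by rewrite -[LHS]/(g (y + x) - (g x + 'd f x y)) -E gx.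
have dE : 'd g x = 'd f x :> (V -> W) by apply: diff_unique => //; exact: diff_continuous.
by apply: DiffDef => //; apply/diff_locallyP; rewrite dE; split => //; exact: diff_continuous.
Unshelve. all: by end_near. Qed.

(** Pointwise form of [C1on]. It depends only on the germ of [f], which lets sums, products,
    inverses and coordinate expressions be treated one point at a time. *)
Definition C1pt V W (f : V -> W) (x : V) := (\forall y \near x, differentiable f y) /\
  forall v, {for x, continuous (fun y => 'd f y v)}.

Lemma C1pt_diff V W (f : V -> W) x : C1pt f x -> differentiable f x.
Proof. by move=> [/nbhs_singleton]. Qed.

Lemma C1pt_near V W (f g : V -> W) x : (\forall y \near x, f y = g y) ->
  C1pt f x -> C1pt g x.
Proof.
move=> fg [df dc].
have fg2 : \forall y \near x, \forall z \near y, f z = g z by exact: near_join fg.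
have key : \forall y \near x, is_diff y g ('d f y).
  by near=> y; apply: near_eq_is_diff; near: y.
split; first by apply: filterS key => y [].
move=> v; have E : \forall y \near x, 'd f y v = 'd g y v.
  by apply: filterS key => y [_ ->].
rewrite /prop_for /continuous_at -(nbhs_singleton E).
by apply: cvg_trans (dc v); apply: near_eq_cvg; apply: filterS E => y ->.
Unshelve. all: by end_near. Qed.

Lemma C1pt_cst V W (c : W) (x : V) : C1pt (fun=> c) x.
Proof.
split; first by apply: nearW => y; exact: differentiable_cst.
move=> v; rewrite (_ : (fun y => _) = cst 0); first exact: cst_continuous.
by apply/funext => y; rewrite (diff_cst c y).
Qed.

Lemma C1pt_lin V W (L : {linear V -> W}) x : continuous L -> C1pt L x.
Proof.
move=> cL; split; first by apply: nearW => y; exact: linear_differentiable.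
move=> v; rewrite (_ : (fun y => _) = cst (L v)); first exact: cst_continuous.
by apply/funext => y; rewrite diff_lin.
Qed.

Lemma C1ptD V W (f g : V -> W) x : C1pt f x -> C1pt g x -> C1pt (fun y => f y + g y) x.
Proof.
move=> [df cf] [dg cg].
have key : \forall y \near x, is_diff y (f + g) (fun v => 'd f y v + 'd g y v).
  near=> y; have dfy : differentiable f y by near: y.
  have dgy : differentiable g y by near: y.
  by apply: (is_diffD (df := 'd f y) (dg := 'd g y)); exact/differentiableP.
split; first by apply: filterS key => y [].
move=> v; have E : \forall y \near x, 'd f y v + 'd g y v = 'd (f + g) y v.
  by apply: filterS key => y [_ ->].
rewrite /prop_for /continuous_at.
rewrite (_ : (fun y => _) = f + g) // -(nbhs_singleton E).
apply: cvg_trans (cvgD (cf v) (cg v)); apply: near_eq_cvg; exact: E.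
Unshelve. all: by end_near. Qed.

Lemma C1ptM V (f g : V -> R) x : C1pt f x -> C1pt g x -> C1pt (fun y => f y * g y) x.
Proof.
move=> [df cf] [dg cg].
have key : \forall y \near x, is_diff y (f * g) (fun v => f y * 'd g y v + g y * 'd f y v).
  near=> y; have dfy : differentiable f y by near: y.
  have dgy : differentiable g y by near: y.
  by apply: (is_diffM (df := 'd f y) (dg := 'd g y)); exact/differentiableP.
split; first by apply: filterS key => y [].
move=> v; have E : \forall y \near x, f y * 'd g y v + g y * 'd f y v = 'd (f * g) y v.
  by apply: filterS key => y [_ ->].
rewrite /prop_for /continuous_at.
rewrite (_ : (fun y => _) = f * g) // -(nbhs_singleton E).
have fx := differentiable_continuous (nbhs_singleton df).
have gx := differentiable_continuous (nbhs_singleton dg).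
apply: cvg_trans (cvgD (cvgM fx (cg v)) (cvgM gx (cf v))); apply: near_eq_cvg; exact: E.
Unshelve. all: by end_near. Qed.

Lemma C1ptV V (f : V -> R) x : f x != 0 -> C1pt f x -> C1pt (fun y => (f y)^-1) x.
Proof.
move=> fx0 [df cf].
have fx := differentiable_continuous (nbhs_singleton df).
have f0 : \forall y \near x, f y != 0.
  by apply: (fx [set r | r != 0]); apply: open_nbhs_nbhs; split => //; exact: open_neq.
have key : \forall y \near x, is_diff y (fun y => (f y)^-1) (fun v => - (f y ^- 2) * 'd f y v).
  near=> y; have dfy : differentiable f y by near: y.
  have fy0 : f y != 0 by near: y.
  by apply: DiffDef; [exact: differentiableV|exact: diffV].
split; first by apply: filterS key => y [].
move=> v; have E : \forall y \near x, - (f y ^- 2) * 'd f y v = 'd (fun y => (f y)^-1) y v.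
  by apply: filterS key => y [_ ->].
rewrite /prop_for /continuous_at -(nbhs_singleton E).
have c2 : (fun y => f y ^- 2) @ x --> f x ^- 2.
  by apply: cvgV; [rewrite expf_neq0|rewrite expr2; exact: cvgM].
apply: cvg_trans (cvgM (cvgN c2) (cf v)); apply: near_eq_cvg; exact: E.
Unshelve. all: by end_near. Qed.

Lemma C1pt_sum V W (I : Type) (r : seq I) (P : pred I) (f : I -> V -> W) x :
  (forall i, P i -> C1pt (f i) x) -> C1pt (fun y => \sum_(i <- r | P i) f i y) x.
Proof.
move=> H; elim: r => [|i r IH].
  have -> : (fun y => \sum_(i <- [::] | P i) f i y) = fun=> 0.
    by apply/funext => y; rewrite big_nil.
  exact: C1pt_cst.
case Pi: (P i); last first.
  by rewrite (_ : (fun y => _) = fun y => \sum_(i <- r | P i) f i y) // funeqE => y; rewrite big_cons Pi.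
rewrite (_ : (fun y => _) = fun y => f i y + \sum_(i <- r | P i) f i y).
  by apply: C1ptD => //; exact: H.
by rewrite funeqE => y; rewrite big_cons Pi.
Qed.

Lemma C1pt_prod V (I : Type) (r : seq I) (P : pred I) (f : I -> V -> R) x :
  (forall i, P i -> C1pt (f i) x) -> C1pt (fun y => \prod_(i <- r | P i) f i y) x.
Proof.
move=> H; elim: r => [|i r IH].
  have -> : (fun y => \prod_(i <- [::] | P i) f i y) = fun=> 1.
    by apply/funext => y; rewrite big_nil.
  exact: C1pt_cst.
case Pi: (P i); last first.
  by rewrite (_ : (fun y => _) = fun y => \prod_(i <- r | P i) f i y) // funeqE => y; rewrite big_cons Pi.
rewrite (_ : (fun y => _) = fun y => f i y * \prod_(i <- r | P i) f i y).
  exact: (C1ptM (H _ Pi) IH).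
by rewrite funeqE => y; rewrite big_cons Pi.
Qed.

Lemma C1pt_comp_lin (U V W : normedModType R) (L : {linear U -> V}) (g : V -> W) (x : U) : continuous L ->
  C1pt g (L x) -> C1pt (g \o L) x.
Proof.
move=> cL [dg cg].
have dg' : \forall y \near x, differentiable g (L y) by exact: (cL x _ dg).
have key : \forall y \near x, is_diff y (g \o L) ('d g (L y) \o L).
  near=> y; have dgy : differentiable g (L y) by near: y.
  have dL := linear_differentiable y cL.
  apply: DiffDef; first exact: differentiable_comp.
  by rewrite diff_comp // diff_lin.
split; first by apply: filterS key => y [].
move=> v; have E : \forall y \near x, 'd g (L y) (L v) = 'd (g \o L) y v.
  by apply: filterS key => y [_ ->].
rewrite /prop_for /continuous_at -(nbhs_singleton E).
have : (fun y => 'd g (L y) (L v)) @ x --> 'd g (L x) (L v).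
  exact: (cvg_comp _ _ (cL x) (cg (L v))).
by move=> H; apply: cvg_trans H; apply: near_eq_cvg; exact: E.
Unshelve. all: by end_near. Qed.

Lemma C1pt_coord m n (V : normedModType R) (f : V -> 'M[R]_(m, n)) x i j :
  C1pt f x -> C1pt (fun y => f y i j) x.
Proof.
move=> [df cf].
have key : \forall y \near x, is_diff y (fun y => f y i j) (fun v => 'd f y v i j).
  near=> y; have dfy : differentiable f y by near: y.
  have [L LE] : exists L : {linear 'M[R]_(m, n) -> R}, L = (fun N => N i j) :> (_ -> _).
    by apply: linear_ex => a M N; rewrite !mxE.
  have cL : continuous L by rewrite LE; exact: coord_continuous.
  have dL := linear_differentiable (f y) cL.
  have -> : (fun y => f y i j) = L \o f by rewrite LE.
  apply: DiffDef; first exact: differentiable_comp.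
  by rewrite diff_comp // diff_lin // LE.
split; first by apply: filterS key => y [].
move=> v; have E : \forall y \near x, 'd f y v i j = 'd (fun y => f y i j) y v.
  by apply: filterS key => y [_ ->].
rewrite /prop_for /continuous_at -(nbhs_singleton E).
have : (fun y => 'd f y v i j) @ x --> 'd f x v i j.
  exact: (cvg_comp _ _ (cf v) (@coord_continuous _ _ _ i j _)).
by move=> H; apply: cvg_trans H; apply: near_eq_cvg; exact: E.
Unshelve. all: by end_near. Qed.

Lemma is_diff_mx m n (V : normedModType R) (f : V -> 'M[R]_(m, n)) x :
  (forall i j, differentiable (fun y => f y i j) x) ->
  is_diff x f (fun v => \matrix_(i, j) 'd (fun y => f y i j) x v).
Proof.
move=> df.
have fE : f = \sum_i \sum_j (fun y => f y i j *: delta_mx i j).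
  by apply/funext => y; rewrite {1}(matrix_sum_delta (f y)) fct_sumE; apply: eq_bigr => i _; rewrite fct_sumE.
have dd i j : differentiable (fun y => f y i j *: delta_mx i j) x by exact: differentiableZl.
have dft : differentiable f x.
  rewrite fE; apply: differentiable_sum => i; exact: differentiable_sum.
apply: DiffDef => //; apply/funext => v; apply/matrixP => i j; rewrite mxE.
have [L LE] : exists L : {linear 'M[R]_(m, n) -> R}, L = (fun N => N i j) :> (_ -> _).
  by apply: linear_ex => a M N; rewrite !mxE.
have cL : continuous L by rewrite LE; exact: coord_continuous.
have dL := linear_differentiable (f x) cL.
have -> : (fun y => f y i j) = L \o f by rewrite LE.
by rewrite (diff_comp dft dL) /= (diff_lin _ cL) LE.
Qed.

Lemma is_derive_line V W (g : V -> W) (y u : V) (r : R) :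
  differentiable g (y + r *: u) ->
  is_derive r (1 : R) (fun s => g (y + s *: u)) ('d g (y + r *: u) u).
Proof.
move=> dg.
have dl : is_diff r (fun s : R => y + s *: u) (fun s => s *: u).
  have -> : (fun s : R => s *: u) = 0 + (fun s : R => s *: u) by rewrite add0r.
  exact: (is_diffD (f := cst y)).
have dgl : differentiable (g \o (fun s : R => y + s *: u)) r by apply: differentiable_comp.
apply: DeriveDef; first exact: diff_derivable.
rewrite -/(g \o (fun s : R => y + s *: u)) deriveE // diff_comp //=.
by rewrite diff_val scale1r.
Qed.

(** Schwarz's theorem. The second difference of [g] over a small parallelogram is symmetric in [u]
    and [v]; two uses of the mean value theorem identify it, up to the square of the scale, with a
    nearby value of either mixed derivative, and these are continuous. *)
Lemma diff_swap V (g : V -> R) y u v :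
  (\forall z \near y, differentiable g z) ->
  C1pt (fun z => 'd g z u) y -> C1pt (fun z => 'd g z v) y ->
  'd (fun z => 'd g z u) y v = 'd (fun z => 'd g z v) y u.
Proof.
move=> dg [du cu] [dv cv].
apply/eqP; rewrite -subr_eq0 -normr_le0; apply/ler_addgt0Pr => e e0; rewrite add0r.
have e2 : 0 < e / 2 by rewrite divr_gt0.
have : \forall z \near y, [/\ differentiable g z, differentiable (fun z => 'd g z u) z,
    differentiable (fun z => 'd g z v) z,
    `|'d (fun z => 'd g z u) y v - 'd (fun z => 'd g z u) z v| <= e / 2 &
    `|'d (fun z => 'd g z v) y u - 'd (fun z => 'd g z v) z u| <= e / 2].
  near=> z; split; near: z => //.
  - by have /cvgrPdist_le /(_ _ e2) := cu v.
  - by have /cvgrPdist_le /(_ _ e2) := cv u.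
move=> /nbhs_ballP[d /= d0 Hd].
pose K := `|u| + `|v| + 1.
have K0 : 0 < K by rewrite /K; have := normr_ge0 u; have := normr_ge0 v; lra.
pose s := d / (2 * K).
have s0 : 0 < s by rewrite divr_gt0 // mulr_gt0.
have inball (a b : R) : 0 <= a <= s -> 0 <= b <= s -> ball y d (y + a *: u + b *: v).
  move=> /andP[a0 as_] /andP[b0 bs]; rewrite -ball_normE /= -addrA opprD addNKr normrN.
  apply: le_lt_trans (ler_normD _ _) _; rewrite !normrZ (ger0_norm a0) (ger0_norm b0).
  have h1 : a * `|u| <= s * `|u| by exact: ler_wpM2r.
  have h2 : b * `|v| <= s * `|v| by exact: ler_wpM2r.
  have h3 : s * K = d / 2 by rewrite /s; field; rewrite gt_eqF.
  have : s * `|u| + s * `|v| <= s * K by rewrite /K; nra.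
  lra.
have key (w w' : V) : (forall a b : R, 0 <= a <= s -> 0 <= b <= s -> ball y d (y + a *: w + b *: w')) ->
    (forall z, ball y d z -> differentiable (fun z => 'd g z w) z) ->
    exists2 z, ball y d z & g (y + s *: w + s *: w') - g (y + s *: w) - g (y + s *: w') + g y
      = s * (s * 'd (fun z => 'd g z w) z w').
  move=> inb dw.
  have in0s (r : R) : r \in `]0, s[ -> 0 <= r <= s by rewrite in_itv /= => /andP[/ltW -> /ltW ->].
  have s0s : 0 <= s <= s by rewrite lexx ltW.
  have s00 : 0 <= (0 : R) <= s by rewrite lexx ltW.
  have cstw (c : V) (r : R) : y + r *: w + c = y + c + r *: w by rewrite addrAC.
  pose phi (r : R) := g (y + s *: w' + r *: w) - g (y + r *: w).
  have dphi (r : R) : 0 <= r <= s -> is_derive r (1 : R) phi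
      ('d g (y + s *: w' + r *: w) w - 'd g (y + r *: w) w).
    move=> rs; apply: is_deriveB; apply: is_derive_line.
      by have [] := Hd _ (inb r s rs s0s); rewrite cstw.
    by have [] := Hd _ (inb r 0 rs s00); rewrite scale0r addr0.
  have [| |r rs phiE] := @MVT _ phi (fun r => 'd g (y + s *: w' + r *: w) w - 'd g (y + r *: w) w) 0 s s0.
  - by move=> r /in0s; exact: dphi.
  - apply: derivable_within_continuous => r; rewrite in_itv /= => rs.
    exact: (ex_derive (is_derive := dphi r rs)).
  have {}rs := in0s _ rs.
  pose psi (t : R) := 'd g (y + r *: w + t *: w') w.
  have dpsi (t : R) : 0 <= t <= s -> is_derive t (1 : R) psi
      ('d (fun z => 'd g z w) (y + r *: w + t *: w') w').
    move=> ts; apply: (is_derive_line (g := fun z => 'd g z w)); apply: dw; exact: inb.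
  have [| |t ts psiE] := @MVT _ psi (fun t => 'd (fun z => 'd g z w) (y + r *: w + t *: w') w') 0 s s0.
  - by move=> t /in0s; exact: dpsi.
  - apply: derivable_within_continuous => t; rewrite in_itv /= => ts.
    exact: (ex_derive (is_derive := dpsi t ts)).
  have {}ts := in0s _ ts.
  exists (y + r *: w + t *: w'); first exact: inb.
  move: phiE psiE; rewrite /phi /psi !scale0r !addr0 !subr0.
  rewrite (addrAC y (s *: w')) (addrAC y (s *: w')) => h1 h2.
  have -> : g (y + s *: w + s *: w') - g (y + s *: w) - g (y + s *: w') + g y =
    g (y + s *: w + s *: w') - g (y + s *: w) - (g (y + s *: w') - g y) by ring.
  by rewrite h1 h2; ring.
have [z1 b1 E1] := key u v inball (fun z bz => let: And5 _ h _ _ _ := Hd z bz in h).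
have inball' (a b : R) : 0 <= a <= s -> 0 <= b <= s -> ball y d (y + a *: v + b *: u).
  by move=> ha hb; rewrite addrAC; exact: inball.
have [z2 b2 E2] := key v u inball' (fun z bz => let: And5 _ _ h _ _ := Hd z bz in h).
have E : 'd (fun z => 'd g z u) z1 v = 'd (fun z => 'd g z v) z2 u.
  have s_ne : s != 0 by rewrite gt_eqF.
  apply: (mulfI s_ne); apply: (mulfI s_ne); rewrite -E1 -E2 (addrAC y (s *: v)); ring.
have [_ _ _ + _] := Hd _ b1; have [_ _ _ _] := Hd _ b2; rewrite E.
rewrite !ler_norml => /andP[? ?] /andP[? ?]; apply/andP; split; lra.
Unshelve. all: by end_near. Qed.

End C1Functions.

(** * Gradients and Hamiltonian fields in coordinates *)

Section PhaseCoordinates.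
Context {R : realType} {n : nat}.
Local Notation P := (pcoord R n).
Implicit Types (q v : P) (h k : P -> R).

Lemma co_t_linear : linear (@co_t R n). Proof. by []. Qed.
Lemma co_x_linear : linear (@co_x R n). Proof. by []. Qed.
Lemma co_tau_linear : linear (@co_tau R n). Proof. by []. Qed.
Lemma co_xi_linear : linear (@co_xi R n). Proof. by []. Qed.

HB.instance Definition _ := GRing.isLinear.Build R P R _ (@co_t R n) co_t_linear.
HB.instance Definition _ := GRing.isLinear.Build R P 'rV[R]_n.+1 _ (@co_x R n) co_x_linear.
HB.instance Definition _ := GRing.isLinear.Build R P R _ (@co_tau R n) co_tau_linear.
HB.instance Definition _ := GRing.isLinear.Build R P 'rV[R]_n.+1 _ (@co_xi R n) co_xi_linear.

Lemma co_t_continuous : continuous (@co_t R n).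
Proof. by move=> q; apply: (cvg_comp _ _ (cvg_comp _ _ cvg_fst cvg_fst) cvg_fst). Qed.
Lemma co_x_continuous : continuous (@co_x R n).
Proof. by move=> q; apply: (cvg_comp _ _ (cvg_comp _ _ cvg_fst cvg_fst) cvg_snd). Qed.
Lemma co_tau_continuous : continuous (@co_tau R n).
Proof. by move=> q; apply: (cvg_comp _ _ cvg_fst cvg_snd). Qed.
Lemma co_xi_continuous : continuous (@co_xi R n).
Proof. by move=> q; apply: cvg_snd. Qed.

Lemma pcoord_eq q q' : co_t q = co_t q' -> co_x q = co_x q' -> co_tau q = co_tau q' ->
  co_xi q = co_xi q' -> q = q'.
Proof.
by case: q q' => [[[t x] tau] xi] [[[t' x'] tau'] xi']; rewrite /co_t /co_x /co_tau /co_xi /= => -> -> -> ->.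
Qed.

Lemma pcoordE q : q = (co_t q, co_x q, co_tau q, co_xi q).
Proof. by case: q => [[[]]]. Qed.

Lemma co_tE t x tau xi : co_t ((t, x, tau, xi) : P) = t. Proof. by []. Qed.
Lemma co_xE t x tau xi : co_x ((t, x, tau, xi) : P) = x. Proof. by []. Qed.
Lemma co_tauE t x tau xi : co_tau ((t, x, tau, xi) : P) = tau. Proof. by []. Qed.
Lemma co_xiE t x tau xi : co_xi ((t, x, tau, xi) : P) = xi. Proof. by []. Qed.
Definition coE := (co_tE, co_xE, co_tauE, co_xiE).

Lemma cvg_pcoord (T : Type) (F : set_system T) {FF : Filter F} (f : T -> P) q :
  co_t \o f @ F --> co_t q -> co_x \o f @ F --> co_x q ->
  co_tau \o f @ F --> co_tau q -> co_xi \o f @ F --> co_xi q -> f @ F --> q.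
Proof.
move=> ht hx htau hxi; rewrite (pcoordE q).
rewrite (_ : f = fun s => (co_t (f s), co_x (f s), co_tau (f s), co_xi (f s))).
  exact: (cvg_pair (cvg_pair (cvg_pair ht hx) htau) hxi).
by apply/funext => s; rewrite -pcoordE.
Qed.

Lemma pcoord_basis v : v = co_t v *: e_t + (\sum_j co_x v 0 j *: e_x j) +
  co_tau v *: e_tau + \sum_j co_xi v 0 j *: e_xi j.
Proof.
apply: pcoord_eq; rewrite !linearD !linearZ !linear_sum.
- rewrite big1; last by move=> j _; exact: mulr0.
  rewrite big1; last by move=> j _; exact: mulr0.
  by rewrite /co_t /= /GRing.scale /= mulr1 mulr0 !addr0.
- rewrite [X in _ = _ + X]big1; last by move=> j _; exact: scaler0.
  by rewrite /co_x /= !scaler0 add0r !addr0 -row_sum_delta.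
- rewrite big1; last by move=> j _; exact: mulr0.
  rewrite big1; last by move=> j _; exact: mulr0.
  by rewrite /co_tau /= /GRing.scale /= mulr1 mulr0 !addr0 add0r.
- rewrite [X in _ = _ + X + _ + _]big1; last by move=> j _; exact: scaler0.
  by rewrite /co_xi /= !scaler0 !add0r -row_sum_delta.
Qed.

Definition pdot (a v : P) : R := co_t v * co_t a + (co_x v *m (co_x a)^T) 0 0 +
  co_tau v * co_tau a + (co_xi v *m (co_xi a)^T) 0 0.

Definition pgrad (k : P -> R) q : P :=
  ('d k q e_t, \row_j 'd k q (e_x j), 'd k q e_tau, \row_j 'd k q (e_xi j)).

Lemma diff_pgrad k q v : 'd k q v = pdot (pgrad k q) v.
Proof.
rewrite {1}(pcoord_basis v) !linearD !linearZ !linear_sum /= /pdot /pgrad.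
rewrite /co_t /co_tau /co_x /co_xi /=.
congr (_ + _ + _ + _); rewrite mxE; apply: eq_bigr => j _; by rewrite linearZ !mxE.
Qed.

Lemma cvg_sum (T : Type) (F : set_system T) {FF : Filter F} (I : Type) (r : seq I)
    (g : I -> T -> R) (l : I -> R) : (forall i, g i @ F --> l i) ->
  (fun s => \sum_(i <- r) g i s) @ F --> \sum_(i <- r) l i.
Proof.
move=> H; elim: r => [|i r IH].
  rewrite big_nil (_ : (fun s => _) = cst 0); first exact: cvg_cst.
  by apply/funext => s; rewrite big_nil.
rewrite big_cons (_ : (fun s => _) = fun s => g i s + \sum_(i <- r) g i s).
  by apply: cvgD.
by apply/funext => s; rewrite big_cons.
Qed.

Lemma cvg_row (T : Type) (F : set_system T) {FF : Filter F} (m : nat)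
    (g : 'I_m -> T -> R) (l : 'I_m -> R) : (forall j, g j @ F --> l j) ->
  (fun s => \row_j g j s : 'rV[R]_m) @ F --> (\row_j l j : 'rV[R]_m).
Proof.
move=> H; apply/cvgrPdist_le => e e0.
have K : \forall s \near F, forall j, `|l j - g j s| <= e.
  by apply: filter_forall => j; have /cvgrPdist_le /(_ e e0) := H j.
apply: filterS K => s K; rewrite /Num.Def.normr /= mx_normrE.
by apply: bigmax_le; [exact: ltW|move=> ij _; rewrite !mxE; exact: K].
Qed.

Lemma cvg_pdot (T : Type) (F : set_system T) {FF : Filter F} (f u : T -> P) a v :
  f @ F --> a -> u @ F --> v -> (fun s => pdot (f s) (u s)) @ F --> pdot a v.
Proof.
move=> fa uv.
have ft : co_t \o f @ F --> co_t a by apply: (cvg_comp _ _ fa); exact: co_t_continuous.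
have fx : co_x \o f @ F --> co_x a by apply: (cvg_comp _ _ fa); exact: co_x_continuous.
have ftau : co_tau \o f @ F --> co_tau a by apply: (cvg_comp _ _ fa); exact: co_tau_continuous.
have fxi : co_xi \o f @ F --> co_xi a by apply: (cvg_comp _ _ fa); exact: co_xi_continuous.
have ut : co_t \o u @ F --> co_t v by apply: (cvg_comp _ _ uv); exact: co_t_continuous.
have ux : co_x \o u @ F --> co_x v by apply: (cvg_comp _ _ uv); exact: co_x_continuous.
have utau : co_tau \o u @ F --> co_tau v by apply: (cvg_comp _ _ uv); exact: co_tau_continuous.
have uxi : co_xi \o u @ F --> co_xi v by apply: (cvg_comp _ _ uv); exact: co_xi_continuous.
have dotE (w w' : 'rV[R]_n.+1) : (w *m w'^T) 0 0 = \sum_j w 0 j * w' 0 j.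
  by rewrite mxE; apply: eq_bigr => j _; rewrite mxE.
have dot_cvg (w w' : T -> 'rV[R]_n.+1) (l l' : 'rV[R]_n.+1) : w @ F --> l -> w' @ F --> l' ->
    (fun s => (w s *m (w' s)^T) 0 0) @ F --> (l *m l'^T) 0 0.
  move=> wl wl'; rewrite dotE.
  rewrite (_ : (fun s => _) = fun s => \sum_j w s 0 j * w' s 0 j); last first.
    by apply/funext => s; rewrite dotE.
  apply: cvg_sum => j; apply: cvgM.
    exact: (cvg_comp _ _ wl (@coord_continuous _ _ _ 0 j _)).
  exact: (cvg_comp _ _ wl' (@coord_continuous _ _ _ 0 j _)).
rewrite /pdot; apply: cvgD; last exact: dot_cvg.
by apply: cvgD; [apply: cvgD; [exact: cvgM|exact: dot_cvg]|exact: cvgM].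
Qed.

Lemma pgrad_cvg (T : Type) (F : set_system T) {FF : Filter F} (f : T -> P) k q :
  C1pt k q -> f @ F --> q -> (fun s => pgrad k (f s)) @ F --> pgrad k q.
Proof.
move=> [_ ck] fq.
have ckf e : (fun s => 'd k (f s) e) @ F --> 'd k q e by exact: (cvg_comp _ _ fq (ck e)).
apply: cvg_pcoord; rewrite /pgrad /co_t /co_x /co_tau /co_xi /=.
- exact: ckf.
- by apply: cvg_row => j; exact: ckf.
- exact: ckf.
- by apply: cvg_row => j; exact: ckf.
Qed.

(** [C1pt] gives continuity of ['d k q v] in [q] for each fixed [v]. Joint continuity in both
    follows from the expansion on the finitely many basis vectors. *)
Lemma cvg_diff (T : Type) (F : set_system T) {FF : Filter F} (f u : T -> P) k q v :
  C1pt k q -> f @ F --> q -> u @ F --> v ->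
  (fun s => 'd k (f s) (u s)) @ F --> 'd k q v.
Proof.
move=> ck fq uv; rewrite [X in _ --> X]diff_pgrad.
have -> : (fun s => 'd k (f s) (u s)) = fun s => pdot (pgrad k (f s)) (u s).
  by apply/funext => s; exact: diff_pgrad.
by apply: cvg_pdot => //; exact: pgrad_cvg.
Qed.

(** The symplectic gradient map: it turns the gradient of h into H_h. *)
Definition sympl (a : P) : P := (co_tau a, co_xi a, - co_t a, - co_x a).

Lemma Ham_diff h q : differentiable h q -> Ham h q = sympl (pgrad h q).
Proof.
move=> dh; rewrite /Ham /sympl /pgrad /co_t /co_tau /co_x /co_xi /= !deriveE //.
congr (_, _, _, _); apply/rowP => j; rewrite !mxE deriveE //.
Qed.

Lemma poisson_diff h k q : differentiable k q -> poisson h k q = 'd k q (Ham h q).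
Proof. by move=> dk; rewrite /poisson deriveE. Qed.

Lemma sympl_cvg (T : Type) (F : set_system T) {FF : Filter F} (f : T -> P) a :
  f @ F --> a -> (fun s => sympl (f s)) @ F --> sympl a.
Proof.
move=> fa; apply: cvg_pcoord; rewrite /sympl.
- by apply: (cvg_comp _ _ fa); exact: co_tau_continuous.
- by apply: (cvg_comp _ _ fa); exact: co_xi_continuous.
- by apply: cvgN; apply: (cvg_comp _ _ fa); exact: co_t_continuous.
- by apply: cvgN; apply: (cvg_comp _ _ fa); exact: co_x_continuous.
Qed.

Lemma Ham_cvg (T : Type) (F : set_system T) {FF : Filter F} (f : T -> P) h q :
  C1pt h q -> f @ F --> q -> (fun s => Ham h (f s)) @ F --> Ham h q.
Proof.
move=> ch fq; rewrite Ham_diff; last exact: C1pt_diff.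
have E : \forall s \near F, sympl (pgrad h (f s)) = Ham h (f s).
  have : \forall y \near q, sympl (pgrad h y) = Ham h y.
    by case: ch => + _; apply: filterS => y /Ham_diff ->.
  exact: (fq _).
have H : (fun s => sympl (pgrad h (f s))) @ F --> sympl (pgrad h q).
  by apply: sympl_cvg; exact: pgrad_cvg.
by apply: cvg_trans H; exact: near_eq_cvg.
Qed.

(** A differential of this block triangular form is symplectic: [B] inverse to [J] deals with the
    diagonal blocks and the symmetry of [S] with the remaining one. A symplectic map carries the
    Hamiltonian field of a pulled-back function to that of the function. *)
Lemma symplectic_Ham (kap L : P -> P) (J B S : 'M[R]_n.+1) q h :
  (forall v, L v = (co_t v, co_x v *m J, co_tau v,
                    co_xi v *m B^T + co_x v *m J *m S)) ->
  J *m B = 1%:M -> B *m J = 1%:M -> S^T = S ->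
  is_diff q kap L -> differentiable h (kap q) ->
  L (Ham (h \o kap) q) = Ham h (kap q).
Proof.
move=> LE JB BJ SS [dkap kapE] dh.
have dhk : differentiable (h \o kap) q by apply: differentiable_comp.
rewrite !Ham_diff //.
set a := pgrad h (kap q).
have dE v : 'd (h \o kap) q v = pdot a (L v).
  by rewrite diff_comp //= kapE diff_pgrad.
clearbody a.
have gE : pgrad (h \o kap) q =
    (co_t a, co_x a *m J^T + co_xi a *m S *m J^T, co_tau a, co_xi a *m B).
  have z : (0 : 'M[R]_1) 0 0 = 0 by rewrite mxE.
  have de (M : 'M[R]_n.+1) (w : 'rV[R]_n.+1) j :
      ((delta_mx 0 j : 'rV[R]_n.+1) *m M *m w^T) 0 0 = (w *m M^T) 0 j.
    by rewrite -mulmxA -rowE mxE -[w *m M^T]trmxK trmx_mul trmxK [RHS]mxE.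
  apply: pcoord_eq; rewrite /pgrad !coE.
  - by rewrite dE LE /pdot /e_t !coE !mul0mx addr0 !mul0mx !z mul1r mul0r !addr0.
  - apply/rowP => j; rewrite mxE dE LE /pdot /e_x !coE.
    by rewrite !mul0r !add0r addr0 mul0mx add0r -(mulmxA _ J S) !de trmx_mul SS mulmxA [RHS]mxE.
  - by rewrite dE LE /pdot /e_tau !coE !mul0mx addr0 !mul0mx !z mul1r mul0r !addr0 add0r.
  - apply/rowP => j; rewrite mxE dE LE /pdot /e_xi !coE.
    by rewrite !mul0r !mul0mx z !(addr0, add0r) de trmxK.
rewrite gE LE /sympl !coE; congr (_, _, _, _).
  by rewrite -mulmxA BJ mulmx1.
rewrite -(mulmxA _ B J) BJ mulmx1 mulNmx mulmxDl -!mulmxA -trmx_mul BJ trmx1 !mulmx1.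
by rewrite opprD subrK.
Qed.

End PhaseCoordinates.

(** * Lifts of coordinate changes to the cotangent bundle *)

Section CotangentLift.
Context {R : realType} {n : nat}.
Local Notation P := (pcoord R n).
Implicit Types (q : P).

(* The lift to the cotangent bundle of a change of coordinates [theta] with inverse [eta]. *)
Definition cotangent_lift (theta eta : 'rV[R]_n.+1 -> 'rV[R]_n.+1) q : P :=
  (co_t q, theta (co_x q), co_tau q, co_xi q *m (jacobian eta (theta (co_x q)))^T).

Lemma jacobianE (f : 'rV[R]_n.+1 -> 'rV[R]_n.+1) y i m :
  jacobian f y i m = ('d f y (delta_mx 0 i)) 0 m.
Proof. by rewrite /jacobian /lin1_mx mxE. Qed.

Lemma mul_jacobian (f : 'rV[R]_n.+1 -> 'rV[R]_n.+1) y v : v *m jacobian f y = 'd f y v.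
Proof. by rewrite /jacobian mul_rV_lin1. Qed.

Lemma diff_sum (V W : normedModType R) m (f : 'I_m -> V -> W) x v :
  (forall i, differentiable (f i) x) -> 'd (\sum_i f i) x v = \sum_i 'd (f i) x v.
Proof.
move=> df; rewrite -deriveE; last exact: differentiable_sum.
rewrite derive_sum; last by move=> i; exact: diff_derivable.
by apply: eq_bigr => i _; rewrite deriveE.
Qed.

(** The fibre component is linear in xi, with first derivatives of [eta] as coefficients. Its
    derivative in x contracts xi with the second derivatives of [eta]: this contraction is [S],
    symmetric by [diff_swap]. *)
Lemma is_diff_cotangent_lift (theta eta : 'rV[R]_n.+1 -> 'rV[R]_n.+1) q :
  differentiable theta (co_x q) ->
  (\forall y \near theta (co_x q), differentiable eta y) ->
  (forall v : 'rV[R]_n.+1, C1pt (fun y => 'd eta y v) (theta (co_x q))) ->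
  exists2 S : 'M[R]_n.+1, S^T = S &
  is_diff q (cotangent_lift theta eta) (fun v : P =>
    (co_t v, co_x v *m jacobian theta (co_x q), co_tau v,
     co_xi v *m (jacobian eta (theta (co_x q)))^T +
     co_x v *m jacobian theta (co_x q) *m S)).
Proof.
move=> dtheta deta ceta.
set x0 := co_x q; set y0 := theta x0.
pose D l i m := 'd (fun y => jacobian eta y i m) y0 (delta_mx 0 l : 'rV[R]_n.+1).
have jacC i m : C1pt (fun y => jacobian eta y i m) y0.
  rewrite (_ : (fun y => _) = fun y => ('d eta y (delta_mx 0 i)) 0 m).
    exact: (C1pt_coord _ _ (ceta (delta_mx 0 i))).
  by apply/funext => y; rewrite jacobianE.
(* For fixed [m], column [m] of the Jacobian is the gradient of the component [g] of [eta], so [D]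
   is the Hessian of [g]. *)
have Dsym l i m : D l i m = D i l m.
  pose g y := (eta y) 0 m.
  have dg : \forall z \near y0, forall j, jacobian eta z j m = 'd g z (delta_mx 0 j).
    apply: filterS deta => z dz j; rewrite jacobianE.
    have [L LE] : exists L : {linear 'rV[R]_n.+1 -> R}, L = (fun N => N 0 m) :> (_ -> _).
      by apply: linear_ex => a M N; rewrite !mxE.
    have cL : continuous L by rewrite LE; exact: coord_continuous.
    have dL := linear_differentiable (eta z) cL.
    have -> : g = L \o eta by rewrite LE.
    by rewrite (diff_comp dz dL) /= (diff_lin _ cL) LE.
  have dgd : \forall z \near y0, differentiable g z.
    apply: filterS deta => z dz.
    exact: (differentiable_comp dz (differentiable_coord _ _ _)).
  have cg j : C1pt (fun z => 'd g z (delta_mx 0 j)) y0.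
    apply: C1pt_near (jacC j m).
    by apply: filterS dg => z ->.
  have E j w : 'd (fun y => jacobian eta y j m) y0 w =
               'd (fun z => 'd g z (delta_mx 0 j)) y0 w.
    have H : is_diff y0 (fun z => 'd g z (delta_mx 0 j)) ('d (fun y => jacobian eta y j m) y0).
      apply: near_eq_is_diff; last exact: C1pt_diff.
      by apply: filterS dg => z ->.
    by rewrite [in RHS]diff_val.
  exact: (etrans (E i _) (etrans (diff_swap dgd (cg i) (cg l)) (esym (E l _)))).
pose S : 'M[R]_n.+1 := \matrix_(l, i) \sum_m co_xi q 0 m * D l i m.
exists S.
  by apply/matrixP => l i; rewrite !mxE; apply: eq_bigr => m _; rewrite Dsym.
have dx : is_diff q (@co_x R n) (@co_x R n).
  have [L LE] := linear_ex (@co_x_linear R n).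
  rewrite -LE; apply: DiffDef; first by apply: linear_differentiable; rewrite LE; exact: co_x_continuous.
  by rewrite diff_lin // LE; exact: co_x_continuous.
have dxi : is_diff q (@co_xi R n) (@co_xi R n).
  have [L LE] := linear_ex (@co_xi_linear R n).
  rewrite -LE; apply: DiffDef; first by apply: linear_differentiable; rewrite LE; exact: co_xi_continuous.
  by rewrite diff_lin // LE; exact: co_xi_continuous.
have dt : is_diff q (@co_t R n) (@co_t R n).
  have [L LE] := linear_ex (@co_t_linear R n).
  rewrite -LE; apply: DiffDef; first by apply: linear_differentiable; rewrite LE; exact: co_t_continuous.
  by rewrite diff_lin // LE; exact: co_t_continuous.
have dtau : is_diff q (@co_tau R n) (@co_tau R n).
  have [L LE] := linear_ex (@co_tau_linear R n).
  rewrite -LE; apply: DiffDef; first by apply: linear_differentiable; rewrite LE; exact: co_tau_continuous.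
  by rewrite diff_lin // LE; exact: co_tau_continuous.
have dth : is_diff q (theta \o @co_x R n) (fun v => co_x v *m jacobian theta x0).
  apply: DiffDef; first exact: differentiable_comp.
  rewrite diff_comp //; apply/funext => v /=; rewrite mul_jacobian.
  by rewrite [in LHS]diff_val.
suff dfib : is_diff q (fun q => co_xi q *m (jacobian eta (theta (co_x q)))^T)
    (fun v => co_xi v *m (jacobian eta y0)^T + co_x v *m jacobian theta x0 *m S).
  by apply: is_diff_pair => //; apply: is_diff_pair => //; apply: is_diff_pair.
pose f i m : P -> R := (fun q => co_xi q 0 m) * (fun q => jacobian eta (theta (co_x q)) i m).
have dco m : is_diff q (fun q : P => co_xi q 0 m) (fun v : P => co_xi v 0 m).
  have [L LE] : exists L : {linear 'rV[R]_n.+1 -> R}, L = (fun N => N 0 m) :> (_ -> _).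
    by apply: linear_ex => a M N; rewrite !mxE.
  have cL : continuous L by rewrite LE; exact: coord_continuous.
  have dL := linear_differentiable (co_xi q) cL.
  have -> : (fun q : P => co_xi q 0 m) = L \o @co_xi R n by rewrite LE.
  apply: DiffDef; first exact: differentiable_comp.
  rewrite diff_comp // (diff_lin _ cL) LE; apply/funext => v /=.
  by rewrite [in LHS]diff_val.
have dj i m : is_diff q (fun q => jacobian eta (theta (co_x q)) i m)
    (fun v => 'd (fun y => jacobian eta y i m) y0 (co_x v *m jacobian theta x0)).
  have dji := C1pt_diff (jacC i m).
  rewrite -/((fun y => jacobian eta y i m) \o (theta \o @co_x R n)).
  apply: DiffDef; first exact: differentiable_comp.
  by rewrite diff_comp //; apply/funext => v /=; rewrite [in LHS]diff_val.
have df i m : is_diff q (f i m) (fun v => co_xi q 0 m * 'd (fun y => jacobian eta y i m) y0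
   (co_x v *m jacobian theta x0) + jacobian eta y0 i m * co_xi v 0 m).
  exact: (is_diffM (dco m) (dj i m)).
have fE : forall i, (fun q => (co_xi q *m (jacobian eta (theta (co_x q)))^T) 0 i) = \sum_m f i m.
  move=> i; apply/funext => q'; rewrite fct_sumE mxE; apply: eq_bigr => m _.
  by rewrite mxE.
have comp i j : differentiable (fun q => (co_xi q *m (jacobian eta (theta (co_x q)))^T) i j) q.
  by rewrite (ord1 i) fE; apply: differentiable_sum => m; exact: ex_diff.
have H := is_diff_mx comp.
apply: DiffDef; first exact: ex_diff.
rewrite [LHS]diff_val; apply/funext => v; apply/rowP => i; rewrite mxE.
have -> : (fun y => (co_xi y *m (jacobian eta (theta (co_x y)))^T) 0 i) = \sum_m f i m.
  exact: fE.
rewrite diff_sum; last by move=> m; exact: ex_diff.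
under eq_bigr do rewrite diff_val.
rewrite big_split /= addrC; rewrite [RHS]mxE; congr (_ + _).
  by rewrite [RHS]mxE; apply: eq_bigr => m _; rewrite [(_^T) m i]mxE mulrC.
have dlin (w : 'rV[R]_n.+1) m : 'd (fun y => jacobian eta y i m) y0 w = \sum_l w 0 l * D l i m.
  by rewrite {1}(row_sum_delta w) linear_sum; apply: eq_bigr => l _; rewrite linearZ.
set w := co_x v *m _.
under eq_bigr do rewrite dlin mulr_sumr.
rewrite exchange_big [RHS]mxE; apply: eq_bigr => l _.
by rewrite [S l i]mxE mulr_sumr; apply: eq_bigr => m _; rewrite mulrCA.
Qed.

(** The Jacobians of [theta] and [eta] are inverse to each other by the chain rule, so that
    [symplectic_Ham] applies. All chart independence of H_p below comes from here. *)
Lemma Ham_cotangent_lift (theta eta : 'rV[R]_n.+1 -> 'rV[R]_n.+1) q (h : P -> R) :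
  differentiable theta (co_x q) ->
  (\forall y \near theta (co_x q), differentiable eta y) ->
  (forall v : 'rV[R]_n.+1, C1pt (fun y => 'd eta y v) (theta (co_x q))) ->
  (\forall x \near co_x q, eta (theta x) = x) ->
  (\forall y \near theta (co_x q), theta (eta y) = y) ->
  differentiable h (cotangent_lift theta eta q) ->
  differentiable (cotangent_lift theta eta) q /\
  'd (cotangent_lift theta eta) q (Ham (h \o cotangent_lift theta eta) q) =
  Ham h (cotangent_lift theta eta q).
Proof.
move=> dth deta ceta etheta theeta dh.
have [S SS dkap] := is_diff_cotangent_lift dth deta ceta.
split; first exact: ex_diff.
have de := nbhs_singleton deta.
have id_jac (f g : 'rV[R]_n.+1 -> 'rV[R]_n.+1) x : differentiable f x ->
    differentiable g (f x) -> (\forall z \near x, g (f z) = z) ->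
    jacobian f x *m jacobian g (f x) = 1%:M.
  move=> df dg gf; apply/row_matrixP => i; rewrite row_mul mul_jacobian row1 rowE mul_jacobian.
  have H : is_diff x (g \o f) id.
    by apply: DiffDef; [exact: differentiable_comp|];
    have [_ ->] := near_eq_is_diff (f := id) (g := g \o f) (filterS (fun z e => esym e) gf) (ex_diff (is_diff_def := is_diff_id x)); rewrite diff_val.
  case: H => _ HE; have := etrans (esym (diff_comp df dg)) HE.
  by move=> /(congr1 (fun F => F (delta_mx 0 i))) /=.
have JB : jacobian theta (co_x q) *m jacobian eta (theta (co_x q)) = 1%:M by exact: id_jac.
have BJ : jacobian eta (theta (co_x q)) *m jacobian theta (co_x q) = 1%:M.
  have e := nbhs_singleton etheta.
  have dth' : differentiable theta (eta (theta (co_x q))) by rewrite e.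
  by have := id_jac _ _ _ de dth' theeta; rewrite e.
have := symplectic_Ham (fun v => erefl) JB BJ SS dkap dh.
by case: dkap => _ E H; rewrite -[RHS]H; exact: (congr1 (fun F : P -> P => F _) E).
Qed.

End CotangentLift.

(** * Charts of the cotangent bundle *)

Section PhaseTopology.
Context {R : realType} {n : nat} (N : manifold R n).

Lemma open_phaseE (O : set (phase N)) : open O = phase_open O.
Proof. by []. Qed.

Lemma nbhs_phaseP (rho : phase N) (A : set (phase N)) :
  nbhs rho A <-> exists U, [/\ phase_open U, U rho & U `<=` A].
Proof.
rewrite nbhsE; split=> [[U [hU Ur] UA]|[U [hU Ur UA]]]; first by exists U.
by exists U.
Qed.

End PhaseTopology.

(* Conversion between distinct instances of the transparent constants is extremely slow,
   hence these opaque copies. *)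
Fact tjac_key : {f : forall (R : realType) (n : nat) (N : manifold R n),
  chart R n N -> chart R n N -> N -> 'M[R]_n.+1 | f = @trans_jac}.
Proof. by exists @trans_jac. Qed.

Fact lcrd_key : {f : forall (R : realType) (n : nat) (N : manifold R n),
  chart R n N -> phase N -> pcoord R n | f = @lcoord}.
Proof. by exists @lcoord. Qed.

Fact ofcrd_key : {f : forall (R : realType) (n : nat) (N : manifold R n),
  chart R n N -> pcoord R n -> phase N | f = @of_coord}.
Proof. by exists @of_coord. Qed.

Fact clift_key : {f : forall (R : realType) (n : nat) (N : manifold R n),
  chart R n N -> chart R n N -> pcoord R n -> pcoord R n |
  f = fun R n N c c' => cotangent_lift (phi c' \o psi c) (phi c \o psi c')}.
Proof. by eexists. Qed.

Section CoordinateUnfolding.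
Context {R : realType} {n : nat} {N : manifold R n}.
Implicit Types (c : chart R n N) (rho : phase N) (q : pcoord R n) (x : N).

Definition tjac c c' x : 'M[R]_n.+1 := sval tjac_key R n N c c' x.
Definition lcrd c rho : pcoord R n := sval lcrd_key R n N c rho.
Definition ofcrd c q : phase N := sval ofcrd_key R n N c q.
Definition clift c c' q : pcoord R n := sval clift_key R n N c c' q.

Lemma tjacE c c' x : tjac c c' x = trans_jac c c' x.
Proof. by rewrite /tjac; case: tjac_key => f /= ->. Qed.
Lemma lcrdE c rho : lcrd c rho = lcoord c rho.
Proof. by rewrite /lcrd; case: lcrd_key => f /= ->. Qed.
Lemma ofcrdE c q : ofcrd c q = of_coord c q.
Proof. by rewrite /ofcrd; case: ofcrd_key => f /= ->. Qed.
Lemma cliftE c c' : clift c c' = cotangent_lift (phi c' \o psi c) (phi c \o psi c').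
Proof. by rewrite /clift; case: clift_key => f /= ->. Qed.

Lemma mul_tjac c c' x v : v *m tjac c c' x = 'd (phi c' \o psi c) (phi c x) v.
Proof. by rewrite tjacE; exact: mul_jacobian. Qed.

Lemma co_t_lcrd c rho : co_t (lcrd c rho) = ph_t rho. Proof. by rewrite lcrdE. Qed.
Lemma co_x_lcrd c rho : co_x (lcrd c rho) = phi c (ph_x rho). Proof. by rewrite lcrdE. Qed.
Lemma co_tau_lcrd c rho : co_tau (lcrd c rho) = ph_tau rho. Proof. by rewrite lcrdE. Qed.
Lemma co_xi_lcrd c rho : co_xi (lcrd c rho) =
  ph_xi rho *m (tjac c (pref_chart (ph_x rho)) (ph_x rho))^T.
Proof. by rewrite lcrdE tjacE. Qed.

Lemma ph_t_ofcrd c q : ph_t (ofcrd c q) = co_t q. Proof. by rewrite ofcrdE. Qed.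
Lemma ph_x_ofcrd c q : ph_x (ofcrd c q) = psi c (co_x q). Proof. by rewrite ofcrdE. Qed.
Lemma ph_tau_ofcrd c q : ph_tau (ofcrd c q) = co_tau q. Proof. by rewrite ofcrdE. Qed.
Lemma ph_xi_ofcrd c q : ph_xi (ofcrd c q) =
  co_xi q *m (tjac (pref_chart (psi c (co_x q))) c (psi c (co_x q)))^T.
Proof. by rewrite ofcrdE tjacE. Qed.

Lemma phase_eq rho rho' : ph_t rho = ph_t rho' -> ph_x rho = ph_x rho' ->
  ph_tau rho = ph_tau rho' -> ph_xi rho = ph_xi rho' -> rho = rho'.
Proof. by case: rho rho' => ? ? ? ? [? ? ? ?] /= -> -> -> ->. Qed.

Lemma co_t_clift c c' q : co_t (clift c c' q) = co_t q.
Proof. by rewrite cliftE. Qed.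
Lemma co_x_clift c c' q : co_x (clift c c' q) = phi c' (psi c (co_x q)).
Proof. by rewrite cliftE. Qed.
Lemma co_tau_clift c c' q : co_tau (clift c c' q) = co_tau q.
Proof. by rewrite cliftE. Qed.
Lemma co_xi_clift c c' q :
  co_xi (clift c c' q) = co_xi q *m (tjac c' c (psi c (co_x q)))^T.
Proof. by rewrite cliftE tjacE. Qed.

End CoordinateUnfolding.

Section Charts.
Context {R : realType} {n : nat} (N : manifold R n).
Local Notation P := (pcoord R n).
Implicit Types (c : chart R n N) (x : N) (q : P) (rho : phase N).

Lemma psiK c u : (phi c @` dom c) u -> dom c (psi c u) /\ phi c (psi c u) = u.
Proof. by move=> [x dx <-]; rewrite phiK. Qed.

Lemma psi_phi_dom c x : dom c x -> (phi c @` dom c) (phi c x).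
Proof. by move=> dx; exists x. Qed.

Lemma near_dom c x : dom c x -> \forall y \near x, dom c y.
Proof. by move=> dx; apply: open_nbhs_nbhs; split => //; exact: dom_open. Qed.

Lemma near_cod c u : (phi c @` dom c) u -> \forall v \near u, (phi c @` dom c) v.
Proof. by move=> du; apply: open_nbhs_nbhs; split => //; exact: cod_open. Qed.

Lemma near_psi c u (A : set N) : (phi c @` dom c) u -> nbhs (psi c u) A ->
  \forall v \near u, A (psi c v).
Proof. by move=> du nA; exact: (psi_cont du). Qed.

Lemma near_overlap c c' u : (phi c @` dom c) u -> dom c' (psi c u) ->
  \forall v \near u, [/\ (phi c @` dom c) v, dom c (psi c v), phi c (psi c v) = v
                     & dom c' (psi c v)].
Proof.
move=> du d'; have h1 := near_cod du; have h2 := near_psi du (near_dom d').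
near=> v; have cv : (phi c @` dom c) v by near: v.
by have [? ?] := psiK cv; split => //; near: v.
Unshelve. all: by end_near. Qed.

Variables (c c' : chart R n N).
Hypotheses (ac : atlas c) (ac' : atlas c').

Lemma C2_trans x : dom c x -> dom c' x ->
  C1pt (phi c' \o psi c) (phi c x) /\
  forall v, C1pt (fun y => 'd (phi c' \o psi c) y v) (phi c x).
Proof.
move=> dx dx'; have [[H1 H2] _] := atlas_compat ac ac'.
have ux : (phi c @` (dom c `&` dom c')) (phi c x) by exists x.
by split; [exact: H1|move=> v; exact: (H2 v)].
Qed.

Lemma trans_inv x : dom c x -> dom c' x ->
  \forall u \near phi c x, (phi c \o psi c') ((phi c' \o psi c) u) = u.
Proof.
move=> dx dx'.
have := near_overlap (psi_phi_dom dx) (c' := c'); rewrite phiK // => /(_ dx').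
by apply: filterS => u [_ _ uE d'] /=; rewrite phiK.
Qed.

End Charts.

Section Jacobians.
Context {R : realType} {n : nat} (N : manifold R n).
Local Notation P := (pcoord R n).
Implicit Types (c : chart R n N) (x : N) (q : P) (rho : phase N).

(** The chain rule; since vectors are rows, Jacobians compose from left to right. *)
Lemma tjac_comp c c' c'' x : atlas c -> atlas c' -> atlas c'' ->
  dom c x -> dom c' x -> dom c'' x ->
  tjac c c' x *m tjac c' c'' x = tjac c c'' x.
Proof.
move=> ac ac' ac'' dx dx' dx''.
have d1 := C1pt_diff (C2_trans ac ac' dx dx').1.
have d2 := C1pt_diff (C2_trans ac' ac'' dx' dx'').1.
have d3 := C1pt_diff (C2_trans ac ac'' dx dx'').1.
have E : (phi c' \o psi c) (phi c x) = phi c' x by rewrite /= phiK.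
have d2' : differentiable (phi c'' \o psi c') ((phi c' \o psi c) (phi c x)) by rewrite E.
have H : is_diff (phi c x) ((phi c'' \o psi c') \o (phi c' \o psi c)) ('d (phi c'' \o psi c) (phi c x)).
  apply: near_eq_is_diff => //.
  have := near_overlap (psi_phi_dom dx) (c' := c'); rewrite phiK // => /(_ dx').
  by apply: filterS => u [_ _ uE d'] /=; rewrite phiK.
apply/row_matrixP => i; rewrite row_mul (rowE i (tjac c c' x)) (rowE i (tjac c c'' x)) !mul_tjac.
case: H => _ HE; have := etrans (esym (diff_comp d1 d2')) HE.
by move=> /(congr1 (fun F => F (delta_mx 0 i))) /=; rewrite phiK.
Qed.

Lemma tjac_id c x : dom c x -> tjac c c x = 1%:M.
Proof.
move=> dx; apply/row_matrixP => i; rewrite !rowE mul_tjac mulmx1.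
have H : is_diff (phi c x) (phi c \o psi c) ('d (@id 'rV[R]_n.+1) (phi c x)).
  apply: near_eq_is_diff; last exact: ex_diff.
  by apply: filterS (near_cod (psi_phi_dom dx)) => u /psiK[_ /=].
by case: H => _ ->; rewrite [in LHS]diff_val.
Qed.

Lemma tjac_inv c c' x : atlas c -> atlas c' -> dom c x -> dom c' x ->
  tjac c c' x *m tjac c' c x = 1%:M.
Proof. by move=> ? ? ? ?; rewrite tjac_comp // tjac_id. Qed.

Lemma pref_chart_atlas x : atlas (pref_chart x).
Proof. by rewrite /pref_chart; case: cid2. Qed.

Lemma pref_chart_dom x : dom (pref_chart x) x.
Proof. by rewrite /pref_chart; case: cid2. Qed.

Hint Resolve pref_chart_atlas pref_chart_dom : core.

Lemma lcrd_change c c' rho : atlas c -> atlas c' -> dom c (ph_x rho) ->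
  dom c' (ph_x rho) ->
  co_xi (lcrd c' rho) = co_xi (lcrd c rho) *m (tjac c' c (ph_x rho))^T.
Proof.
move=> ac ac' dx dx'; rewrite !co_xi_lcrd -mulmxA -trmx_mul.
by rewrite (tjac_comp ac' ac).
Qed.

Lemma lcrd_ofcrd c q : atlas c -> pcod c q -> lcrd c (ofcrd c q) = q.
Proof.
move=> ac /psiK[dx uE]; apply: pcoord_eq.
- by rewrite co_t_lcrd ph_t_ofcrd.
- by rewrite co_x_lcrd ph_x_ofcrd.
- by rewrite co_tau_lcrd ph_tau_ofcrd.
- rewrite co_xi_lcrd ph_x_ofcrd ph_xi_ofcrd -mulmxA -trmx_mul.
  by rewrite (tjac_inv ac) // trmx1 mulmx1.
Qed.

Lemma ofcrd_lcrd c rho : atlas c -> dom c (ph_x rho) -> ofcrd c (lcrd c rho) = rho.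
Proof.
move=> ac dx; apply: phase_eq.
- by rewrite ph_t_ofcrd co_t_lcrd.
- by rewrite ph_x_ofcrd co_x_lcrd phiK.
- by rewrite ph_tau_ofcrd co_tau_lcrd.
- rewrite ph_xi_ofcrd co_x_lcrd phiK // co_xi_lcrd -mulmxA -trmx_mul.
  by rewrite (tjac_inv _ ac) // trmx1 mulmx1.
Qed.

Lemma pcod_lcrd c rho : dom c (ph_x rho) -> pcod c (lcrd c rho).
Proof. by move=> dx; exists (ph_x rho); rewrite ?co_x_lcrd. Qed.

Lemma lcrd_lift c c' q : atlas c -> atlas c' -> pcod c q -> dom c' (psi c (co_x q)) ->
  lcrd c' (ofcrd c q) = clift c c' q.
Proof.
move=> ac ac' cq d'; have [d uE] := psiK cq.
apply: pcoord_eq.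
- by rewrite co_t_lcrd ph_t_ofcrd co_t_clift.
- by rewrite co_x_lcrd ph_x_ofcrd co_x_clift.
- by rewrite co_tau_lcrd ph_tau_ofcrd co_tau_clift.
- rewrite (lcrd_change ac ac') ?ph_x_ofcrd // lcrd_ofcrd //.
  by rewrite co_xi_clift.
Qed.

Lemma lift_hyp c c' q : atlas c -> atlas c' -> pcod c q -> dom c' (psi c (co_x q)) ->
  [/\ differentiable (phi c' \o psi c) (co_x q),
      \forall y \near (phi c' \o psi c) (co_x q), differentiable (phi c \o psi c') y,
      forall v : 'rV[R]_n.+1, C1pt (fun y => 'd (phi c \o psi c') y v) ((phi c' \o psi c) (co_x q)),
      \forall x \near co_x q, (phi c \o psi c') ((phi c' \o psi c) x) = x &
      \forall y \near (phi c' \o psi c) (co_x q), (phi c' \o psi c) ((phi c \o psi c') y) = y].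
Proof.
move=> ac ac' cq d'; have [d uE] := psiK cq.
have [H1 H2] := C2_trans ac' ac d' d.
split.
- by have := C1pt_diff (C2_trans ac ac' d d').1; rewrite uE.
- by case: H1.
- exact: H2.
- by have := trans_inv d d'; rewrite uE.
- exact: trans_inv.
Qed.

Lemma lift_continuous c c' q : atlas c -> atlas c' -> pcod c q -> dom c' (psi c (co_x q)) ->
  {for q, continuous (clift c c')}.
Proof.
move=> ac ac' cq d'; have [H1 H2 H3 H4 H5] := lift_hyp ac ac' cq d'.
rewrite cliftE; have [S _ H] := is_diff_cotangent_lift H1 H2 H3.
exact/differentiable_continuous/ex_diff.
Qed.

Lemma pcod_near c q : pcod c q -> \forall q' \near q, pcod c q'.
Proof. by move=> cq; apply: open_nbhs_nbhs; split => //; exact: open_pcod. Qed.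

Lemma pcod_near_psi c q (A : set N) : pcod c q -> nbhs (psi c (co_x q)) A ->
  \forall q' \near q, A (psi c (co_x q')).
Proof.
move=> cq nA; have := near_psi cq nA; exact: (co_x_continuous (n := n) (x := q)).
Qed.

Lemma near_lcrd_lift c c' q : atlas c -> atlas c' -> pcod c q -> dom c' (psi c (co_x q)) ->
  \forall q' \near q, lcrd c' (ofcrd c q') = clift c c' q'.
Proof.
move=> ac ac' cq d'; have h1 := pcod_near cq; have h2 := pcod_near_psi cq (near_dom d').
by near=> q'; apply: lcrd_lift => //; near: q'.
Unshelve. all: by end_near. Qed.

Lemma ofcrd_continuous c q : atlas c -> pcod c q -> {for q, continuous (ofcrd c)}.
Proof.
move=> ac cq A /nbhs_phaseP[U [hU Uq UA]].
have : open (pcod c `&` ofcrd c @^-1` U).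
  rewrite (_ : ofcrd c = of_coord c); first exact: (hU c ac).
  by apply/funext => z; rewrite ofcrdE.
move=> o; apply: filterS (open_nbhs_nbhs (conj o (conj cq Uq))) => q' [_ /UA]; exact.
Qed.

Lemma ph_x_continuous : continuous (@ph_x R n N).
Proof.
apply/continuousP => O oO; rewrite open_phaseE => c ac.
rewrite openE => q [cq Oq]; have h1 := pcod_near cq.
have h2 : \forall q' \near q, O (psi c (co_x q')).
  by apply: pcod_near_psi => //; apply: open_nbhs_nbhs.
by near=> q'; split; near: q'.
Unshelve. all: by end_near. Qed.

(** Openness in [phase N] is tested through every other chart [c1], where [lcrd c] reads as the
    continuous lift [clift c1 c]. *)
Lemma lcrd_continuous c rho : atlas c -> dom c (ph_x rho) -> {for rho, continuous (lcrd c)}.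
Proof.
move=> ac dx A /=; rewrite nbhsE => -[V [oV Vr] VA].
suff o : open [set r : phase N | dom c (ph_x r) /\ V (lcrd c r)].
  by apply: filterS (open_nbhs_nbhs (conj o (conj dx Vr))) => r [_ /VA].
rewrite open_phaseE => c1 ac1; rewrite openE => q [cq /=].
rewrite -ofcrdE => -[dq Vq].
have h1 := pcod_near cq; have h2 := pcod_near_psi cq (near_dom dq).
have h3 := near_lcrd_lift ac1 ac cq dq.
have h4 : \forall q' \near q, V (clift c1 c q').
  have nV : nbhs (clift c1 c q) V.
    by apply: open_nbhs_nbhs; split; [exact: oV|rewrite -(lcrd_lift ac1 ac cq dq)].
  exact: (lift_continuous ac1 ac cq dq nV).
near=> q'; split; first by near: q'.
rewrite /= -ofcrdE; split; first by near: q'.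
have -> : lcrd c (ofcrd c1 q') = clift c1 c q'.
  by near: q'.
by near: q'.
Unshelve. all: by end_near. Qed.

Lemma ph_t_continuous : continuous (@ph_t R n N).
Proof.
move=> rho; have H := lcrd_continuous (pref_chart_atlas (ph_x rho)) (pref_chart_dom (ph_x rho)).
set c := pref_chart _ in H; have -> : @ph_t R n N = co_t \o lcrd c.
  by apply/funext => r /=; rewrite co_t_lcrd.
exact: (continuous_comp H (@co_t_continuous R n _)).
Qed.

(** Distinct base points are separated on the manifold, points of one fibre by their coordinates in
    a common chart. Uniqueness of the limits defining [Gam] and closedness of compact sets depend on
    this. *)
Lemma phase_hausdorff : hausdorff_space (phase N).
Proof.
rewrite open_hausdorff => r s rs.
have [xE|xN] := pselect (ph_x r = ph_x s); last first.
  have := @mhausdorff R n N; rewrite open_hausdorff => /(_ (ph_x r) (ph_x s)).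
  case; first exact/eqP.
  move=> [A B] /= [Ar Bs] [oA oB AB].
  exists (@ph_x R n N @^-1` A, @ph_x R n N @^-1` B); split => /=.
  - by rewrite inE /=; move: Ar; rewrite inE.
  - by rewrite inE /=; move: Bs; rewrite inE.
  - by move/continuousP : ph_x_continuous; apply.
  - by move/continuousP : ph_x_continuous; apply.
  - by rewrite -preimage_setI (eqP AB) preimage_set0.
set x := ph_x r; set c := pref_chart x.
have dr : dom c (ph_x r) by exact: pref_chart_dom.
have ds : dom c (ph_x s) by rewrite -xE; exact: pref_chart_dom.
have ac : atlas c by exact: pref_chart_atlas.
have lN : lcrd c r != lcrd c s.
  apply: contra_neq rs => e.
  by rewrite -(ofcrd_lcrd ac dr) -(ofcrd_lcrd ac ds) e.
have := @norm_hausdorff _ P; rewrite open_hausdorff => /(_ _ _ lN).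
move=> [[A B] /= [Ar Bs] [oA oB AB]].
have op (V : set P) : open V -> open [set r : phase N | dom c (ph_x r) /\ V (lcrd c r)].
  move=> oV; rewrite openE => r' [dr' Vr'].
  have h1 : \forall z \near r', dom c (ph_x z).
    by apply: ph_x_continuous; exact: near_dom.
  have h2 : \forall z \near r', V (lcrd c z).
    by apply: (lcrd_continuous ac dr'); apply: open_nbhs_nbhs.
  by near=> z; split; near: z.
exists ([set r : phase N | dom c (ph_x r) /\ A (lcrd c r)],
        [set r : phase N | dom c (ph_x r) /\ B (lcrd c r)]); split => /=.
- by rewrite inE /=; split => //; move: Ar; rewrite inE.
- by rewrite inE /=; split => //; move: Bs; rewrite inE.
- exact: op.
- exact: op.
apply/eqP/seteqP; split => // z [[_ Az] [_ Bz]].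
by have : (A `&` B) (lcrd c z) by []; rewrite (eqP AB).
Unshelve. all: by end_near. Qed.

End Jacobians.

Lemma near_eq_continuous (T U : topologicalType) (f g : T -> U) x :
  (\forall y \near x, f y = g y) -> {for x, continuous f} -> {for x, continuous g}.
Proof.
move=> fg; rewrite /prop_for /continuous_at => cf; rewrite -(nbhs_singleton fg).
by apply: cvg_trans cf; apply: near_eq_cvg.
Qed.

Section C1Matrices.
Context {R : realType} {V : normedModType R}.

Lemma C1pt_det m (A : V -> 'M[R]_m) x : (forall i j, C1pt (fun y => A y i j) x) ->
  C1pt (fun y => \det (A y)) x.
Proof.
move=> cA; rewrite /determinant; apply: C1pt_sum => s _.
apply: C1ptM; first exact: C1pt_cst.
by apply: C1pt_prod => i _; exact: cA.
Qed.

Lemma C1pt_invmx m (A : V -> 'M[R]_m.+1) x : (forall i j, C1pt (fun y => A y i j) x) ->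
  (\forall y \near x, A y \in unitmx) -> forall i j, C1pt (fun y => invmx (A y) i j) x.
Proof.
move=> cA uA i j.
apply: (@C1pt_near _ _ _ (fun y => (\det (A y))^-1 * \adj (A y) i j)).
  by apply: filterS uA => y uy; rewrite /invmx uy !mxE.
apply: C1ptM.
  apply: C1ptV; last exact: C1pt_det.
  by have := nbhs_singleton uA; rewrite unitmxE unitfE.
rewrite (_ : (fun y => \adj (A y) i j) = fun y => (-1) ^+ (j + i) * \det (row' j (col' i (A y)))).
  apply: C1ptM; first exact: C1pt_cst.
  apply: C1pt_det => k l; rewrite (_ : (fun y => _) = fun y => A y (lift j k) (lift i l)) //.
  by apply/funext => y; rewrite !mxE.
by apply/funext => y; rewrite mxE.
Qed.

(** The symbol is a quadratic polynomial along fibre lines, and its vertical derivatives are read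
    off as the linear coefficients. *)
Lemma derive_quadratic (f : V -> R) (q v : V) (A B : R) :
  (forall s : R, f (s *: v + q) = f q + s * A + s ^+ 2 * B) -> 'D_v f q = A.
Proof.
move=> H; rewrite /derive; apply/cvg_lim => //.
have E : \forall h \near (0 : R)^', A + h * B = h^-1 *: ((f \o shift q) (h *: v) - f q).
  near=> h; have h0 : h != 0 by near: h; exact: nbhs_dnbhs_neq.
  by rewrite /= H /GRing.scale /=; field.
apply: cvg_trans; first exact: (near_eq_cvg E).
have L : (fun h : R => A + h * B) @ (0 : R)^' --> A + 0 * B.
  apply: cvgD; first exact: cvg_cst.
  by apply: cvgM; [exact: nbhs_dnbhs|exact: cvg_cst].
by rewrite mul0r addr0 in L.
Unshelve. all: by end_near. Qed.

End C1Matrices.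

Lemma posdef_unitmx (R : realType) m (A : 'M[R]_m.+1) :
  (forall v : 'rV[R]_m.+1, v != 0 -> 0 < (v *m A *m v^T) 0 0) -> A \in unitmx.
Proof.
move=> pA; rewrite -row_free_unit -kermx_eq0; apply/rowV0P => v /sub_kermxP vA.
apply/eqP/negPn/negP => v0; have := pA v v0.
by rewrite vA mul0mx mxE ltxx.
Qed.

Lemma near_eq_Ham (R : realType) n (h k : pcoord R n -> R) q :
  (\forall y \near q, h y = k y) -> Ham h q = Ham k q.
Proof.
move=> hk; rewrite /Ham; congr (_, _, _, _); rewrite ?(near_eq_derive _ hk) //.
- by apply/rowP => j; rewrite !mxE (near_eq_derive _ hk).
- by apply/rowP => j; rewrite !mxE (near_eq_derive _ hk).
Qed.

Fact ginv_key : {f : forall (R : realType) (n : nat) (G : geometry R n),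
  chart R n G -> 'rV[R]_n.+1 -> 'M[R]_n.+1 | f = fun R n G c u => invmx (metric c (psi c u))}.
Proof. by eexists. Qed.

Fact psy_key : {f : forall (R : realType) (n : nat) (G : geometry R n),
  chart R n G -> pcoord R n -> R | f = @psym}.
Proof. by eexists. Qed.

(** * The symbol p, its Hamiltonian field and its brackets with z *)

Section Symbols.
Context {R : realType} {n : nat} {G : geometry R n}.
Local Notation P := (pcoord R n).
Implicit Types (c : chart R n G) (q : P) (rho : phase G) (x : G) (u : 'rV[R]_n.+1).

Definition ginv c u : 'M[R]_n.+1 := sval ginv_key R n G c u.
Definition psy c q : R := sval psy_key R n G c q.

Lemma ginvE c u : ginv c u = invmx (metric c (psi c u)).
Proof. by rewrite /ginv; case: ginv_key => f /= ->. Qed.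

Lemma psyE c : psy c = psym c.
Proof. by apply/funext => q; rewrite /psy; case: psy_key => f /= ->. Qed.

Lemma psy_def c q : psy c q =
  - co_tau q ^+ 2 + (co_xi q *m ginv c (co_x q) *m (co_xi q)^T) 0 0.
Proof. by rewrite psyE ginvE. Qed.

(** Coordinates of points over the open set on which [metric_C1] holds; elsewhere the matrix
    [metric] carries no information. *)
Definition good c q := pcod c q /\ mdom (psi c (co_x q)).

Lemma near_good c q : good c q -> \forall q' \near q, good c q'.
Proof.
move=> [cq mq]; have h1 := pcod_near cq.
have h2 : \forall q' \near q, mdom (psi c (co_x q')).
  by apply: pcod_near_psi => //; apply: open_nbhs_nbhs; split => //; exact: mdom_open.
by near=> q'; split; near: q'.
Unshelve. all: by end_near. Qed.

Lemma good_lcrd c rho : dom c (ph_x rho) -> mdom (ph_x rho) -> good c (lcrd c rho).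
Proof. by move=> dx mx; split; [exact: pcod_lcrd|rewrite co_x_lcrd phiK]. Qed.

Section OneChart.
Variable c : chart R n G.
Hypothesis ac : atlas c.

Lemma metric_sym x : dom c x -> mdom x -> (metric c x)^T = metric c x.
Proof. by move=> dx mx; have [H _ _] := @metric_C1 R n G; have [] := H c x ac dx mx. Qed.

Lemma metric_unit x : dom c x -> mdom x -> metric c x \in unitmx.
Proof.
move=> dx mx; have [H _ _] := @metric_C1 R n G; have [_] := H c x ac dx mx.
exact: posdef_unitmx.
Qed.

Lemma ginv_sym q : good c q -> (ginv c (co_x q))^T = ginv c (co_x q).
Proof. by move=> [/psiK[dx _] mx]; rewrite ginvE trmx_inv metric_sym. Qed.

Lemma ginv_pos q (v : 'rV[R]_n.+1) : good c q -> v != 0 ->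
  0 < (v *m ginv c (co_x q) *m v^T) 0 0.
Proof.
move=> gq v0; have [/psiK[dx _] mx] := gq; set x := psi c (co_x q) in dx mx.
have [H _ _] := @metric_C1 R n G; have [gs gp] := H c x ac dx mx.
have gu := metric_unit dx mx.
have w0 : v *m ginv c (co_x q) != 0.
  apply: contra_neq v0 => e.
  have -> : v = v *m ginv c (co_x q) *m metric c x by rewrite ginvE -/x mulmxKV.
  by rewrite e mul0mx.
have := gp _ w0; rewrite trmx_mul ginv_sym // mulmxA.
by rewrite -(mulmxA v) (_ : ginv c (co_x q) *m metric c x = 1%:M) ?mulmx1 // ginvE mulVmx.
Qed.

Lemma ginv_C1 q i j : good c q -> C1pt (fun q' => ginv c (co_x q') i j) q.
Proof.
move=> [cq mx]; have [dx uE] := psiK cq.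
have [_ H _] := @metric_C1 R n G.
have u_in : (phi c @` (dom c `&` mdom (g := G))) (co_x q) by exists (psi c (co_x q)).
have cm : C1pt (metric c \o psi c) (co_x q) by exact: (H c ac (co_x q) u_in).
have [L LE] := linear_ex (@co_x_linear R n).
have cL : continuous L by rewrite LE; exact: co_x_continuous.
rewrite (_ : (fun q' => _) = (fun u => ginv c u i j) \o L); last by rewrite LE.
apply: C1pt_comp_lin => //; rewrite LE.
rewrite (_ : (fun u => _) = fun u => invmx ((metric c \o psi c) u) i j); last first.
  by apply/funext => u; rewrite ginvE.
apply: C1pt_invmx; first by move=> k l; exact: C1pt_coord.
have nd := near_psi cq (near_dom dx).
have nm : \forall v \near co_x q, mdom (psi c v).
  by apply: (near_psi cq); apply: open_nbhs_nbhs; split => //; exact: mdom_open.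
by near=> v; apply: metric_unit; near: v.
Unshelve. all: by end_near. Qed.

Lemma C1pt_co_tau q : C1pt (@co_tau R n) q.
Proof.
have [L LE] := linear_ex (@co_tau_linear R n).
by rewrite -LE; apply: C1pt_lin; rewrite LE; exact: co_tau_continuous.
Qed.

Lemma C1pt_co_xi j q : C1pt (fun q => co_xi q 0 j) q.
Proof.
have [L LE] := linear_ex (@co_xi_linear R n).
apply: C1pt_coord; rewrite -LE; apply: C1pt_lin; rewrite LE; exact: co_xi_continuous.
Qed.

Lemma psy_sum q : psy c q = - co_tau q ^+ 2 +
  \sum_j (\sum_i co_xi q 0 i * ginv c (co_x q) i j) * co_xi q 0 j.
Proof.
by rewrite psy_def; congr (_ + _); rewrite mxE; apply: eq_bigr => j _; rewrite !mxE.
Qed.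

Lemma psy_C1 q : good c q -> C1pt (psy c) q.
Proof.
move=> gq; rewrite (_ : psy c = fun q => (-1) * (co_tau q * co_tau q) +
  \sum_j (\sum_i co_xi q 0 i * ginv c (co_x q) i j) * co_xi q 0 j); last first.
  by apply/funext => q'; rewrite psy_sum mulN1r expr2.
apply: C1ptD.
  by apply: C1ptM; [exact: C1pt_cst|apply: C1ptM; exact: C1pt_co_tau].
apply: C1pt_sum => j _; apply: C1ptM; last exact: C1pt_co_xi.
by apply: C1pt_sum => i _; apply: C1ptM; [exact: C1pt_co_xi|exact: ginv_C1].
Qed.

(** Closed form of {p, z}. Free of derivatives of the metric, it is as regular as the metric, namely
    C^1, so that it can be differentiated once more along the curve. *)
Definition Hp_z q : R := 2 * (co_xi q *m ginv c (co_x q)) 0 ord_max.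

Lemma Hp_z_C1 q : good c q -> C1pt Hp_z q.
Proof.
move=> gq; rewrite (_ : Hp_z = fun q => 2 * \sum_i co_xi q 0 i * ginv c (co_x q) i ord_max).
  apply: C1ptM; first exact: C1pt_cst.
  by apply: C1pt_sum => i _; apply: C1ptM; [exact: C1pt_co_xi|exact: ginv_C1].
by apply/funext => q'; rewrite /Hp_z mxE.
Qed.

Lemma psy_vert q (tau : R) (xi : 'rV[R]_n.+1) : good c q ->
  'D_((0, 0, tau, xi) : P) (psy c) q = - 2 * co_tau q * tau +
    2 * (co_xi q *m ginv c (co_x q) *m xi^T) 0 0.
Proof.
move=> gq; apply: (derive_quadratic (B := - tau ^+ 2 + (xi *m ginv c (co_x q) *m xi^T) 0 0)) => s.
have xE : co_x (s *: ((0, 0, tau, xi) : P) + q) = co_x q by rewrite linearD linearZ /= co_xE scaler0 add0r.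
have tE : co_tau (s *: ((0, 0, tau, xi) : P) + q) = s * tau + co_tau q by rewrite linearD linearZ.
have xiE : co_xi (s *: ((0, 0, tau, xi) : P) + q) = s *: xi + co_xi q by rewrite linearD linearZ.
rewrite !psy_def xE tE xiE; set g := ginv c (co_x q).
have gs : g^T = g by exact: ginv_sym.
have sw : (xi *m g *m (co_xi q)^T) 0 0 = (co_xi q *m g *m xi^T) 0 0.
  rewrite -[RHS](_ : ((co_xi q *m g *m xi^T)^T) 0 0 = _); last by rewrite mxE.
  by rewrite !trmx_mul trmxK gs mulmxA.
rewrite [(_ + _)^T]raddfD /= [(_ *: _)^T]linearZ /= !mulmxDl !mulmxDr -!scalemxAl -!scalemxAr.
have ee (M M' : 'M[R]_1) : (M + M') 0 0 = M 0 0 + M' 0 0 by rewrite mxE.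
have es (M : 'M[R]_1) (r : R) : (r *: M) 0 0 = r * M 0 0 by rewrite mxE.
by rewrite !(ee, es) sw; ring.
Qed.

Lemma Ham_psy q : good c q -> [/\ co_t (Ham (psy c) q) = - 2 * co_tau q,
  co_x (Ham (psy c) q) = 2 *: (co_xi q *m ginv c (co_x q)) &
  co_tau (Ham (psy c) q) = 0].
Proof.
move=> gq; rewrite /Ham !coE; split.
- by rewrite /e_tau psy_vert // trmx0 mulmx0 mxE mulr0 addr0 mulr1.
- apply/rowP => j; rewrite !mxE /e_xi psy_vert // mulr0 add0r.
  by congr (_ * _); rewrite trmx_delta -colE mxE mxE.
- rewrite (_ : 'D_e_t (psy c) q = 0) ?oppr0 //.
  apply: (derive_quadratic (B := 0)) => s; rewrite !mulr0 !addr0.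
  have xE : co_x (s *: (e_t : P) + q) = co_x q by rewrite linearD linearZ /= co_xE scaler0 add0r.
  have tE : co_tau (s *: (e_t : P) + q) = co_tau q.
    by rewrite linearD linearZ /= co_tauE [_ *: _]mulr0 add0r.
  have xiE : co_xi (s *: (e_t : P) + q) = co_xi q by rewrite linearD linearZ /= scaler0 add0r.
  by rewrite !psy_def xE tE xiE.
Qed.

Lemma zfun_lin : linear (@zfun R n).
Proof. by move=> a q q'; rewrite /zfun /zlast linearD linearZ !mxE. Qed.

Lemma zfun_continuous : continuous (@zfun R n).
Proof.
move=> q; exact: (continuous_comp (@co_x_continuous R n q) (@coord_continuous _ _ _ _ _ _)).
Qed.

Lemma C1pt_zfun q : C1pt (@zfun R n) q.
Proof.
have [L LE] := linear_ex zfun_lin.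
by rewrite -LE; apply: C1pt_lin; rewrite LE; exact: zfun_continuous.
Qed.

Lemma diff_zfun q v : 'd (@zfun R n) q v = zfun v.
Proof.
have [L LE] := linear_ex zfun_lin.
by rewrite -LE diff_lin // LE; exact: zfun_continuous.
Qed.

Lemma poisson_psy_z q : good c q -> poisson (psy c) zfun q = Hp_z q.
Proof.
move=> gq; rewrite poisson_diff; last exact: C1pt_diff (C1pt_zfun q).
rewrite diff_zfun /zfun /zlast; have [_ -> _] := Ham_psy gq.
by rewrite mxE.
Qed.

Definition Hp2_z q : R := 'd Hp_z q (Ham (psy c) q).

Lemma poisson2_psy_z q : good c q -> poisson (psy c) (poisson (psy c) zfun) q = Hp2_z q.
Proof.
move=> gq; rewrite /Hp2_z -poisson_diff; last exact: C1pt_diff (Hp_z_C1 gq).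
rewrite /poisson; apply: near_eq_derive; near=> q'; apply: poisson_psy_z.
by near: q'; exact: near_good.
Unshelve. all: by end_near. Qed.

Definition e_zeta : P := (0, 0, 0, delta_mx 0 ord_max).

Lemma Ham_zfun q : Ham (@zfun R n) q = - e_zeta.
Proof.
have dz : differentiable (@zfun R n) q by exact: C1pt_diff (C1pt_zfun q).
have z0 (v : P) : co_x v = 0 -> 'D_v (@zfun R n) q = 0.
  by move=> v0; rewrite deriveE // diff_zfun /zfun v0 /zlast mxE.
rewrite /Ham /e_zeta; apply: pcoord_eq; rewrite ?(linearN (@co_t R n)) ?(linearN (@co_x R n))
   ?(linearN (@co_tau R n)) ?(linearN (@co_xi R n)) !coE.
- by rewrite z0 // oppr0.
- by apply/rowP => j; rewrite !mxE z0 // oppr0.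
- by rewrite z0.
- apply/rowP => j; rewrite !mxE deriveE // diff_zfun /zfun /e_x coE /zlast mxE eqxx /=.
  by rewrite eq_sym.
Qed.

Lemma e_zetaN : - e_zeta = (0, 0, 0, - delta_mx 0 ord_max) :> P.
Proof.
by rewrite /e_zeta; apply: pcoord_eq; rewrite ?(linearN (@co_t R n)) ?(linearN (@co_x R n))
   ?(linearN (@co_tau R n)) ?(linearN (@co_xi R n)) !coE ?oppr0.
Qed.

Lemma derive_Hp_z_e_zeta q : 'D_(- e_zeta) Hp_z q = - (2 * ginv c (co_x q) ord_max ord_max).
Proof.
rewrite e_zetaN; apply: (derive_quadratic (B := 0)) => s.
have xE : co_x (s *: ((0, 0, 0, - delta_mx 0 ord_max) : P) + q) = co_x q.
  by rewrite linearD linearZ /= co_xE scaler0 add0r.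
have xiE : co_xi (s *: ((0, 0, 0, - delta_mx 0 ord_max) : P) + q) = - s *: delta_mx 0 ord_max + co_xi q.
  by rewrite linearD linearZ /= scalerN scaleNr.
rewrite /Hp_z xE xiE mulmxDl -scalemxAl -rowE.
have ee (M M' : 'rV[R]_n.+1) j : (M + M') 0 j = M 0 j + M' 0 j by rewrite mxE.
have es (M : 'rV[R]_n.+1) (r : R) j : (r *: M) 0 j = r * M 0 j by rewrite mxE.
have er (M : 'M[R]_n.+1) i j : (row i M) 0 j = M i j by rewrite mxE.
by rewrite !(ee, es, er); ring.
Qed.

Lemma poisson_z_psy q : good c q -> poisson zfun (psy c) q = - Hp_z q.
Proof.
move=> gq; rewrite /poisson Ham_zfun e_zetaN psy_vert // mulr0 add0r.
rewrite raddfN /= mulmxN trmx_delta -colE.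
have er (M : 'rV[R]_n.+1) j : (- col j M) 0 0 = - M 0 j by rewrite !mxE.
by rewrite er /Hp_z mulrN.
Qed.

Lemma poisson2_z_psy q : good c q ->
  poisson zfun (poisson zfun (psy c)) q = 2 * ginv c (co_x q) ord_max ord_max.
Proof.
move=> gq; rewrite /poisson Ham_zfun.
transitivity ('D_(- e_zeta) (- Hp_z) q).
  apply: near_eq_derive; near=> q'; apply: poisson_z_psy.
  by near: q'; exact: near_good.
have dw := C1pt_diff (Hp_z_C1 gq).
by rewrite deriveN ?derive_Hp_z_e_zeta ?opprK //; exact: diff_derivable.
Unshelve. all: by end_near. Qed.

Lemma HamGE q : good c q ->
  HamG c q = Ham (psy c) q + (Hp2_z q / (2 * ginv c (co_x q) ord_max ord_max)) *: - e_zeta.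
Proof.
move=> gq; rewrite /HamG -!psyE poisson2_psy_z // poisson2_z_psy //.
by rewrite Ham_zfun.
Qed.

Lemma ginv_last_gt0 q : good c q -> 0 < ginv c (co_x q) ord_max ord_max.
Proof.
move=> gq; have := ginv_pos gq (v := delta_mx 0 ord_max).
rewrite -rowE trmx_delta -colE !mxE; apply.
by apply/eqP => /(congr1 (fun M : 'rV[R]_n.+1 => M 0 ord_max)); rewrite !mxE !eqxx /= => /eqP; rewrite oner_eq0.
Qed.

(** This is the purpose of the gliding field: the quotient in [HamG] is the multiple of H_z that
    cancels the derivative of H_p z. *)
Lemma diff_Hp_z_HamG q : good c q -> 'd Hp_z q (HamG c q) = 0.
Proof.
move=> gq; have dw := C1pt_diff (Hp_z_C1 gq).
rewrite HamGE // linearD linearZ /=.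
have -> : 'd Hp_z q (- e_zeta) = - (2 * ginv c (co_x q) ord_max ord_max).
  by rewrite -deriveE // derive_Hp_z_e_zeta.
rewrite -/(Hp2_z q).
by rewrite /GRing.scale /=; field; rewrite gt_eqF // ginv_last_gt0.
Qed.

End OneChart.

Lemma metric_change c c' x : atlas c -> atlas c' -> dom c x -> dom c' x -> mdom x ->
  metric c x = tjac c c' x *m metric c' x *m (tjac c c' x)^T.
Proof.
by move=> ac ac' dx dx' mx; rewrite tjacE; have [_ _ H] := @metric_C1 R n G; exact: H.
Qed.

Lemma ginv_change c c' q : atlas c -> atlas c' -> good c q -> dom c' (psi c (co_x q)) ->
  ginv c' (phi c' (psi c (co_x q))) = (tjac c c' (psi c (co_x q)))^T *m ginv c (co_x q) *m
    tjac c c' (psi c (co_x q)).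
Proof.
move=> ac ac' [/psiK[dx _] mx] dx'; rewrite !ginvE phiK //.
set x := psi c (co_x q) in dx mx dx' *.
rewrite (metric_change ac' ac dx' dx mx).
have um := metric_unit ac dx mx.
have h1 := tjac_inv ac ac' dx dx'; have h2 := tjac_inv ac' ac dx' dx.
set T := tjac c c' x in h1 h2 *; set T' := tjac c' c x in h1 h2 *.
suff H : T' *m metric c x *m T'^T *m (T^T *m invmx (metric c x) *m T) = 1%:M.
  have [u _] := mulmx1_unit H.
  by rewrite -[LHS]mulmx1 -H mulKmx.
rewrite -!mulmxA (mulmxA T'^T) -trmx_mul h1 trmx1 mul1mx.
by rewrite (mulmxA (metric c x)) mulmxV // mul1mx.
Qed.

Lemma psy_clift c c' q : atlas c -> atlas c' -> good c q -> dom c' (psi c (co_x q)) ->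
  psy c' (clift c c' q) = psy c q.
Proof.
move=> ac ac' gq dx'; have [/psiK[dx _] mx] := gq.
rewrite !psy_def co_tau_clift co_x_clift co_xi_clift (ginv_change ac ac' gq dx').
set x := psi c (co_x q) in dx mx dx' *.
have h1 := tjac_inv ac ac' dx dx'.
set T := tjac c c' x in h1 *; set T' := tjac c' c x in h1 *.
congr (_ + _); rewrite trmx_mul trmxK -!mulmxA (mulmxA T) h1 mul1mx.
by rewrite (mulmxA T'^T) -trmx_mul h1 trmx1 mul1mx.
Qed.

Lemma lcrd_clift c c' rho : atlas c -> atlas c' -> dom c (ph_x rho) -> dom c' (ph_x rho) ->
  clift c c' (lcrd c rho) = lcrd c' rho.
Proof.
move=> ac ac' dx dx'; rewrite -(lcrd_lift ac ac'); last 2 first.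
- exact: pcod_lcrd.
- by rewrite co_x_lcrd phiK.
by rewrite ofcrd_lcrd.
Qed.

Lemma p_chart c rho : atlas c -> dom c (ph_x rho) -> mdom (ph_x rho) ->
  p rho = psy c (lcrd c rho).
Proof.
move=> ac dx mx; rewrite /p -psyE -lcrdE.
rewrite -(lcrd_clift ac (pref_chart_atlas (ph_x rho)) dx (pref_chart_dom _)).
apply: psy_clift => //; [exact: pref_chart_atlas|exact: good_lcrd|].
by rewrite co_x_lcrd phiK //; exact: pref_chart_dom.
Qed.

(** By [psy_clift] the symbol in [c] is the pull-back of the symbol in [c'] near [q], and lifts are
    symplectic. *)
Lemma Ham_change c c' q : atlas c -> atlas c' -> good c q -> dom c' (psi c (co_x q)) ->
  differentiable (clift c c') q /\
  'd (clift c c') q (Ham (psy c) q) = Ham (psy c') (clift c c' q).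
Proof.
move=> ac ac' gq dx'; have [cq mx] := gq; have [/psiK[dx _] _] := gq.
have [H1 H2 H3 H4 H5] := lift_hyp ac ac' cq dx'.
have gq' : good c' (clift c c' q).
  split; first by rewrite /pcod /= co_x_clift; exact: psi_phi_dom.
  by rewrite co_x_clift phiK.
have dh := C1pt_diff (psy_C1 ac' gq').
have -> : Ham (psy c) q = Ham (psy c' \o clift c c') q.
  apply: near_eq_Ham; have n1 := near_good gq.
  have n2 := pcod_near_psi cq (near_dom dx').
  by near=> q'; rewrite /= psy_clift //; near: q'.
by rewrite cliftE in dh *; exact: Ham_cotangent_lift.
Unshelve. all: by end_near. Qed.

Definition C1ph (a : phase G -> R) :=
  forall c, atlas c -> C1on (pcod c) (a \o of_coord c).

Lemma C1ph_pt a c q : C1ph a -> atlas c -> pcod c q -> C1pt (a \o ofcrd c) q.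
Proof.
move=> ca ac cq; rewrite (_ : a \o ofcrd c = a \o of_coord c); first exact: (ca c ac q cq).
by apply/funext => z /=; rewrite ofcrdE.
Qed.

Lemma diff_change a c c' q v : C1ph a -> atlas c -> atlas c' -> pcod c q ->
  dom c' (psi c (co_x q)) ->
  'd (a \o ofcrd c) q v = 'd (a \o ofcrd c') (clift c c' q) ('d (clift c c') q v).
Proof.
move=> ca ac ac' cq dx'; have [dx _] := psiK cq.
have [H1 H2 H3 H4 H5] := lift_hyp ac ac' cq dx'.
have dl : differentiable (clift c c') q.
  by rewrite cliftE; have [S _ H] := is_diff_cotangent_lift H1 H2 H3; exact: ex_diff.
have cq' : pcod c' (clift c c' q) by rewrite /pcod /= co_x_clift; exact: psi_phi_dom.
have da := C1pt_diff (C1ph_pt ca ac cq); have da' := C1pt_diff (C1ph_pt ca ac' cq').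
have E : \forall z \near q, (a \o ofcrd c) z = ((a \o ofcrd c') \o clift c c') z.
  have h1 := pcod_near cq; have h2 := pcod_near_psi cq (near_dom dx').
  near=> z; have cz : pcod c z by near: z.
  have dz : dom c' (psi c (co_x z)) by near: z.
  rewrite /= -(lcrd_lift ac ac' cz dz) ofcrd_lcrd // ph_x_ofcrd //.
have [_ HE] := near_eq_is_diff E da.
have := etrans (esym HE) (diff_comp dl da').
by move=> /(congr1 (fun F : P -> R => F v)).
Unshelve. all: by end_near. Qed.

Lemma Hp_chart a c rho : C1ph a -> atlas c -> dom c (ph_x rho) -> mdom (ph_x rho) ->
  Hp a rho = 'd (a \o ofcrd c) (lcrd c rho) (Ham (psy c) (lcrd c rho)).
Proof.
move=> ca ac dx mx; rewrite /Hp -psyE -lcrdE.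
set c0 := pref_chart _; have ac0 : atlas c0 by exact: pref_chart_atlas.
have dx0 : dom c0 (ph_x rho) by exact: pref_chart_dom.
have -> : a \o of_coord c0 = a \o ofcrd c0 by apply/funext => z /=; rewrite ofcrdE.
have cq := pcod_lcrd dx; have cq0 := pcod_lcrd dx0.
have dq0 : dom c0 (psi c (co_x (lcrd c rho))) by rewrite co_x_lcrd phiK.
rewrite poisson_diff; last exact: C1pt_diff (C1ph_pt ca ac0 cq0).
have E1 := diff_change (Ham (psy c) (lcrd c rho)) ca ac ac0 cq dq0.
have [_ E2] := Ham_change ac ac0 (good_lcrd dx mx) dq0.
have E3 := lcrd_clift ac ac0 dx dx0.
have E4 := etrans E2 (congr1 (Ham (psy c0)) E3).
exact: (esym (etrans E1 (congr2 (fun y v => 'd (a \o ofcrd c0) y v) E3 E4))).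
Qed.

(** [Hp] reads each point in its own preferred chart, and these charts need not vary continuously;
    [Hp_chart] replaces them by a single chart near [rho]. *)
Lemma Hp_continuous a rho : C1ph a -> mdom (ph_x rho) -> {for rho, continuous (Hp a)}.
Proof.
move=> ca mx; set c := pref_chart (ph_x rho).
have ac : atlas c by exact: pref_chart_atlas.
have dx : dom c (ph_x rho) by exact: pref_chart_dom.
have E : \forall r \near rho, 'd (a \o ofcrd c) (lcrd c r) (Ham (psy c) (lcrd c r)) = Hp a r.
  have h1 : \forall r \near rho, dom c (ph_x r) by apply: ph_x_continuous; exact: near_dom.
  have h2 : \forall r \near rho, mdom (ph_x r).
    by apply: ph_x_continuous; apply: open_nbhs_nbhs; split => //; exact: mdom_open.
  by near=> r; rewrite (Hp_chart ca ac) //; near: r.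
have L := lcrd_continuous ac dx.
have HL : (fun r => Ham (psy c) (lcrd c r)) @ rho --> Ham (psy c) (lcrd c rho).
  exact: (@Ham_cvg R n _ (nbhs rho) _ _ _ _ (psy_C1 ac (good_lcrd dx mx)) L).
have D : (fun r => 'd (a \o ofcrd c) (lcrd c r) (Ham (psy c) (lcrd c r))) @ rho -->
    'd (a \o ofcrd c) (lcrd c rho) (Ham (psy c) (lcrd c rho)).
  exact: (@cvg_diff R n _ (nbhs rho) _ _ _ _ _ _ (C1ph_pt ca ac (pcod_lcrd dx)) L HL).
exact: (near_eq_continuous E D).
Unshelve. all: by end_near. Qed.

Lemma p_continuous rho : mdom (ph_x rho) -> {for rho, continuous (@p R n G)}.
Proof.
move=> mx; set c := pref_chart (ph_x rho).
have ac : atlas c by exact: pref_chart_atlas.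
have dx : dom c (ph_x rho) by exact: pref_chart_dom.
have E : \forall r \near rho, psy c (lcrd c r) = p r.
  have h1 : \forall r \near rho, dom c (ph_x r) by apply: ph_x_continuous; exact: near_dom.
  have h2 : \forall r \near rho, mdom (ph_x r).
    by apply: ph_x_continuous; apply: open_nbhs_nbhs; split => //; exact: mdom_open.
  by near=> r; rewrite (p_chart ac) //; near: r.
have L := lcrd_continuous ac dx.
have C := differentiable_continuous (C1pt_diff (psy_C1 ac (good_lcrd dx mx))).
have D := continuous_comp L C.
exact: (near_eq_continuous E D).
Unshelve. all: by end_near. Qed.

End Symbols.

Lemma approx1_is_derive (R : realType) (F : R -> R) (s l : R) :
  is_derive s (1 : R) F l -> approx1 F s l.
Proof.
move=> [dF Fl] e e0; have /cvgrPdist_le /(_ e e0) : (fun h => h^-1 *: ((F \o shift s) (h *: (1 : R)) - F s)) @ (0 : R)^' --> l.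
  by rewrite -Fl; exact: dF.
rewrite near_withinE => /near_ball[d d0 Hd].
apply: (ball_near d0) => s' s'd.
have [->|ss'] := eqVneq s' s; first by rewrite !subrr mulr0 subrr !normr0 mulr0.
have h0 : s' - s != 0 by rewrite subr_eq0.
have hd : `|0 - (s' - s)| < d by rewrite sub0r opprB.
have := Hd (s' - s) hd h0; rewrite /= /GRing.scale /= mulr1 subrK => H.
have -> : F s' - F s - l * (s' - s) = - ((s' - s) * (l - (s' - s)^-1 * (F s' - F s))).
  by field.
by rewrite normrN normrM mulrC; apply: ler_wpM2r.
Qed.

(** * Quasi-normal coordinates and the jump *)

Section QuasiNormal.
Context {R : realType} {n : nat} {G : geometry R n}.
Local Notation P := (pcoord R n).
Local Notation bM := (boundary (@Mset R n G)).
Local Notation qn := (quasi_normal (@Mset R n G) (@metric R n G)).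
Implicit Types (c : chart R n G) (q : P) (rho : phase G) (x : G).

Lemma Mset_mdom x : Mset x -> mdom x.
Proof. by move=> /(@M_sub_Mhat R n G)/interior_subset/(@Mhat_sub_mdom R n G). Qed.

Lemma bM_mdom x : bM x -> mdom x.
Proof. by move=> [/Mset_mdom]. Qed.

Lemma qn_chartP x : bM x -> qn (qn_chart x) /\ dom (qn_chart x) x.
Proof.
by move=> bx; rewrite /qn_chart; case: pselect => // b; case: cid2.
Qed.

Lemma qn_atlas c : qn c -> atlas c. Proof. by case. Qed.

Lemma zlast_lin : linear (@zlast R n).
Proof. by move=> a u v; rewrite /zlast !mxE. Qed.
HB.instance Definition _ := GRing.isLinear.Build R 'rV[R]_n.+1 R _ (@zlast R n) zlast_lin.

Lemma zlast_continuous : continuous (@zlast R n).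
Proof. exact: coord_continuous. Qed.

Lemma metric_qn c x : qn c -> dom c x -> bM x ->
  metric c x *m delta_mx ord_max 0 = delta_mx ord_max 0 :> 'cV[R]_n.+1.
Proof.
move=> [_ _ _ H] dx bx; apply/colP => i; rewrite -colE !mxE H //.
by rewrite eqxx andbT.
Qed.

Lemma ginv_qn c x : qn c -> dom c x -> bM x ->
  ginv c (phi c x) *m delta_mx ord_max 0 = delta_mx ord_max 0 :> 'cV[R]_n.+1.
Proof.
move=> qc dx bx; rewrite ginvE phiK // -{1}(metric_qn qc dx bx).
have u : metric c x \in unitmx by apply: metric_unit; [exact: qn_atlas|by []|exact: bM_mdom].
by rewrite mulKmx.
Qed.

(* Both charts map the boundary to {z = 0}, so the last column of the Jacobian is a multiple of
   e_d; the normalization of the metric then determines the multiple and the last row. *)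
Lemma qn_tjac c c' x : qn c -> qn c' -> dom c x -> dom c' x -> bM x ->
  tjac c' c x *m delta_mx ord_max 0 = delta_mx ord_max 0 :> 'cV[R]_n.+1 /\
  (tjac c' c x)^T *m delta_mx ord_max 0 = delta_mx ord_max 0 :> 'cV[R]_n.+1.
Proof.
move=> qc qc' dx dx' bx; have ac := qn_atlas qc; have ac' := qn_atlas qc'.
set S := tjac c' c x.
pose th := phi c \o psi c'.
pose u0 := phi c' x.
have dth : differentiable th u0 := C1pt_diff (C2_trans ac' ac dx' dx).1.
have overlap : \forall u \near u0, [/\ (phi c' @` dom c') u, dom c' (psi c' u), phi c' (psi c' u) = u & dom c (psi c' u)].
  by apply: near_overlap; [exact: psi_phi_dom|rewrite phiK].
have line (v : 'rV[R]_n.+1) : approx1 (fun s : R => zlast (th (u0 + s *: v))) 0 (zlast (v *m S)) /\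
    \forall s \near (0 : R), [/\ dom c' (psi c' (u0 + s *: v)),
      phi c' (psi c' (u0 + s *: v)) = u0 + s *: v & dom c (psi c' (u0 + s *: v))].
  split.
    apply: approx1_is_derive; rewrite mul_tjac.
    have dz : differentiable (@zlast R n) (th u0) by apply: linear_differentiable; exact: zlast_continuous.
    have E : u0 + 0 *: v = u0 by rewrite scale0r addr0.
    have := @is_derive_line R _ _ (@zlast R n \o th) u0 v 0; rewrite E.
    have dzt : differentiable (@zlast R n \o th) u0 by exact: differentiable_comp.
    move=> /(_ dzt); rewrite (diff_comp dth dz) /= (diff_lin _ zlast_continuous).
    exact.
  have c0 : (fun s : R => u0 + s *: v) @ (0 : R) --> u0 + 0 *: v.
    by apply: cvgD; [exact: cvg_cst|exact: scalel_continuous].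
  rewrite scale0r addr0 in c0.
  have H : \forall s \near (0 : R), [/\ (phi c' @` dom c') (u0 + s *: v),
      dom c' (psi c' (u0 + s *: v)), phi c' (psi c' (u0 + s *: v)) = u0 + s *: v &
      dom c (psi c' (u0 + s *: v))] by exact: (c0 _ overlap).
  by apply: filterS H => s [].
have th0 : zlast (th u0) = 0.
  by rewrite /th /= phiK //; case: qc => _ _ /(_ x dx) [+ _] _; apply.
have z0 : zlast u0 = 0 by case: qc' => _ _ /(_ x dx') [+ _] _; apply.
(* A line tangent to the boundary in [c'] stays in z = 0, and so does its image in [c]; the
   difference quotients of the last coordinate vanish. *)
have tang (v : 'rV[R]_n.+1) : zlast v = 0 -> zlast (v *m S) = 0.
  move=> v0; have [app dm] := line v.
  apply/eqP; rewrite -normr_le0; apply/ler_addgt0Pr => e e0; rewrite add0r.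
  have [d d0 Hd] := near_ball (app e e0); have [d' d'0 Hd'] := near_ball dm.
  pose s := Num.min d d' / 2.
  have m0 : 0 < Num.min d d' by rewrite lt_min d0 d'0.
  have s0 : 0 < s by rewrite divr_gt0.
  have md : Num.min d d' <= d by rewrite ge_min lexx.
  have md' : Num.min d d' <= d' by rewrite ge_min lexx orbT.
  have sd : `|0 - s| < d by rewrite sub0r normrN gtr0_norm // /s; lra.
  have sd' : `|0 - s| < d' by rewrite sub0r normrN gtr0_norm // /s; lra.
  have [ds' us ds] := Hd' s sd'.
  have zs : zlast (th (u0 + s *: v)) = 0.
    have b : bM (psi c' (u0 + s *: v)).
      by case: qc' => _ _ /(_ _ ds') [_ +] _; apply; rewrite us linearD linearZ /= z0 v0 scaler0 addr0.
    by case: qc => _ _ /(_ _ ds) [+ _] _; apply.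
  have := Hd s sd; rewrite zs scale0r addr0 th0 !subr0 sub0r normrN normrM (gtr0_norm s0).
  by rewrite ler_pM2r.
(* The metric will only give that the square of [al] is 1. Its sign comes from M being the side z >=
   0 in both charts. *)
have pos : 0 <= zlast ((delta_mx 0 ord_max : 'rV[R]_n.+1) *m S).
  set v : 'rV[R]_n.+1 := delta_mx 0 ord_max; have [app dm] := line v.
  have zv : zlast v = 1 by rewrite /zlast mxE !eqxx.
  apply/ler_addgt0Pr => e e0.
  have [d d0 Hd] := near_ball (app e e0); have [d' d'0 Hd'] := near_ball dm.
  pose s := Num.min d d' / 2.
  have m0 : 0 < Num.min d d' by rewrite lt_min d0 d'0.
  have s0 : 0 < s by rewrite divr_gt0.
  have md : Num.min d d' <= d by rewrite ge_min lexx.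
  have md' : Num.min d d' <= d' by rewrite ge_min lexx orbT.
  have sd : `|0 - s| < d by rewrite sub0r normrN gtr0_norm // /s; lra.
  have sd' : `|0 - s| < d' by rewrite sub0r normrN gtr0_norm // /s; lra.
  have [ds' us ds] := Hd' s sd'.
  have zs : 0 <= zlast (th (u0 + s *: v)).
    have b : Mset (psi c' (u0 + s *: v)).
      case: qc' => _ /(_ _ ds') [_ +] _ _; apply; rewrite us linearD linearZ /= z0 zv add0r.
      by rewrite [_ *: _]mulr1 ltW.
    by case: qc => _ /(_ _ ds) [+ _] _ _; apply.
  have := Hd s sd; rewrite scale0r addr0 th0 !subr0 (gtr0_norm s0) ler_norml => /andP[_ h].
  have : 0 <= (zlast (v *m S) + e) * s by lra.
  by rewrite pmulr_lge0.
set al := zlast _ in pos.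
have Se : S *m delta_mx ord_max 0 = al *: delta_mx ord_max 0 :> 'cV[R]_n.+1.
  apply/colP => i; rewrite -colE [LHS]mxE [RHS]mxE [X in _ * X]mxE eqxx andbT.
  have -> : S i ord_max = zlast ((delta_mx 0 i : 'rV[R]_n.+1) *m S) by rewrite -rowE /zlast mxE.
  have [->|id_] := eqVneq i ord_max; first by rewrite mulr1.
  by rewrite mulr0 tang // /zlast mxE eqxx /= eq_sym (negbTE id_).
have gc : ginv c (phi c x) = S^T *m ginv c' (phi c' x) *m S.
  pose q : P := (0, phi c' x, 0, 0).
  have gq : good c' q by split; rewrite /pcod /= co_xE; [exact: psi_phi_dom|rewrite phiK //; exact: bM_mdom].
  have := ginv_change ac' ac gq; rewrite co_xE phiK //; exact.
have He := ginv_qn qc dx bx; have He' := ginv_qn qc' dx' bx.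
have key : al *: (S^T *m delta_mx ord_max 0) = delta_mx ord_max 0 :> 'cV[R]_n.+1.
  rewrite -[RHS]He gc -!mulmxA Se -!scalemxAr; congr (_ *: _).
  by rewrite He'.
have al1 : al = 1.
  have sT : (S^T *m delta_mx ord_max 0 : 'cV[R]_n.+1) ord_max 0 = S ord_max ord_max.
    by rewrite -colE !mxE.
  have sd : S ord_max ord_max = al.
    have := congr1 (fun M : 'cV[R]_n.+1 => M ord_max 0) Se.
    by rewrite -colE mxE [RHS]mxE [X in _ * X]mxE !eqxx mulr1.
  have := congr1 (fun M : 'cV[R]_n.+1 => M ord_max 0) key.
  rewrite [LHS]mxE sT sd mxE !eqxx => /eqP; rewrite -expr2 sqrf_eq1 => /orP[/eqP //|/eqP alN].
  by move: pos; rewrite alN; lra.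
by rewrite Se al1 scale1r; split => //; rewrite -[RHS]key al1 scale1r.
Qed.

Lemma zlast_mul (u : 'rV[R]_n.+1) : zlast u = (u *m delta_mx ord_max 0 : 'M[R]_1) 0 0.
Proof. by rewrite -colE mxE. Qed.

Lemma zeta_qn c rho : qn c -> dom c (ph_x rho) -> bTL rho ->
  zeta rho = zlast (co_xi (lcrd c rho)).
Proof.
move=> qc dx bx; have [q0 d0] := qn_chartP bx.
rewrite /zeta /qcoord -lcrdE (lcrd_change (qn_atlas qc) (qn_atlas q0) dx d0).
have [_ h] := qn_tjac qc q0 dx d0 bx.
by rewrite !zlast_mul -mulmxA h.
Qed.

(** Written as a translation along [e_zeta], so that a derivative in [r] is a derivative along a
    line. *)
Definition setz q (r : R) : P := q + (r - zlast (co_xi q)) *: e_zeta.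

Lemma co_t_setz q r : co_t (setz q r) = co_t q.
Proof. by rewrite /setz linearD linearZ /= [_ *: _]mulr0 addr0. Qed.
Lemma co_x_setz q r : co_x (setz q r) = co_x q.
Proof. by rewrite /setz linearD linearZ /= scaler0 addr0. Qed.
Lemma co_tau_setz q r : co_tau (setz q r) = co_tau q.
Proof. by rewrite /setz linearD linearZ /= [_ *: _]mulr0 addr0. Qed.
Lemma co_xi_setz q r : co_xi (setz q r) = co_xi q + (r - zlast (co_xi q)) *: delta_mx 0 ord_max.
Proof. by rewrite /setz linearD linearZ. Qed.

Lemma zlast_setz q r : zlast (co_xi (setz q r)) = r.
Proof.
rewrite co_xi_setz linearD linearZ /= {3}/zlast mxE !eqxx /= [_ *: _]mulr1.
by rewrite addrC subrK.
Qed.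

Lemma setz_setz q r r' : setz (setz q r) r' = setz q r'.
Proof.
rewrite {1}/setz zlast_setz {1}/setz -addrA -scalerDl; congr (_ + _ *: _); ring.
Qed.

Lemma setz_id q r : zlast (co_xi q) = r -> setz q r = q.
Proof. by move=> <-; rewrite /setz subrr scale0r addr0. Qed.

(** On the fibre the lift is multiplication by a transposed Jacobian; by [qn_tjac] this preserves
    both the last component and the last basis vector. *)
Lemma setz_clift c c' q r : qn c -> qn c' -> pcod c q -> dom c' (psi c (co_x q)) ->
  bM (psi c (co_x q)) -> clift c c' (setz q r) = setz (clift c c' q) r.
Proof.
move=> qc qc' cq dx' bx; have [dx _] := psiK cq.
have [h1 h2] := qn_tjac qc qc' dx dx' bx.
have zE : zlast (co_xi q *m (tjac c' c (psi c (co_x q)))^T) = zlast (co_xi q).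
  by rewrite !zlast_mul -mulmxA h2.
apply: pcoord_eq.
- by rewrite co_t_clift !co_t_setz co_t_clift.
- by rewrite co_x_clift !co_x_setz co_x_clift.
- by rewrite co_tau_clift !co_tau_setz co_tau_clift.
- rewrite co_xi_clift co_x_setz !co_xi_setz co_xi_clift zE mulmxDl -scalemxAl.
  congr (_ + _ *: _); apply: trmx_inj; rewrite trmx_mul trmxK !trmx_delta.
  exact: h1.
Qed.

Lemma set_zeta_qn c rho r : qn c -> dom c (ph_x rho) -> bTL rho ->
  [/\ ph_x (set_zeta rho r) = ph_x rho, ph_t (set_zeta rho r) = ph_t rho &
      lcrd c (set_zeta rho r) = setz (lcrd c rho) r].
Proof.
move=> qc dx bx; have [q0 d0] := qn_chartP bx.
set c0 := qn_chart (ph_x rho) in q0 d0.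
have ac := qn_atlas qc; have ac0 := qn_atlas q0.
have sE : set_zeta rho r = ofcrd c0 (setz (lcrd c0 rho) r).
  rewrite /set_zeta -ofcrdE; congr (ofcrd c0 _); rewrite /qcoord -lcrdE -/c0.
  apply: pcoord_eq; [exact: (esym (co_t_setz (lcrd c0 rho) r))
    |exact: (esym (co_x_setz (lcrd c0 rho) r))
    |exact: (esym (co_tau_setz (lcrd c0 rho) r))
    |apply: (etrans _ (esym (co_xi_setz (lcrd c0 rho) r)))].
  rewrite co_xiE; apply/rowP => j; rewrite [LHS]mxE [RHS]mxE [X in _ + X]mxE.
  rewrite [delta_mx _ _ _ _]mxE eqxx /=; case: eqVneq => [->|_].
    by rewrite mulr1 /zlast addrC subrK.
  by rewrite mulr0 addr0.
have xE : ph_x (set_zeta rho r) = ph_x rho.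
  by rewrite sE ph_x_ofcrd co_x_setz co_x_lcrd phiK.
have tE : ph_t (set_zeta rho r) = ph_t rho by rewrite sE ph_t_ofcrd co_t_setz co_t_lcrd.
split; [exact: xE|exact: tE|].
have cs : pcod c0 (setz (lcrd c0 rho) r).
  by rewrite /pcod /= co_x_setz co_x_lcrd; exact: psi_phi_dom.
have c0r := pcod_lcrd d0.
rewrite sE (lcrd_lift ac0 ac cs); last by rewrite co_x_setz co_x_lcrd phiK.
rewrite setz_clift //; last 2 first.
- by rewrite co_x_lcrd phiK.
- by rewrite co_x_lcrd phiK.
by rewrite lcrd_clift.
Qed.

(** At the boundary the inverse metric has no cross term between xi' and zeta, and its last diagonal
    entry is 1. *)
Lemma psy_setz c q r : qn c -> pcod c q -> bM (psi c (co_x q)) ->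
  psy c (setz q r) = psy c (setz q 0) + r ^+ 2.
Proof.
move=> qc cq bx; have [dx uE] := psiK cq.
have He := ginv_qn qc dx bx; rewrite uE in He.
have gq : good c q by split => //; exact: bM_mdom.
have gs := ginv_sym (qn_atlas qc) gq.
rewrite -(setz_setz q 0 r); set q0 := setz q 0.
have z0 : zlast (co_xi q0) = 0 by rewrite zlast_setz.
have xE : co_x q0 = co_x q by rewrite co_x_setz.
clearbody q0.
rewrite !psy_def co_tau_setz co_x_setz co_xi_setz xE z0 subr0.
set g := ginv c (co_x q) in He gs *; set e := delta_mx 0 ord_max.
have eT : e^T = delta_mx ord_max 0 by rewrite trmx_delta.
rewrite [(_ + _)^T]raddfD /= [(_ *: _)^T]linearZ /= eT.
have ge (u : 'rV[R]_n.+1) : u *m g *m (delta_mx ord_max 0 : 'cV[R]_n.+1) = u *m delta_mx ord_max 0 by rewrite -mulmxA He.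
have ee (M M' : 'M[R]_1) : (M + M') 0 0 = M 0 0 + M' 0 0 by rewrite mxE.
have es (M : 'M[R]_1) (s : R) : (s *: M) 0 0 = s * M 0 0 by rewrite mxE.
have sw : (e *m g *m (co_xi q0)^T) 0 0 = 0.
  rewrite -[LHS](_ : ((e *m g *m (co_xi q0)^T)^T) 0 0 = _); last by rewrite mxE.
  by rewrite !trmx_mul trmxK gs eT mulmxA ge -zlast_mul.
have z1 : zlast e = 1 by rewrite /zlast mxE !eqxx.
rewrite !mulmxDl !mulmxDr -!scalemxAl -!scalemxAr !ge.
by rewrite !(ee, es) sw -!zlast_mul z0 z1; ring.
Qed.

Lemma lcrd_inj c rho rho' : atlas c -> dom c (ph_x rho) -> dom c (ph_x rho') ->
  lcrd c rho = lcrd c rho' -> rho = rho'.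
Proof. by move=> ac dx dx' e; rewrite -(ofcrd_lcrd ac dx) e ofcrd_lcrd. Qed.

Lemma bTL_set_zeta rho r : bTL rho -> bTL (set_zeta rho r).
Proof.
move=> bx; have [q0 d0] := qn_chartP bx.
have [E _ _] := set_zeta_qn r q0 d0 bx.
by change (bM (ph_x (set_zeta rho r))); rewrite E.
Qed.

Lemma zeta_set_zeta rho r : bTL rho -> zeta (set_zeta rho r) = r.
Proof.
move=> bx; have [q0 d0] := qn_chartP bx; have [xE _ lE] := set_zeta_qn r q0 d0 bx.
rewrite (@zeta_qn (qn_chart (ph_x rho))) ?xE // ?lE ?zlast_setz //.
exact: bTL_set_zeta.
Qed.

Lemma set_zeta_set_zeta rho r r' : bTL rho -> set_zeta (set_zeta rho r) r' = set_zeta rho r'.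
Proof.
move=> bx; have [q0 d0] := qn_chartP bx; have [xE _ lE] := set_zeta_qn r q0 d0 bx.
have [xE' _ lE'] := set_zeta_qn r' q0 d0 bx.
have bx' := bTL_set_zeta r bx.
have D s : ph_x s = ph_x rho -> dom (qn_chart (ph_x rho)) (ph_x s) by move=> ->.
have [xE2 _ lE2] := set_zeta_qn r' q0 (D _ xE) bx'.
apply: (lcrd_inj (qn_atlas q0) (D _ (etrans xE2 xE)) (D _ xE')).
exact: (etrans lE2 (etrans (congr1 (setz^~ r') lE) (etrans (setz_setz _ _ _) (esym lE')))).
Qed.

Lemma set_zeta_id rho r : bTL rho -> zeta rho = r -> set_zeta rho r = rho.
Proof.
move=> bx zr; have [q0 d0] := qn_chartP bx; have [xE _ lE] := set_zeta_qn r q0 d0 bx.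
have d1 : dom (qn_chart (ph_x rho)) (ph_x (set_zeta rho r)) by rewrite xE.
apply: (lcrd_inj (qn_atlas q0) d1 d0); apply: (etrans lE); apply: setz_id.
by rewrite -zr (zeta_qn q0 d0 bx).
Qed.

Lemma p_set_zeta rho r : bTL rho -> p (set_zeta rho r) = p rho - zeta rho ^+ 2 + r ^+ 2.
Proof.
move=> bx; have [q0 d0] := qn_chartP bx; have [xE _ lE] := set_zeta_qn r q0 d0 bx.
have ac0 := qn_atlas q0; have mx := bM_mdom bx.
have cq := pcod_lcrd d0.
have bq : bM (psi (qn_chart (ph_x rho)) (co_x (lcrd (qn_chart (ph_x rho)) rho))).
  by rewrite co_x_lcrd phiK.
rewrite (p_chart ac0) ?xE // lE (p_chart ac0 d0 mx) psy_setz //.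
have := psy_setz (zeta rho) q0 cq bq.
by rewrite setz_id; [move=> ->; ring|rewrite (zeta_qn q0 d0 bx)].
Qed.

(** In quasi-normal coordinates the unit inward normal is the last basis vector, so pairing with it
    extracts zeta. *)
Lemma normal_gapE rho : bTL rho -> p rho < 0 -> normal_gap rho = 2 * Num.sqrt (- p rho).
Proof.
move=> bx pr; have [q0 d0] := qn_chartP bx.
set c0 := qn_chart (ph_x rho) in q0 d0.
have [xp _ lp] := set_zeta_qn (Num.sqrt (- p rho)) q0 d0 bx.
have [xm _ lm] := set_zeta_qn (- Num.sqrt (- p rho)) q0 d0 bx.
have gn : normal (ph_x rho) = delta_mx 0 ord_max.
  rewrite /normal -/c0 -[invmx _](_ : ginv c0 (phi c0 (ph_x rho)) = _); last first.
    by rewrite ginvE phiK.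
  have He := ginv_qn q0 d0 bx.
  have gq : good c0 (lcrd c0 rho) by apply: good_lcrd => //; exact: bM_mdom.
  have := ginv_sym (qn_atlas q0) gq; rewrite co_x_lcrd => gs.
  have rE : row ord_max (ginv c0 (phi c0 (ph_x rho))) = delta_mx 0 ord_max.
    rewrite rowE; apply: trmx_inj; rewrite trmx_mul gs trmx_delta; exact: He.
  have dE : ginv c0 (phi c0 (ph_x rho)) ord_max ord_max = 1.
    by have := congr1 (fun M : 'rV[R]_n.+1 => M 0 ord_max) rE; rewrite !mxE !eqxx.
  by rewrite rE dE sqrtr1 invr1 scale1r.
rewrite /normal_gap gn trmx_delta /qcoord -!lcrdE /rho_plus /rho_minus xp xm -/c0.
rewrite lp lm.
have zB (u v : 'rV[R]_n.+1) : ((u - v) *m delta_mx ord_max 0 : 'M[R]_1) 0 0 = zlast u - zlast v.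
  by rewrite mulmxBl !zlast_mul !mxE.
apply: (etrans (zB _ _)); apply: (etrans (congr2 (fun x y : R => x - y) (zlast_setz _ _) (zlast_setz _ _))).
ring.
Qed.

Lemma jump_quotE a c rho : qn c -> dom c (ph_x rho) -> bTL rho -> p rho < 0 ->
  jump_quot a rho = (a (ofcrd c (setz (lcrd c rho) (Num.sqrt (- p rho)))) -
    a (ofcrd c (setz (lcrd c rho) (- Num.sqrt (- p rho))))) / (2 * Num.sqrt (- p rho)).
Proof.
move=> qc dx bx pr; rewrite /jump_quot normal_gapE //.
have [xp _ lp] := set_zeta_qn (Num.sqrt (- p rho)) qc dx bx.
have [xm _ lm] := set_zeta_qn (- Num.sqrt (- p rho)) qc dx bx.
by rewrite -lp -lm !ofcrd_lcrd ?xp ?xm //; exact: qn_atlas.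
Qed.

Lemma setz_line q r : setz q r = setz q 0 + r *: e_zeta.
Proof. by rewrite /setz -addrA -scalerDl; congr (_ + _ *: _); ring. Qed.

(** The mean value theorem on the fibre segment from [rho_minus rho] to [rho_plus rho]. The
    denominator of the quotient degenerates near [Gpar]; this form is controlled uniformly there. *)
Lemma jump_quot_mvt a c rho : C1ph a -> qn c -> dom c (ph_x rho) -> bTL rho -> p rho < 0 ->
  exists2 th, `|th| <= Num.sqrt (- p rho) &
    jump_quot a rho = 'd (a \o ofcrd c) (setz (lcrd c rho) th) e_zeta.
Proof.
move=> ca qc dx bx pr; rewrite (jump_quotE a qc dx bx pr).
set r := Num.sqrt _; have r0 : 0 < r by rewrite sqrtr_gt0 oppr_gt0.
have ac := qn_atlas qc.
pose f (s : R) := (a \o ofcrd c) (setz (lcrd c rho) 0 + s *: e_zeta).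
have df (s : R) : is_derive s (1 : R) f ('d (a \o ofcrd c) (setz (lcrd c rho) 0 + s *: e_zeta) e_zeta).
  apply: is_derive_line; apply: C1pt_diff; apply: (C1ph_pt ca ac).
  rewrite -setz_line /pcod /= co_x_setz co_x_lcrd; exact: psi_phi_dom.
have rr : - r < r by lra.
have [|th thr E] := @MVT _ f (fun s => 'd (a \o ofcrd c) (setz (lcrd c rho) 0 + s *: e_zeta) e_zeta)
  (- r) r rr (fun s _ => df s).
  by apply: derivable_within_continuous => s _; exact: (ex_derive (is_derive := df s)).
exists th.
  by move: thr; rewrite in_itv /= ler_norml => /andP[/ltW -> /ltW ->].
move: E; rewrite /f /= -!setz_line => ->.
rewrite opprK mulrC; field; lra.
Qed.

Lemma near_preimage (T U : topologicalType) (f : T -> U) (x : T) (A : set U) :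
  {for x, continuous f} -> nbhs (f x) A -> \forall y \near x, A (f y).
Proof. by move=> cf nA; exact: (cf _ nA). Qed.

(** The square root vanishes at the glancing point [rho0], so every intermediate [th] is small
    nearby. Uniformity in [th] covers neighbours in [Hpar], and those in [Gpar] through [th = 0]. *)
Lemma jump_near a c rho0 e : C1ph a -> qn c -> dom c (ph_x rho0) -> Gpar rho0 -> 0 < e ->
  \forall rho \near rho0, forall th, bparTL rho -> `|th| <= Num.sqrt (- p rho) ->
    `|'d (a \o ofcrd c) (setz (lcrd c rho) th) e_zeta -
      'd (a \o ofcrd c) (lcrd c rho0) e_zeta| <= e.
Proof.
move=> ca qc dx [[bx _] p0] e0; have ac := qn_atlas qc.
have [_ /(_ e_zeta)/cvgrPdist_le /(_ e e0)] := C1ph_pt ca ac (pcod_lcrd dx).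
move=> /nbhs_ballP[d /= d0 Hd].
have K0 : 0 < `|e_zeta : P| + 1 by have := normr_ge0 (e_zeta : P); lra.
have h1 : \forall r \near rho0, dom c (ph_x r) by apply: ph_x_continuous; exact: near_dom.
have d2 : 0 < d / 2 by rewrite divr_gt0.
have h2 : \forall r \near rho0, ball (lcrd c rho0) (d / 2) (lcrd c r).
  have L := lcrd_continuous ac dx.
  have nb : nbhs (lcrd c rho0) (ball (lcrd c rho0) (d / 2)) by exact: nbhsx_ballx.
  exact: (near_preimage L nb).
have h3 : \forall r \near rho0, Num.sqrt (- p r) < d / 2 / (`|e_zeta : P| + 1).
  have cp := p_continuous (bM_mdom bx).
  have cs : {for rho0, continuous (fun r => Num.sqrt (- p r))}.
    apply: (@continuous_comp _ _ _ (fun r => - p r) (@Num.sqrt R)).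
      exact: (cvgN cp).
    exact: sqrt_continuous.
  have nb : nbhs (Num.sqrt (- p rho0)) [set s : R | s < d / 2 / (`|e_zeta : P| + 1)].
    apply: open_nbhs_nbhs; split; first exact: open_lt.
    by rewrite /= (p0 : p rho0 = 0) oppr0 sqrtr0 divr_gt0.
  exact: (near_preimage cs nb).
have H : \forall r \near rho0, [/\ dom c (ph_x r), ball (lcrd c rho0) (d / 2) (lcrd c r) &
    Num.sqrt (- p r) < d / 2 / (`|e_zeta : P| + 1)].
  by near=> r; split; near: r.
apply: filterS H => r [dr lr pr] th [br zr] thr; rewrite -ball_normE /= in lr.
rewrite distrC; apply: Hd; rewrite -ball_normE /=.
have -> : setz (lcrd c r) th = lcrd c r + th *: e_zeta.
  by rewrite /setz -(zeta_qn qc dr br) (zr : zeta r = 0) subr0.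
rewrite opprD addrA; apply: le_lt_trans (ler_normB _ _) _.
rewrite normrZ.
have : `|th| * `|e_zeta : P| <= d / 2.
  apply: (@le_trans _ _ (d / 2 / (`|e_zeta : P| + 1) * (`|e_zeta : P| + 1))); last first.
    by rewrite divfK // gt_eqF.
  by apply: ler_pM => //; lra.
lra.
Unshelve. all: by end_near. Qed.

End QuasiNormal.

(** * The jump: limits, continuity, support *)

Section Jump.
Context {R : realType} {n : nat} {G : geometry R n}.
Local Notation P := (pcoord R n).
Local Notation bM := (boundary (@Mset R n G)).
Local Notation qn := (quasi_normal (@Mset R n G) (@metric R n G)).
Local Notation HG := (@Hpar R n G `|` @Gpar R n G).
Implicit Types (c : chart R n G) (q : P) (rho : phase G) (x : G).

Lemma nbhs_near_t (A : set (phase G)) c rho : atlas c -> dom c (ph_x rho) -> nbhs rho A ->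
  \forall s \near (0 : R), A (ofcrd c (lcrd c rho + s *: (e_tau : P))) /\
    pcod c (lcrd c rho + s *: (e_tau : P)).
Proof.
move=> ac dx nA; have cq := pcod_lcrd dx.
have c0 : {for (0 : R), continuous (fun s : R => lcrd c rho + s *: (e_tau : P))}.
  by apply: cvgD; [exact: cvg_cst|exact: scalel_continuous].
have e0 : lcrd c rho + 0 *: (e_tau : P) = lcrd c rho by rewrite scale0r addr0.
have h1 : nbhs (lcrd c rho + 0 *: (e_tau : P)) (fun q => A (ofcrd c q) /\ pcod c q).
  rewrite e0; apply: filterI; last exact: pcod_near.
  have K := ofcrd_continuous ac cq.
  have nA' : nbhs (ofcrd c (lcrd c rho)) A by rewrite (ofcrd_lcrd ac dx).
  exact: (near_preimage K nA').
exact: (near_preimage c0 h1).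
Qed.

Lemma p_shift c rho (s : R) : atlas c -> dom c (ph_x rho) -> mdom (ph_x rho) ->
  let r := ofcrd c (lcrd c rho + s *: (e_tau : P)) in
  [/\ ph_x r = ph_x rho, co_xi (lcrd c r) = co_xi (lcrd c rho) &
    p r = p rho + co_tau (lcrd c rho) ^+ 2 - (co_tau (lcrd c rho) + s) ^+ 2].
Proof.
move=> ac dx mx; set q := lcrd c rho; set q' := q + s *: (e_tau : P); move=> r.
have xE : co_x q' = co_x q by rewrite /q' linearD linearZ /= scaler0 addr0.
have xiE : co_xi q' = co_xi q by rewrite /q' linearD linearZ /= scaler0 addr0.
have tE : co_tau q' = co_tau q + s by rewrite /q' linearD linearZ /= [_ *: _]mulr1.
have cq' : pcod c q' by rewrite /pcod /= xE; exact: pcod_lcrd.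
have rx : ph_x r = ph_x rho by rewrite /r ph_x_ofcrd xE co_x_lcrd phiK.
have lr : lcrd c r = q' by exact: lcrd_ofcrd.
split; [exact: rx|by rewrite lr|].
rewrite (p_chart ac) ?rx // (p_chart ac dx mx) lr -/q !psy_def xE xiE tE; ring.
Qed.

(** Pushing tau away from 0, with x and xi fixed, makes p negative. Hence the filter in the
    definition of [jump] on [Gpar] is proper, and its [lim] is a genuine limit. *)
Lemma Hpar_near_Gpar rho0 (A : set (phase G)) : Gpar rho0 -> nbhs rho0 A ->
  exists2 rho, A rho & Hpar rho.
Proof.
move=> [[bx z0] p0] nA; have [q0 d0] := qn_chartP bx.
set c := qn_chart (ph_x rho0) in q0 d0; have ac := qn_atlas q0.
have mx := bM_mdom bx.
have [d dp Hd] := near_ball (nbhs_near_t ac d0 nA).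
(* A sign of tau, equal to 1 when tau is 0, so that adding [s] increases the absolute value of tau
   in all cases. *)
pose sg : R := if 0 <= co_tau (lcrd c rho0) then 1 else -1.
have sgE : sg ^+ 2 = 1 by rewrite /sg; case: ifP => _; rewrite ?expr1n ?sqrrN ?expr1n.
have sgt : 0 <= sg * co_tau (lcrd c rho0).
  rewrite /sg; case: ifP => [|/negbT]; first by rewrite mul1r.
  by rewrite -ltNge mulN1r oppr_ge0 => /ltW.
pose s := sg * (d / 2).
have d2 : 0 < d / 2 by rewrite divr_gt0.
have sd : `|0 - s| < d.
  have -> : `|0 - s| = d / 2; last by lra.
  rewrite sub0r normrN normrM (gtr0_norm d2) (_ : `|sg| = 1) ?mul1r //.
  by rewrite /sg; case: ifP => _; rewrite ?normrN normr1.
have [Ar cr] := Hd s sd.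
have [xE xiE pE] := p_shift s ac d0 mx.
set r := ofcrd c _ in Ar xE xiE pE.
have br : bTL r by change (bM (ph_x r)); rewrite xE.
have zr : zeta r = 0.
  have dr : dom c (ph_x r) by rewrite xE.
  rewrite (zeta_qn q0 dr br) xiE -(zeta_qn q0 d0 bx); exact: z0.
suff pr : p r < 0 by exact: (ex_intro2 _ _ r Ar (conj (conj br zr) pr)).
rewrite pE (p0 : p rho0 = 0).
have -> : 0 + co_tau (lcrd c rho0) ^+ 2 - (co_tau (lcrd c rho0) + s) ^+ 2 =
   - (d * (sg * co_tau (lcrd c rho0))) - (sg ^+ 2) * (d / 2) ^+ 2.
  by rewrite /s; field.
rewrite sgE mul1r.
have h1 : 0 < (d / 2) ^+ 2 by exact: exprn_gt0.
rewrite -opprD oppr_lt0; exact: (ltr_wpDl (mulr_ge0 (ltW dp) sgt) h1).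
Qed.

Lemma jump_Gpar a c rho : C1ph a -> qn c -> dom c (ph_x rho) -> Gpar rho ->
  jump a rho = 'd (a \o ofcrd c) (lcrd c rho) e_zeta.
Proof.
move=> ca qc dx gr; have [[bx z0] p0] := gr.
rewrite /jump; case: pselect => h.
  by exfalso; case: h => _; rewrite /= (p0 : p rho = 0) ltxx.
have pf : ProperFilter (within (@Hpar R n G) (nbhs rho)).
  apply: within_nbhs_proper => A nA.
  by have [r Ar hr] := Hpar_near_Gpar gr nA; exact: (ex_intro _ r (conj hr Ar)).
apply: cvg_lim => //; apply/cvgrPdist_le => e e0.
have H1 := jump_near ca qc dx gr e0.
have H2 : \forall r \near rho, dom c (ph_x r) by apply: ph_x_continuous; exact: near_dom.
near=> r.
have hr : Hpar r by near: r; exact: withinT.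
have dr : dom c (ph_x r) by near: r; apply: cvg_within; exact: H2.
have [br pr] := hr; have [th thr ->] := jump_quot_mvt ca qc dr br.1 pr.
rewrite distrC; have : bparTL r -> `|th| <= Num.sqrt (- p r) ->
    `|'d (a \o ofcrd c) (setz (lcrd c r) th) e_zeta -
      'd (a \o ofcrd c) (lcrd c rho) e_zeta| <= e.
  by move: th {thr}; near: r; apply: cvg_within; exact: H1.
by move=> H; exact: (H br thr).
Unshelve. all: by end_near. Qed.

Lemma jump_Hpar a rho : Hpar rho -> jump a rho = jump_quot a rho.
Proof. by move=> h; rewrite /jump; case: pselect. Qed.

Lemma cvg_for (T : Type) (U V : topologicalType) (F : set_system T) (f : T -> U) (g : U -> V) (x : U) :
  f @ F --> x -> {for x, continuous g} -> g (f t) @[t --> F] --> g x.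
Proof. by move=> fx gx; exact: (fun A nA => fx _ (gx A nA)). Qed.

Lemma setz_cvg (T : topologicalType) (F : set_system T) {FF : Filter F} (f : T -> P) (g : T -> R) q r :
  f x @[x --> F] --> q -> g x @[x --> F] --> r ->
  setz (f x) (g x) @[x --> F] --> setz q r.
Proof.
move=> fq gr; apply: cvgD => //; apply: cvgZr_tmp; apply: cvgB => //.
have cz : {for q, continuous (fun q : P => zlast (co_xi q))}.
  by apply: (@continuous_comp _ _ _ (@co_xi R n) (@zlast R n)); [exact: co_xi_continuous|exact: zlast_continuous].
exact: (cvg_for fq cz).
Qed.

(** The quotient is computed in a chart that varies with [rho]. In the chart of [rho0] it is given
    at nearby boundary points by one expression [g], continuous as long as p stays negative. *)
Lemma jump_quot_continuous a rho0 : C1ph a -> Hpar rho0 ->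
  exists2 g : phase G -> R, {for rho0, continuous g} &
    \forall rho \near rho0, bTL rho -> p rho < 0 /\ jump_quot a rho = g rho.
Proof.
move=> ca [[bx z0] p0]; have [qc dx] := qn_chartP bx.
set c := qn_chart _ in qc dx; have ac := qn_atlas qc.
pose rt := fun r : phase G => Num.sqrt (- p r).
exists (fun r => (a (ofcrd c (setz (lcrd c r) (rt r))) -
    a (ofcrd c (setz (lcrd c r) (- rt r)))) / (2 * rt r)); last first.
  have H2 : \forall r \near rho0, dom c (ph_x r) by apply: ph_x_continuous; exact: near_dom.
  have cp := p_continuous (bM_mdom bx).
  have np : nbhs (p rho0) [set s : R | s < 0] by apply: open_nbhs_nbhs; split; [exact: open_lt|].
  have H1 := near_preimage cp np.
  near=> r => br; have pr : p r < 0 by near: r.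
  by split=> //; apply: jump_quotE => //; near: r.
have cp := p_continuous (bM_mdom bx).
have crt : rt r @[r --> rho0] --> rt rho0.
  have cs := @sqrt_continuous R (- p rho0).
  exact: (cvg_for (cvgN cp) cs).
have aux (h : phase G -> R) : h r @[r --> rho0] --> h rho0 ->
    a (ofcrd c (setz (lcrd c r) (h r))) @[r --> rho0] --> a (ofcrd c (setz (lcrd c rho0) (h rho0))).
  move=> ch; have cl := lcrd_continuous ac dx.
  have s := setz_cvg cl ch.
  have cq : pcod c (setz (lcrd c rho0) (h rho0)).
    by rewrite /pcod /= co_x_setz; exact: pcod_lcrd.
  have := differentiable_continuous (C1pt_diff (C1ph_pt ca ac cq)).
  exact: (cvg_for (s _)).
have c1 := cvgB (aux rt crt) (aux (fun r => - rt r) (cvgN crt)).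
have nz : 2 * rt rho0 != 0 by rewrite gt_eqF // mulr_gt0 // sqrtr_gt0 oppr_gt0.
have c2 : 2 * rt r @[r --> rho0] --> 2 * rt rho0 by exact: (@cvgM _ _ _ _ (fun=> 2) rt _ _ (cvg_cst _) crt).
have FF := @nbhs_filter (phase G) rho0.
exact: (cvgM (c1 FF FF) (cvgV nz c2)).
Unshelve. all: by end_near. Qed.

Lemma Hpar_lt0 rho : HG rho -> p rho < 0 -> Hpar rho.
Proof. by case=> // -[_ pz] pr; exfalso; move: pr; rewrite (pz : p rho = 0) ltxx. Qed.

(** Near [Hpar] only points of [Hpar] occur. Near [Gpar] both kinds do, and [jump_near] treats them
    alike. *)
Lemma jump_continuous a rho0 e : C1ph a -> HG rho0 -> 0 < e ->
  \forall rho \near rho0, HG rho -> `|jump a rho - jump a rho0| <= e.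
Proof.
move=> ca [h0|g0] e0.
  have [g cg gE] := jump_quot_continuous ca h0.
  have H := near_preimage cg (nbhsx_ballx (g rho0) e e0).
  have E0 : jump_quot a rho0 = g rho0 by have := nbhs_singleton gE; case=> //; case: h0 => [[]].
  near=> r => hr.
  have br : bTL r by case: hr => -[[]].
  have : bTL r -> p r < 0 /\ jump_quot a r = g r by near: r.
  move=> /(_ br)[pr rE].
  have hp : Hpar r by exact: (Hpar_lt0 hr pr).
  rewrite !jump_Hpar // rE E0 distrC; apply/ltW.
  by have : ball (g rho0) e (g r) by near: r; exact: H.
have [[bx z0] p0] := g0; have [qc dx] := qn_chartP bx.
set c := qn_chart _ in qc dx; have ac := qn_atlas qc.
have H1 := jump_near ca qc dx g0 e0.
have H2 : \forall r \near rho0, dom c (ph_x r) by apply: ph_x_continuous; exact: near_dom.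
near=> r => hr.
have dr : dom c (ph_x r) by near: r.
have J th : bparTL r -> `|th| <= Num.sqrt (- p r) ->
    `|'d (a \o ofcrd c) (setz (lcrd c r) th) e_zeta -
      'd (a \o ofcrd c) (lcrd c rho0) e_zeta| <= e.
  by move: th; near: r.
rewrite (jump_Gpar ca qc dx g0).
case: hr => [hr|gr].
  have [br pr] := hr; have [th thr E] := jump_quot_mvt ca qc dr br.1 pr.
  by rewrite (jump_Hpar a hr) E; exact: J.
have [br pr] := gr; rewrite (jump_Gpar ca qc dr gr).
have -> : lcrd c r = setz (lcrd c r) 0.
  by rewrite setz_id // -(zeta_qn qc dr br.1); exact: br.2.
by apply: J => //; rewrite normr0 sqrtr_ge0.
Unshelve. all: by end_near. Qed.

(** The zeta-derivative at an arbitrary boundary point. Unlike [jump] it is local, so it inherits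
    the compact support of [a] directly. *)
Definition dzeta (a : phase G -> R) rho : R := 'D_1 (fun r : R => a (set_zeta rho r)) (zeta rho).

Lemma dzeta_chart a c rho : C1ph a -> qn c -> dom c (ph_x rho) -> bTL rho ->
  dzeta a rho = 'd (a \o ofcrd c) (lcrd c rho) e_zeta.
Proof.
move=> ca qc dx bx; have ac := qn_atlas qc.
have E (r : R) : a (set_zeta rho r) = (a \o ofcrd c) (setz (lcrd c rho) 0 + r *: e_zeta).
  have [xp _ lp] := set_zeta_qn r qc dx bx.
  have dp : dom c (ph_x (set_zeta rho r)) by rewrite xp.
  rewrite -setz_line -lp /=; congr a; exact: (esym (ofcrd_lcrd ac dp)).
rewrite /dzeta (_ : (fun r => a (set_zeta rho r)) =
  (fun r : R => (a \o ofcrd c) (setz (lcrd c rho) 0 + r *: e_zeta))); last by apply/funext.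
have lE : setz (lcrd c rho) 0 + zeta rho *: e_zeta = lcrd c rho.
  by rewrite -setz_line setz_id // (zeta_qn qc dx bx).
have df : is_derive (zeta rho) (1 : R)
    (fun r : R => (a \o ofcrd c) (setz (lcrd c rho) 0 + r *: e_zeta))
    ('d (a \o ofcrd c) (setz (lcrd c rho) 0 + zeta rho *: e_zeta) e_zeta).
  apply: is_derive_line; rewrite lE; apply: C1pt_diff; apply: (C1ph_pt ca ac).
  exact: pcod_lcrd.
apply: (etrans (@derive_val _ _ _ _ _ _ _ df)).
exact: (congr1 (fun q => 'd (a \o ofcrd c) q e_zeta) lE).
Qed.

Lemma dzeta_near a rho0 e : C1ph a -> bTL rho0 -> 0 < e ->
  \forall rho \near rho0, bTL rho -> `|dzeta a rho - dzeta a rho0| <= e.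
Proof.
move=> ca bx e0; have [qc dx] := qn_chartP bx.
set c := qn_chart _ in qc dx; have ac := qn_atlas qc.
have [_ /(_ e_zeta) ce] := C1ph_pt ca ac (pcod_lcrd dx).
have H2 : \forall r \near rho0, dom c (ph_x r) by apply: ph_x_continuous; exact: near_dom.
have L := lcrd_continuous ac dx.
have H3 := near_preimage (cvg_for L ce) (nbhsx_ballx _ e e0).
near=> r => br.
rewrite (dzeta_chart ca qc dx bx) (dzeta_chart (c := c) (rho := r) ca qc _ br).
  rewrite distrC; apply/ltW.
  suff : ball ('d (a \o ofcrd c) (lcrd c rho0) e_zeta) e ('d (a \o ofcrd c) (lcrd c r) e_zeta) by [].
  by near: r.
by near: r.
Unshelve. all: by end_near. Qed.

Lemma near_eq_lcrd (a : phase G -> R) c rho : atlas c -> dom c (ph_x rho) ->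
  (\forall r \near rho, a r = 0) -> \forall q \near lcrd c rho, (a \o ofcrd c) q = cst 0 q.
Proof.
move=> ac dx h; have K := ofcrd_continuous ac (pcod_lcrd dx).
have h' : nbhs (ofcrd c (lcrd c rho)) (fun r => a r = 0) by rewrite (ofcrd_lcrd ac dx).
exact: (near_preimage K h').
Qed.

Lemma near_eq0_diff (a : phase G -> R) c rho v : atlas c -> dom c (ph_x rho) ->
  (\forall r \near rho, a r = 0) -> 'd (a \o ofcrd c) (lcrd c rho) v = 0.
Proof.
move=> ac dx h; have H := near_eq_lcrd ac dx h.
have H' : \forall q \near lcrd c rho, cst 0 q = (a \o ofcrd c) q by apply: filterS H => q ->.
have D := near_eq_is_diff H' (differentiable_cst (0 : R) (lcrd c rho)).
by rewrite (diff_val (f := a \o ofcrd c)) diff_cst.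
Qed.

Lemma supp_near0 (a : phase G -> R) rho : ~ closure [set r | a r != 0] rho ->
  \forall r \near rho, a r = 0.
Proof.
move=> nc; have := open_nbhs_nbhs (conj (closed_openC (@closed_closure _ [set r | a r != 0])) nc).
apply: filterS => r nr; apply/eqP; apply: contrapT => /negP ar; apply: nr.
exact: subset_closure.
Qed.

Lemma dzeta_supp a rho : C1ph a -> bTL rho -> dzeta a rho != 0 ->
  closure [set r | a r != 0] rho.
Proof.
move=> ca bx; have [qc dx] := qn_chartP bx; have ac := qn_atlas qc.
move=> /eqP dn; apply: contrapT => nc; apply: dn.
rewrite (dzeta_chart ca qc dx bx); exact: near_eq0_diff (supp_near0 nc).
Qed.

Lemma Hp_supp a rho : C1ph a -> mdom (ph_x rho) -> Hp a rho != 0 ->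
  closure [set r | a r != 0] rho.
Proof.
move=> ca mx; have ac := pref_chart_atlas (ph_x rho); have dx := pref_chart_dom (ph_x rho).
move=> /eqP dn; apply: contrapT => nc; apply: dn.
rewrite (Hp_chart ca ac dx mx); exact: near_eq0_diff (supp_near0 nc).
Qed.

(** The jump at [rho] involves values of [a] elsewhere in the fibre. Being one value of [dzeta] in
    that fibre, it inherits bounds from it. *)
Lemma jump_dzeta a rho : C1ph a -> HG rho ->
  exists2 th, jump a rho = dzeta a (set_zeta rho th) & bTL rho.
Proof.
move=> ca [hr|gr].
  have [[bx zr] pr] := hr; have [qc dx] := qn_chartP bx.
  have [th thr E] := jump_quot_mvt ca qc dx bx pr.
  have [xp _ lp] := set_zeta_qn th qc dx bx.
  exists th => //; rewrite (jump_Hpar a hr) E -lp.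
  have dp : dom (qn_chart (ph_x rho)) (ph_x (set_zeta rho th)) by rewrite xp.
  exact: (esym (dzeta_chart ca qc dp (bTL_set_zeta th bx))).
have [[bx zr] pr] := gr; have [qc dx] := qn_chartP bx.
exists 0 => //; rewrite (jump_Gpar ca qc dx gr) (set_zeta_id bx zr).
exact: (esym (dzeta_chart ca qc dx bx)).
Qed.

Lemma closed_bTL : closed (@bTL R n G).
Proof.
have cM : closed (@Mset R n G) by apply: compact_closed; [exact: mhausdorff|exact: M_compact].
have cb : closed (boundary (@Mset R n G)).
  by apply: closedI => //; apply: open_closedC; exact: open_interior.
have -> : @bTL R n G = @ph_x R n G @^-1` boundary (@Mset R n G) by [].
by apply: closed_comp => // x _; exact: ph_x_continuous.
Qed.

Lemma closed_TLhat : closed (@TLhat R n G).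
Proof.
have cM : closed (@Mhat R n G) by apply: compact_closed; [exact: mhausdorff|exact: Mhat_compact].
have -> : @TLhat R n G = @ph_x R n G @^-1` (@Mhat R n G) by [].
by apply: closed_comp => // x _; exact: ph_x_continuous.
Qed.

Lemma closed_near (T : topologicalType) (A B : set T) : closed A ->
  (forall x : T, A x -> ~ B x -> \forall y \near x, A y -> ~ B y) -> B `<=` A -> closed B.
Proof.
move=> cA h BA x clx.
have Ax : A x by apply: cA; exact: closure_subset clx.
apply: contrapT => nB; have [y [By]] := clx _ (h x Ax nB).
by move=> /(_ (BA _ By)); exact.
Qed.

Lemma zeta_near0 rho0 : bTL rho0 -> zeta rho0 != 0 ->
  \forall rho \near rho0, bTL rho -> zeta rho != 0.
Proof.
move=> bx z0; have [qc dx] := qn_chartP bx; have ac := qn_atlas qc.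
set c := qn_chart _ in qc dx ac.
have H2 : \forall r \near rho0, dom c (ph_x r) by apply: ph_x_continuous; exact: near_dom.
have cz : {for lcrd c rho0, continuous (fun q : P => zlast (co_xi q))}.
  by apply: (@continuous_comp _ _ _ (@co_xi R n) (@zlast R n)); [exact: co_xi_continuous|exact: zlast_continuous].
have L := cvg_for (lcrd_continuous ac dx) cz.
have nz : zlast (co_xi (lcrd c rho0)) != 0 by rewrite -(zeta_qn qc dx bx).
have nb : nbhs (zlast (co_xi (lcrd c rho0))) [set x : R | x != 0].
  by apply: open_nbhs_nbhs; split=> //; exact: open_neq.
have H1 := near_preimage L nb.
near=> r => br; have dr : dom c (ph_x r) by near: r.
rewrite (zeta_qn qc dr br); near: r; exact: H1.
Unshelve. all: by end_near. Qed.

Lemma closed_bparTL : closed (@bparTL R n G).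
Proof.
apply: (closed_near closed_bTL); last by move=> x [].
move=> x bx nb; have zx : zeta x != 0 by apply/eqP => zx; apply: nb.
have := zeta_near0 bx zx; apply: filterS => y h /h/eqP zy [_ z0].
exact: zy.
Qed.

Lemma HG_p_le0 rho : HG rho <-> bparTL rho /\ p rho <= 0.
Proof.
split; first by case=> -[br]; [move=> /ltW|move=> /= pz]; split=> //; rewrite (pz : p rho = 0).
by case=> br; rewrite le_eqVlt => /orP[/eqP|]; [right|left].
Qed.

Lemma closed_HG : closed HG.
Proof.
apply: (closed_near closed_bparTL); last by move=> x /HG_p_le0[].
move=> x bx nb; have px : 0 < p x by rewrite ltNge; apply/negP => px; apply: nb; apply/HG_p_le0.
have np : nbhs (p x) [set s : R | 0 < s] by apply: open_nbhs_nbhs; split; [exact: open_gt|].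
have := near_preimage (p_continuous (bM_mdom bx.1)) np.
by apply: filterS => y py _ /HG_p_le0[_]; rewrite leNgt py.
Qed.

End Jump.

(** * Measurability of relatively continuous maps *)

Section BorelMaps.
Context {R : realType}.

(** Only local bounds are assumed, because the curve is not continuous at reflections; [D] restricts
    them to the set where [g] is meaningful. *)
Lemma compact_bounded (T : topologicalType) (K D : set T) (g : T -> R) : compact K ->
  (forall x : T, K x -> exists M, \forall y \near x, D y -> `|g y| <= M) ->
  exists M, forall y, K y -> D y -> `|g y| <= M.
Proof.
move=> /compact_near_coveringP cK lb.
have H : \forall M \near +oo, K `<=` (fun y => D y -> `|g y| <= M).
  apply: cK => x Kx; have [M0 hM] := lb x Kx.
  exists ([set y | D y -> `|g y| <= M0], [set M | M0 <= M]) => /=.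
    by split=> //; exists M0; split; [exact: num_real|move=> M /ltW].
  by move=> [y M] /= [h1 h2] Dy; exact: le_trans (h1 Dy) h2.
have [M [Mr hM]] := H; exists (M + 1) => y Ky Dy.
by apply: (hM (M + 1)) => //; rewrite ltrDl.
Qed.

Lemma borel_closed (T : ptopologicalType) (A : set T) : closed A ->
  measurable (A : set (g_sigma_algebraType (@open T))).
Proof.
move=> cA; rewrite -[A]setCK; apply: measurableC; apply: sub_sigma_algebra.
exact: closed_openC.
Qed.

(** Continuity is assumed along [A] only, as [jump] and [Hp] are controlled on closed sets.
    Superlevel sets are traces on [A] of the interiors displayed in the proof. *)
Lemma borel_measurable_fun (T : ptopologicalType) (A : set T) (g : T -> R) : closed A ->
  (forall (x : T) (e : R), A x -> 0 < e -> \forall y \near x, A y -> `|g y - g x| <= e) ->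
  measurable_fun (A : set (g_sigma_algebraType (@open T))) g.
Proof.
move=> cA gc; apply: (@measurability _ _ (g_sigma_algebraType (@open T)) _ A g (@measurable_realfun.RGenOInfty.G R)); first exact: measurable_realfun.RGenOInfty.measurableE.
move=> _ [_ [x ->] <-].
have -> : A `&` g @^-1` `]x, +oo[ = A `&` (interior [set y | A y -> x < g y]).
  apply/seteqP; split=> y [Ay] /=; rewrite in_itv /= andbT; last first.
    by move=> /interior_subset h; split=> //; exact: h.
  move=> xg; split=> //; rewrite /interior /=.
  have d0 : 0 < (g y - x) / 2 by rewrite divr_gt0 // subr_gt0.
  have := gc y _ Ay d0; apply: filterS => z h Az.
  by have := h Az; rewrite ler_norml => /andP[]; lra.
apply: measurableI; first exact: borel_closed.
by apply: sub_sigma_algebra; exact: open_interior.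
Qed.

End BorelMaps.

Lemma borel_measurable_map (T U : ptopologicalType) (A : set T) (g : T -> U) : closed A ->
  (forall (x : T) (V : set U), A x -> nbhs (g x) V -> \forall y \near x, A y -> V (g y)) ->
  @measurable_fun _ _ (g_sigma_algebraType (@open T)) (g_sigma_algebraType (@open U)) A g.
Proof.
move=> cA gc.
apply: (@measurability _ _ (g_sigma_algebraType (@open T)) (g_sigma_algebraType (@open U)) A g (@open U)) => //.
move=> _ [V oV <-].
have -> : A `&` g @^-1` V = A `&` (interior [set y | A y -> V (g y)]).
  apply/seteqP; split=> y [Ay] /=; last first.
    by move=> /interior_subset h; split=> //; exact: h.
  by move=> Vgy; split=> //; apply: gc => //; exact: open_nbhs_nbhs.
apply: measurableI; first exact: borel_closed.
by apply: sub_sigma_algebra; exact: open_interior.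
Qed.

Lemma dist_bound (R : realType) (u v e : R) : `|u - v| <= e -> `|u| <= `|v| + e.
Proof. by have := ler_normD (u - v) v; rewrite subrK; lra. Qed.

Lemma ball_dist (R : realType) (u v e : R) : ball u e v -> `|v - u| <= e.
Proof. by move=> /ltW; rewrite /= distrC. Qed.

(** * Bounds, and the projection to zeta = 0 *)

Section ParallelProjection.
Context {R : realType} {n : nat} {G : geometry R n}.
Local Notation P := (pcoord R n).
Local Notation bM := (boundary (@Mset R n G)).
Local Notation qn := (quasi_normal (@Mset R n G) (@metric R n G)).
Local Notation HG := (@Hpar R n G `|` @Gpar R n G).
Implicit Types (c : chart R n G) (q : P) (rho : phase G) (x : G).

Lemma dzeta_bounded a : C1c a -> exists M, forall rho, bTL rho -> `|dzeta a rho| <= M.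
Proof.
move=> [ca cK].
have [x Kx|M hM] := @compact_bounded R _ _ (@bTL R n G) (dzeta a) cK.
  have [bx|nb] := pselect (bTL x).
    exists (`|dzeta a x| + 1); apply: filterS (dzeta_near ca bx ltr01) => y h /h; exact: dist_bound.
  exists 0; have := open_nbhs_nbhs (conj (closed_openC (@closed_bTL R n G)) nb).
  by apply: filterS => y ny /ny.
exists (Num.max M 0) => rho br; have [->|/(dzeta_supp ca br) Kr] := eqVneq (dzeta a rho) 0.
  by rewrite normr0 le_max lexx orbT.
by rewrite le_max hM.
Qed.

Lemma jump_bounded a : C1c a -> exists M, forall rho, HG rho -> `|jump a rho| <= M.
Proof.
move=> ca; have [M hM] := dzeta_bounded ca; exists M => rho hr.
have [th -> bx] := jump_dzeta ca.1 hr; apply: hM; exact: bTL_set_zeta.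
Qed.

(** The support point found is only in the same fibre as [rho]. Agreement in time is enough, since
    supports will be used through the time variable. *)
Lemma jump_supp a rho : C1c a -> HG rho -> jump a rho != 0 ->
  exists2 k, closure [set r | a r != 0] k & ph_t k = ph_t rho.
Proof.
move=> ca hr; have [th -> bx] := jump_dzeta ca.1 hr.
move=> /(dzeta_supp ca.1 (bTL_set_zeta th bx)) Kk.
exists (set_zeta rho th); first exact: Kk.
by have [qc dx] := qn_chartP bx; have [_ tE _] := set_zeta_qn th qc dx bx.
Qed.

Lemma Hp_bounded a : C1c a -> exists M, forall rho, TLhat rho -> `|Hp a rho| <= M.
Proof.
move=> [ca cK].
have [x Kx|M hM] := @compact_bounded R _ _ (@TLhat R n G) (Hp a) cK.
  have [bx|nb] := pselect (TLhat x).
    have mx := Mhat_sub_mdom bx.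
    exists (`|Hp a x| + 1).
    have := near_preimage (Hp_continuous ca mx) (nbhsx_ballx _ 1 ltr01).
    by apply: filterS => y /ball_dist hy _; exact: dist_bound.
  exists 0; have := open_nbhs_nbhs (conj (closed_openC (@closed_TLhat R n G)) nb).
  by apply: filterS => y ny /ny.
exists (Num.max M 0) => rho br; have mr := Mhat_sub_mdom br.
have [->|/(Hp_supp ca mr) Kr] := eqVneq (Hp a rho) 0.
  by rewrite normr0 le_max lexx orbT.
by rewrite le_max hM.
Qed.

Lemma jump_measurable a : C1ph a -> measurable_fun (HG : set (borel G)) (jump a).
Proof.
move=> ca; apply: borel_measurable_fun; first exact: closed_HG.
by move=> x e hx e0; exact: jump_continuous.
Qed.

Lemma Hp_measurable a : C1ph a -> measurable_fun (@TLhat R n G : set (borel G)) (Hp a).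
Proof.
move=> ca; apply: borel_measurable_fun; first exact: closed_TLhat.
move=> x e hx e0; have mx := Mhat_sub_mdom hx.
have := near_preimage (Hp_continuous ca mx) (nbhsx_ballx _ e e0).
by apply: filterS => y /ball_dist hy _.
Qed.

Lemma C1ph_continuous (a : phase G -> R) : C1ph a -> continuous a.
Proof.
move=> ca rho; have ac := pref_chart_atlas (ph_x rho); have dx := pref_chart_dom (ph_x rho).
set c := pref_chart _ in ac dx.
have C := differentiable_continuous (C1pt_diff (C1ph_pt ca ac (pcod_lcrd dx))).
have H := cvg_for (lcrd_continuous ac dx) C.
have E : \forall r \near rho, (a \o ofcrd c) (lcrd c r) = a r.
  have : \forall r \near rho, dom c (ph_x r) by apply: ph_x_continuous; exact: near_dom.
  by apply: filterS => r dr /=; congr a; exact: ofcrd_lcrd.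
exact: (near_eq_continuous E H).
Qed.

Definition par_proj rho : phase G := set_zeta rho 0.

Lemma par_proj_near rho0 (V : set (phase G)) : bTL rho0 -> nbhs (par_proj rho0) V ->
  \forall rho \near rho0, bTL rho -> V (par_proj rho).
Proof.
move=> bx nV; have [qc dx] := qn_chartP bx; have ac := qn_atlas qc.
set c := qn_chart _ in qc dx ac.
have H2 : \forall r \near rho0, dom c (ph_x r) by apply: ph_x_continuous; exact: near_dom.
have sE r : dom c (ph_x r) -> bTL r -> par_proj r = ofcrd c (setz (lcrd c r) 0).
  move=> dr br; have [xp _ <-] := set_zeta_qn 0 qc dr br.
  by apply: esym; apply: ofcrd_lcrd => //; rewrite xp.
have FF := @nbhs_filter (phase G) rho0.
have s := setz_cvg (lcrd_continuous ac dx) (@cvg_cst _ (0 : R) _ (nbhs rho0) FF) .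
have cq : pcod c (setz (lcrd c rho0) 0) by rewrite /pcod /= co_x_setz; exact: pcod_lcrd.
have C := cvg_for (s FF) (ofcrd_continuous ac cq).
rewrite (sE _ dx bx) in nV.
have H1 := C _ nV.
by near=> r => br; rewrite sE //; near: r.
Unshelve. all: by end_near. Qed.

Lemma par_proj_measurable : @measurable_fun _ _ (borel G) (borel G) (@bTL R n G) par_proj.
Proof.
apply: borel_measurable_map; first exact: closed_bTL.
by move=> x V bx nV; exact: par_proj_near.
Qed.

(** Setting zeta to 0 subtracts the square of zeta from p, which was 0. *)
Lemma par_proj_HG rho : bTL rho -> p rho = 0 -> HG (par_proj rho).
Proof.
move=> bx p0; apply/HG_p_le0; split; first by split; [exact: bTL_set_zeta|exact: zeta_set_zeta].
by rewrite p_set_zeta // p0 sub0r expr0n addr0 oppr_le0 sqr_ge0.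
Qed.

Lemma par_proj_Gpar rho : Gpar rho -> par_proj rho = rho.
Proof. by move=> [[bx z0] _]; exact: set_zeta_id. Qed.

(** [rho] and [Sigma rho] are [rho_plus] and [rho_minus] of the projected point, where - p is the
    square of zeta. The factor is [normal_gap] there; it will also be the jump of N. *)
Lemma jump_par_proj a rho : Hbplus rho ->
  a rho - a (Sigma rho) = 2 * zeta rho * jump a (par_proj rho).
Proof.
move=> [bx [p0 z0]]; have hs := par_proj_HG bx p0.
have ps : p (par_proj rho) = - zeta rho ^+ 2 by rewrite p_set_zeta // p0 sub0r expr0n addr0.
have pn : p (par_proj rho) < 0 by rewrite ps oppr_lt0 exprn_gt0.
have bs := bTL_set_zeta 0 bx.
rewrite (jump_Hpar a (Hpar_lt0 hs pn)) /jump_quot normal_gapE //.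
rewrite /rho_plus /rho_minus ps opprK sqrtr_sqr gtr0_norm //.
rewrite !set_zeta_set_zeta // -/(Sigma rho) (set_zeta_id bx (erefl (zeta rho))).
by rewrite mulrC divfK // mulf_neq0 // gt_eqF.
Qed.

End ParallelProjection.

(** * H_p^2 z in different quasi-normal charts *)

Section QnBracket.
Context {R : realType} {n : nat} {G : geometry R n}.
Local Notation P := (pcoord R n).
Local Notation bM := (boundary (@Mset R n G)).
Local Notation qn := (quasi_normal (@Mset R n G) (@metric R n G)).
Implicit Types (c : chart R n G) (q : P) (rho : phase G) (x : G).

Lemma Hp_z_qn c q : qn c -> pcod c q -> bM (psi c (co_x q)) -> Hp_z c q = 2 * zlast (co_xi q).
Proof.
move=> qc cq bx; have [dx uE] := psiK cq.
have He := ginv_qn qc dx bx; rewrite uE in He.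
have -> : Hp_z c q = 2 * zlast (co_xi q *m ginv c (co_x q)) by [].
rewrite zlast_mul -mulmxA [X in _ *m X](_ : _ = delta_mx ord_max 0); first by rewrite -zlast_mul.
exact: He.
Qed.

Lemma bM_chart c q : qn c -> pcod c q -> (bM (psi c (co_x q)) <-> zlast (co_x q) = 0).
Proof.
by move=> [_ _ H _] cq; have [dx uE] := psiK cq; rewrite -{2}uE; exact: H.
Qed.

(* The difference of the two functions vanishes on {z = 0}, to which H_p is tangent. *)
Lemma Hp2_z_change c c' q : qn c -> qn c' -> good c q -> dom c' (psi c (co_x q)) ->
  bM (psi c (co_x q)) -> zlast (co_xi q) = 0 -> Hp2_z c' (clift c c' q) = Hp2_z c q.
Proof.
move=> qc qc' gq dx' bx z0; have ac := qn_atlas qc; have ac' := qn_atlas qc'.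
have [cq mx] := gq; have [dx _] := psiK cq.
have [dl HE] := Ham_change ac ac' gq dx'.
set H := Ham (psy c) q in HE *.
have gq' : good c' (clift c c' q).
  split; first by rewrite /pcod /= co_x_clift; exact: psi_phi_dom.
  by rewrite co_x_clift phiK.
have d1 : is_derive (0 : R) (1 : R) (fun s => (Hp_z c' \o clift c c') (q + s *: H)) (Hp2_z c' (clift c c' q)).
  have dw := C1pt_diff (Hp_z_C1 ac' gq').
  have E : q + 0 *: H = q by rewrite scale0r addr0.
  have := @is_derive_line R _ _ (Hp_z c' \o clift c c') q H 0; rewrite E.
  move=> /(_ (differentiable_comp dl dw)).
  by rewrite (diff_comp dl dw) /= HE.
have d2 : is_derive (0 : R) (1 : R) (fun s => Hp_z c (q + s *: H)) (Hp2_z c q).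
  have dw := C1pt_diff (Hp_z_C1 ac gq).
  have E : q + 0 *: H = q by rewrite scale0r addr0.
  by have := @is_derive_line R _ _ (Hp_z c) q H 0; rewrite E; exact.
have zH : zlast (co_x H) = 0.
  have [_ -> _] := Ham_psy ac gq.
  have -> : zlast (2 *: (co_xi q *m ginv c (co_x q))) = Hp_z c q by rewrite /zlast mxE.
  by rewrite Hp_z_qn // z0 mulr0.
have zq : zlast (co_x q) = 0 by exact: ((bM_chart qc cq).1 bx).
have c0 : {for (0 : R), continuous (fun s : R => q + s *: H)}.
  by apply: cvgD; [exact: cvg_cst|exact: scalel_continuous].
have n1 : nbhs (q + 0 *: H) (fun q' => pcod c q' /\ dom c' (psi c (co_x q'))).
  rewrite scale0r addr0; apply: filterI; first exact: pcod_near.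
  exact: (pcod_near_psi cq (near_dom dx')).
have n2 := near_preimage c0 n1.
have eqn : \forall s \near (0 : R), (Hp_z c' \o clift c c') (q + s *: H) = Hp_z c (q + s *: H).
  apply: filterS n2 => s [cs ds].
  have zs : zlast (co_x (q + s *: H)) = 0.
    have -> : zlast (co_x (q + s *: H)) = zlast (co_x q) + s * zlast (co_x H) by rewrite /zlast !mxE.
    by rewrite zq zH mulr0 addr0.
  have bs : bM (psi c (co_x (q + s *: H))) by exact: ((bM_chart qc cs).2 zs).
  have [dxs _] := psiK cs.
  rewrite /= (Hp_z_qn qc cs bs) Hp_z_qn //; last 2 first.
  - by rewrite /pcod /= co_x_clift; exact: psi_phi_dom.
  - by rewrite co_x_clift phiK.
  congr (2 * _); rewrite co_xi_clift !zlast_mul -mulmxA.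
  by have [_ ->] := qn_tjac qc qc' dxs ds bs.
case: d1 d2 => _ <- [_ <-]; exact: near_eq_derive.
Qed.

Lemma Hp2z_chart c rho : qn c -> dom c (ph_x rho) -> bparTL rho ->
  Hp2z rho = Hp2_z c (lcrd c rho).
Proof.
move=> qc dx [bx z0]; have [q0 d0] := qn_chartP bx.
have ac := qn_atlas qc; have a0 := qn_atlas q0.
rewrite /Hp2z /qcoord -psyE -lcrdE.
set c0 := qn_chart _ in q0 d0 a0 *.
have g0 : good c0 (lcrd c0 rho) by apply: good_lcrd => //; exact: bM_mdom.
rewrite (poisson2_psy_z a0 g0) -(lcrd_clift a0 ac d0 dx).
apply: esym; apply: Hp2_z_change => //; rewrite ?co_x_lcrd ?phiK //.
by rewrite -(zeta_qn q0 d0 bx).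
Qed.

End QnBracket.

(** * Local compactness of coordinates, regularity of the phase space *)

Definition lcompact (T : topologicalType) := forall (x : T) (V : set T),
  nbhs x V -> exists K, [/\ compact K, nbhs x K & K `<=` V].

Lemma lcompact_prod (T U : topologicalType) : lcompact T -> lcompact U -> lcompact (T * U)%type.
Proof.
move=> cT cU [x y] V [[A B] /= [nA nB] AB].
have [K [cK nK KA]] := cT _ _ nA; have [L [cL nL LB]] := cU _ _ nB.
exists (K `*` L); split; first exact: compact_setX.
  by exists (K, L).
by move=> [u v] [/= Ku Lv]; apply: AB; split; [exact: KA|exact: LB].
Qed.

Lemma lcompact_R (R : realType) : lcompact R.
Proof.
move=> x V /nbhs_ballP[e /= e0 eV]; exists `[x - e / 2, x + e / 2]%classic; split.
- exact: segment_compact.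
- apply/nbhs_ballP; exists (e / 2) => /=; first by rewrite divr_gt0.
  move=> y /ball_dist; rewrite ler_norml => /andP[h1 h2] /=; rewrite in_itv /=.
  by apply/andP; split; lra.
- move=> y; rewrite /= in_itv /= => /andP[h1 h2]; apply: eV.
  rewrite -ball_normE /= distrC; apply: (@le_lt_trans _ _ (e / 2)); last by lra.
  by rewrite ler_norml; apply/andP; split; lra.
Qed.

Lemma lcompact_rV (R : realType) (n : nat) : lcompact 'rV[R]_n.
Proof.
move=> x V /nbhs_ballP[e /= e0 eV]; exists (closed_ball x (e / 2)).
have e2 : 0 < e / 2 by rewrite divr_gt0.
split.
- apply: bounded_closed_compact; last exact: closed_ball_closed.
  rewrite closed_ballE //; exists (`|x| + e / 2); split; first exact: num_real.
  move=> M xM y; rewrite /closed_ball_ /= => h; apply: le_trans (ltW xM).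
  have := ler_normD (y - x) x; rewrite subrK distrC; lra.
- apply/nbhs_ballP; exists (e / 2) => //; exact: subset_closed_ball.
- move=> y; rewrite closed_ballE // /closed_ball_ /= => h; apply: eV.
  by rewrite -ball_normE /=; lra.
Qed.

Lemma lcompact_pcoord (R : realType) (n : nat) : lcompact (pcoord R n).
Proof.
apply: lcompact_prod; last exact: lcompact_rV.
apply: lcompact_prod; last exact: lcompact_R.
by apply: lcompact_prod; [exact: lcompact_R|exact: lcompact_rV].
Qed.

(** A compact neighbourhood in coordinates has a compact image, closed by [phase_hausdorff]. Closed
    neighbourhoods are needed because limits of [gamma] stay in them. *)
Lemma phase_regular (R : realType) (n : nat) (N : manifold R n) (rho : phase N) V : nbhs rho V ->
  exists C, [/\ closed C, nbhs rho C & C `<=` V].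
Proof.
move=> nV; have ac := pref_chart_atlas (ph_x rho); have dx := pref_chart_dom (ph_x rho).
set c := pref_chart _ in ac dx; have cq := pcod_lcrd dx.
have oc := ofcrd_continuous ac cq.
have n1 : nbhs (lcrd c rho) (fun q => pcod c q /\ V (ofcrd c q)).
  apply: filterI; first exact: pcod_near.
  have nV' : nbhs (ofcrd c (lcrd c rho)) V by rewrite ofcrd_lcrd.
  exact: (near_preimage oc nV').
have [K [cK nK KV]] := lcompact_pcoord n1.
exists (ofcrd c @` K); split.
- apply: compact_closed; first exact: phase_hausdorff.
  apply: continuous_compact => //; apply: continuous_in_subspaceT => q /set_mem Kq.
  by apply: ofcrd_continuous => //; exact: (KV _ Kq).1.
- have n2 := near_preimage (lcrd_continuous ac dx) nK.
  have n3 : \forall r \near rho, dom c (ph_x r) by apply: ph_x_continuous; exact: near_dom.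
  near=> r; exists (lcrd c r); first by near: r.
  by apply: ofcrd_lcrd => //; near: r.
- by move=> _ [q /KV[_ Vq] <-].
Unshelve. all: by end_near. Qed.

(** * The curve *)

(** Differentiability in remainder form: unlike a limit of quotients along [s'] off B, a non-strict
    inequality passes to the right limits that define [Gam]. *)
Definition approxP (R : realType) (V : normedModType R) (y : R -> V) (s : R) (v : V) :=
  forall e : R, 0 < e -> \forall s' \near s, `|y s' - y s - (s' - s) *: v| <= e * `|s' - s|.

Lemma diff_eps (R : realType) (V W : normedModType R) (f : V -> W) x (e : R) :
  differentiable f x -> 0 < e ->
  \forall y \near x, `|f y - f x - 'd f x (y - x)| <= e * `|y - x|.
Proof.
move=> /diff_locallyP[_ /eqaddoP H] e0.
have /nbhs_ballP[d /= d0 hd] : nbhs (0 : V) (fun h => `|(f \o shift x - (cst (f x) + 'd f x)) h| <= e * `|h|).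
  exact: H.
apply/nbhs_ballP; exists d => //= y; rewrite -ball_normE /= => yd.
have := hd (y - x); rewrite -ball_normE /= sub0r normrN distrC => /(_ yd).
by rewrite fctE /= subrK opprD addrA.
Qed.

Lemma approxP_comp (R : realType) (V : normedModType R) (y : R -> V) (s : R) (v : V) (f : V -> R) :
  approxP y s v -> differentiable f (y s) -> approx1 (f \o y) s ('d f (y s) v).
Proof.
move=> yv df e e0.
have [k k0 hk] := linear_lipschitz (diff_continuous df).
(* [K] is a Lipschitz constant of [y] at [s] and [k] one of the differential; the remainder of [f]
   and that of [y] receive [e / 2] each. *)
pose K := `|v| + 1; have K0 : 0 < K by have := normr_ge0 v; rewrite /K; lra.
have a0 : 0 < e / 2 / K by rewrite !divr_gt0.
have b0 : 0 < Num.min 1 (e / 2 / k) by rewrite lt_min ltr01 !divr_gt0.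
have h1 := yv _ b0.
have ly : \forall r \near s, `|y r - y s| <= K * `|r - s|.
  apply: filterS h1 => r h.
  have h2 : `|y r - y s| <= `|y r - y s - (r - s) *: v| + `|(r - s) *: v|.
    by have := ler_normD (y r - y s - (r - s) *: v) ((r - s) *: v); rewrite subrK.
  apply: le_trans h2 _; rewrite normrZ /K mulrDl mul1r addrC (mulrC `|v|) lerD2l.
  apply: le_trans h _; rewrite -[leRHS]mul1r; apply: ler_wpM2r => //.
  by rewrite ge_min lexx.
have cy : {for s, continuous y}.
  apply/cvgrPdist_le => d d0.
  have dK : 0 < d / K by rewrite divr_gt0.
  have n2 : \forall r \near s, `|s - r| < d / K by apply: (ball_near dK).
  near=> r; rewrite distrC; apply: (@le_trans _ _ (K * `|r - s|)); first by near: r.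
  by rewrite mulrC -ler_pdivlMr // distrC; apply/ltW; near: r.
have h3 := near_preimage cy (diff_eps df a0).
near=> r; rewrite /=.
have H1 : `|f (y r) - f (y s) - 'd f (y s) (y r - y s)| <= e / 2 / K * `|y r - y s| by near: r.
have H2 : `|y r - y s| <= K * `|r - s| by near: r.
have H3 : `|y r - y s - (r - s) *: v| <= Num.min 1 (e / 2 / k) * `|r - s| by near: r.
have H4 : `|'d f (y s) (y r - y s - (r - s) *: v)| <= e / 2 * `|r - s|.
  apply: le_trans (hk _) _; apply: (@le_trans _ _ (k * (e / 2 / k * `|r - s|))); last first.
    by rewrite mulrA [k * _]mulrC divfK // gt_eqF.
  rewrite ler_pM2l //; apply: le_trans H3 _; apply: ler_wpM2r => //.
  by rewrite ge_min lexx orbT.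
have H5 : e / 2 / K * `|y r - y s| <= e / 2 * `|r - s|.
  apply: (@le_trans _ _ (e / 2 / K * (K * `|r - s|))); first by rewrite ler_pM2l.
  by rewrite mulrA divfK // gt_eqF.
rewrite linearB linearZ /= [_ *: _]mulrC in H4.
have -> : f (y r) - f (y s) - 'd f (y s) v * (r - s) =
  (f (y r) - f (y s) - 'd f (y s) (y r - y s)) + ('d f (y s) (y r - y s) - 'd f (y s) v * (r - s)).
  by rewrite addrA subrK.
apply: le_trans (ler_normD _ _) _.
have -> : e * `|r - s| = e / 2 * `|r - s| + e / 2 * `|r - s| by rewrite -mulrDl -splitr.
by apply: lerD => //; exact: le_trans H1 H5.
Unshelve. all: by end_near. Qed.

Lemma cvg_remainder (R : realType) (V : normedModType R) (T : Type) (F : set_system T)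
    (FF : Filter F) (y : T -> V) (r : T -> R) (y0 y1 v : V) (r0 s e : R) :
  y @ F --> y1 -> r @ F --> r0 ->
  (`|y t - y0 - (r t - s) *: v| - e * `|r t - s|) @[t --> F] -->
  (`|y1 - y0 - (r0 - s) *: v| - e * `|r0 - s|).
Proof.
move=> yF rF.
have c1 : (r t - s) @[t --> F] --> r0 - s by exact: (cvgB rF (cvg_cst s)).
have c2 : (y t - y0) @[t --> F] --> y1 - y0 by exact: (cvgB yF (cvg_cst y0)).
have c3 : (r t - s) *: v @[t --> F] --> (r0 - s) *: v by exact: (cvgZ c1 (cvg_cst v)).
have c4 : (y t - y0 - (r t - s) *: v) @[t --> F] --> y1 - y0 - (r0 - s) *: v by exact: (cvgB c2 c3).
have c5 : e * `|r t - s| @[t --> F] --> e * `|r0 - s| by exact: (cvgM (cvg_cst e) (cvg_norm c1)).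
exact: (cvgB (cvg_norm c4) c5).
Qed.

Section Curve.
Context {R : realType} {n : nat} {G : geometry R n}.
Local Notation P := (pcoord R n).
Local Notation bM := (boundary (@Mset R n G)).
Local Notation qn := (quasi_normal (@Mset R n G) (@metric R n G)).
Implicit Types (c : chart R n G) (q : P) (rho : phase G) (x : G).
Variables (B : set R) (gamma : R -> phase G).
Hypothesis hgamma : gen_bichar [set: R] B gamma.

Lemma B_isolated S : B S -> exists2 d, 0 < d & forall r, 0 < `|S - r| < d -> ~ B r.
Proof.
move=> bS; have [[_ _ iso _] _] := hgamma.
have [_ [V nV VB]] := iso S bS; have [d d0 hd] := near_ball nV.
exists d => // r /andP[r0 rd] br.
have : (V `&` B) r by split => //; exact: hd.
by rewrite VB /= => rS; move: r0; rewrite rS subrr normr0 ltxx.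
Qed.

Lemma gamma_in s : ~ B s -> p (gamma s) = 0 /\ TL (gamma s).
Proof. by move=> nB; have [[_ _ _ h] _] := hgamma; apply: h; split. Qed.

Definition Gam s : phase G := if pselect (B s) then lim (gamma @ s^'+) else gamma s.

Lemma GamD s : ~ B s -> Gam s = gamma s.
Proof. by move=> nB; rewrite /Gam; case: pselect. Qed.

Lemma GamB S : B S -> [/\ Hbplus (Gam S), gamma @ S^'+ --> Gam S &
  exists l, [/\ Hbminus l, gamma @ S^'- --> l & Gam S = Sigma l]].
Proof.
move=> bS; have [_ [_ /(_ S bS)[h1 h2 h3 h4]]] := hgamma.
have [|l Hl cl] := h2; first by exists 1.
have [|r Hr cr] := h3; first by exists 1.
have GE : Gam S = r.
  rewrite /Gam; case: pselect => // b; apply: cvg_lim => //; exact: phase_hausdorff.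
rewrite GE; split => //; exists l; split => //; apply: h4 => //; by exists 1.
Qed.

Lemma Gam_near S : B S -> exists2 d, 0 < d & forall r, 0 < `|S - r| < d ->
  [/\ ~ B r, TL (gamma r) & ~ bTL (gamma r)].
Proof.
move=> bS; have [_ [_ /(_ S bS)[h1 _ _ _]]] := hgamma.
have [d d0 hd] := B_isolated bS; have [d' d'0 hd'] := near_ball h1.
exists (Num.min d d'); first by rewrite lt_min d0.
move=> r /andP[r0]; rewrite lt_min => /andP[rd rd'].
have nb : ~ B r by apply: hd; rewrite r0.
by have [] := hd' r rd' (conj I nb).
Qed.

Lemma Gam_right S (V : set (phase G)) : B S -> nbhs (Gam S) V ->
  \forall r \near S, S < r -> V (Gam r).
Proof.
move=> bS nV; have [_ cr _] := GamB bS; have [d d0 hd] := B_isolated bS.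
have : \forall r \near S^'+, V (gamma r) by exact: (cr _ nV).
rewrite /at_right near_withinE => h.
have n2 : \forall r \near S, `|S - r| < d by apply: (ball_near d0).
near=> r => Sr; rewrite GamD; last first.
  apply: hd; apply/andP; split; last by near: r.
  by rewrite normr_gt0 subr_eq0 lt_eqF.
have : S < r -> V (gamma r) by near: r.
exact.
Unshelve. all: by end_near. Qed.

Lemma Gam_left S (l : phase G) (V : set (phase G)) : B S -> gamma @ S^'- --> l -> nbhs l V ->
  \forall r \near S, r < S -> V (Gam r).
Proof.
move=> bS cl nV; have [d d0 hd] := B_isolated bS.
have : \forall r \near S^'-, V (gamma r) by exact: (cl _ nV).
rewrite /at_left near_withinE => h.
have n2 : \forall r \near S, `|S - r| < d by apply: (ball_near d0).
near=> r => Sr; rewrite GamD; last first.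
  apply: hd; apply/andP; split; last by near: r.
  by rewrite normr_gt0 subr_eq0 gt_eqF.
have : r < S -> V (gamma r) by near: r.
exact.
Unshelve. all: by end_near. Qed.

(* B may accumulate at s; closed neighbourhoods carry over from gamma to its right limits. *)
Lemma Gam_continuous s : ~ B s -> {for s, continuous Gam}.
Proof.
move=> nB V; rewrite /= GamD // => /phase_regular[C [cC nC CV]].
have [_ [/(_ s (conj I nB))[_ cg _ _] _]] := hgamma.
have : within (setT `\` B) (nbhs s) (gamma @^-1` C) by exact: (cg _ nC).
rewrite /within /= => /near_ball[d d0 hd].
apply: (ball_near d0) => r rd; apply: CV.
have [br|nbr] := pselect (B r); last by rewrite GamD //; apply: hd.
have [_ cr _] := GamB br; apply: (@closed_cvg _ _ (r^'+) _ gamma C cC _ _ cr).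
have [d1 d10 hd1] := B_isolated br.
rewrite /at_right near_withinE.
have d2 : 0 < Num.min d1 (d - `|s - r|) by rewrite lt_min d10 subr_gt0.
apply: (ball_near d2) => r'; rewrite lt_min => /andP[r1 r2] rr'.
apply: hd; last first.
  by split=> //; apply: hd1; rewrite r1 andbT normr_gt0 subr_eq0 lt_eqF.
have := ler_normD (s - r) (r - r'); rewrite addrA subrK; lra.
Qed.

Lemma set_zeta_x rho (r : R) : bTL rho -> ph_x (set_zeta rho r) = ph_x rho.
Proof. by move=> bx; have [q0 d0] := qn_chartP bx; have [] := set_zeta_qn r q0 d0 bx. Qed.

Lemma set_zeta_t rho (r : R) : bTL rho -> ph_t (set_zeta rho r) = ph_t rho.
Proof. by move=> bx; have [q0 d0] := qn_chartP bx; have [] := set_zeta_qn r q0 d0 bx. Qed.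

Lemma set_zeta_tau rho (r : R) : bTL rho -> ph_tau (set_zeta rho r) = ph_tau rho.
Proof.
move=> bx; have [q0 d0] := qn_chartP bx; have [_ _ h] := set_zeta_qn r q0 d0 bx.
by have := congr1 (@co_tau R n) h; rewrite co_tau_setz !co_tau_lcrd.
Qed.

(** The left limit and the value of [Gam] at a reflection differ only in zeta, which [f] does not
    see. *)
Lemma Gam_x_continuous (U : topologicalType) (f : phase G -> U) : continuous f ->
  (forall rho r, bTL rho -> f (set_zeta rho r) = f rho) -> continuous (f \o Gam).
Proof.
move=> cf fS s; have [bs|nb] := pselect (B s); last first.
  by apply: (continuous_comp (Gam_continuous nb)); exact: cf.
move=> V nV.
have [[bx _] _ [l [[bl _] cl GE]]] := GamB bs.
have fl : f l = f (Gam s) by rewrite GE fS.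
have n1 := Gam_right bs (cf (Gam s) V nV).
have nV' : nbhs (f l) V by rewrite fl.
have n2 := Gam_left bs cl (cf l V nV').
suff h : \forall r \near s, V (f (Gam r)) by exact: h.
near=> r; case: (ltgtP r s) => [rs|sr|->].
- by move: rs; near: r.
- by move: sr; near: r.
- exact: nbhs_singleton nV.
Unshelve. all: by end_near. Qed.

(** [velocity] speaks of parameters off [B], while [s] may be a limit of points of [B]. At such a
    point the estimate is the limit of those just to its right, by [cvg_remainder]. *)
Lemma Gam_approx s c v : ~ B s -> atlas c -> dom c (ph_x (Gam s)) ->
  velocity (setT `\` B) gamma s c v -> approxP (lcrd c \o Gam) s v.
Proof.
move=> nB ac dx /cvgrPdist_le vl e e0.
have := vl e e0; rewrite near_withinE /dnbhs near_withinE => /near_ball[d d0 hd].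
have n1 : \forall r \near s, dom c (ph_x (Gam r)).
  have xc := Gam_x_continuous (@ph_x_continuous R n G) set_zeta_x (x := s).
  exact: (near_preimage xc (near_dom dx)).
have [d1 d10 hd1] := near_ball n1.
have key r : `|s - r| < d -> ~ B r -> `|lcrd c (gamma r) - lcrd c (Gam s) - (r - s) *: v| <= e * `|r - s|.
  move=> rd nr; have [->|rs] := eqVneq r s.
    by rewrite GamD // !subrr scale0r subr0 !normr0 mulr0.
  have rs0 : r - s != 0 by rewrite subr_eq0.
  have := hd r rd rs (conj I nr); rewrite -!lcrdE => h.
  have -> : lcrd c (gamma r) - lcrd c (Gam s) - (r - s) *: v =
     - ((r - s) *: (v - (r - s)^-1 *: (lcrd c (gamma r) - lcrd c (gamma s)))).
    by rewrite scalerBr scalerA divff // scale1r opprB GamD.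
  by rewrite normrN normrZ mulrC; exact: ler_wpM2r.
have d2 : 0 < Num.min d d1 by rewrite lt_min d0 d10.
apply: (ball_near d2) => r; rewrite lt_min => /andP[rd rd1].
have [br|nbr] := pselect (B r); last by rewrite /= (GamD nbr); exact: key.
have [_ cr _] := GamB br; have dr := hd1 r rd1.
have cl := cvg_for cr (lcrd_continuous ac dr).
have ci : r' @[r' --> r^'+] --> r by apply: cvg_within_filter; exact: cvg_id.
have FF : ProperFilter r^'+ by exact: at_right_proper_filter.
have cF := @cvg_remainder _ _ _ (r^'+) FF (fun r' => lcrd c (gamma r')) id (lcrd c (Gam s)) _ v _ s e cl ci.
rewrite -subr_le0; apply: (cvgr_to_le cF).
have [d3 d30 hd3] := B_isolated br.
rewrite /at_right near_withinE.
have d4 : 0 < Num.min d3 (d - `|s - r|) by rewrite lt_min d30 subr_gt0.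
apply: (ball_near d4) => r'; rewrite lt_min => /andP[r1 r2] rr'.
rewrite /= subr_le0; apply: key; last first.
  by apply: hd3; rewrite r1 andbT normr_gt0 subr_eq0 lt_eqF.
have := ler_normD (s - r) (r - r'); rewrite addrA subrK; lra.
Qed.

Lemma Gam_free s c : ~ B s -> ~ Ggl (Gam s) -> atlas c -> dom c (ph_x (Gam s)) ->
  approxP (lcrd c \o Gam) s (Ham (psy c) (lcrd c (Gam s))).
Proof.
move=> nB ng ac dx; apply: Gam_approx => //; rewrite psyE lcrdE (GamD nB).
have [_ [/(_ s (conj I nB))[_ _ h _] _]] := hgamma; rewrite (GamD nB) in ng dx.
exact: h.
Qed.

Lemma Gam_gliding s c : ~ B s -> Ggl (Gam s) -> qn c -> dom c (ph_x (Gam s)) ->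
  approxP (lcrd c \o Gam) s (HamG c (lcrd c (Gam s))).
Proof.
move=> nB ng qc dx; apply: Gam_approx => //; first exact: qn_atlas.
rewrite lcrdE (GamD nB).
have [_ [/(_ s (conj I nB))[_ _ _ h] _]] := hgamma; rewrite (GamD nB) in ng dx.
exact: h.
Qed.

End Curve.

(** * Induction on intervals, measurability off countable sets, primitives, images of measures *)

Section RealLine.
Context {R : realType}.
Local Notation lam := (@lebesgue_measure R).
Local Notation oc c d := (`]c, d]%classic : set (measurableTypeR R)).

(** The supremum of the end points reached from [a] is itself passed, because [Q] holds on all small
    intervals around it. *)
Lemma interval_induction (Q : R -> R -> Prop) :
  (forall s, exists2 d, 0 < d & forall u v, s - d < u -> u <= v -> v < s + d -> Q u v) ->
  (forall u v w, u <= v -> v <= w -> Q u v -> Q v w -> Q u w) ->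
  forall a b, a <= b -> Q a b.
Proof.
move=> loc tr a b ab.
pose S := [set x | [/\ a <= x, x <= b & Q a x]].
have Sa : S a.
  split=> //; have [d d0 h] := loc a; apply: h => //; lra.
have bS : ubound S b by move=> x [].
have hS : has_sup S by split; [exists a|exists b].
have sa : a <= sup S by apply: sup_ubound => //; exists b.
have sb : sup S <= b by apply: sup_le_ub => //; exists a.
have [d d0 h] := loc (sup S).
have [x [ax xb Qx] xs] : exists2 x, S x & sup S - d < x.
  have [x Sx h1] := sup_adherent d0 hS; exists x => //.
have xs' : x <= sup S by apply: sup_ubound => //; exists b.
pose v := Num.min b (sup S + d / 2).
have xv : x <= v by rewrite le_min xb /=; lra.
have vb : v <= b by rewrite ge_min lexx.
have vd : v < sup S + d.
  by apply: (@le_lt_trans _ _ (sup S + d / 2)); [rewrite ge_min lexx orbT|lra].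
have Qv : Q a v by apply: (tr a x v) => //; exact: h.
have Sv : S v by split => //; lra.
have vs : v <= sup S by apply: sup_ubound => //; exists b.
have vE : v = b by move: vs; rewrite /v; case: (leP b (sup S + d / 2)) => // _; lra.
by rewrite -vE.
Qed.

(** Attach to each point a rational to its right with no point of [B] up to it. Two points cannot
    share one, since the larger would be excluded by the smaller. *)
Lemma countable_isolated (B : set R) :
  (forall s, B s -> exists2 d, 0 < d & forall r, 0 < `|s - r| < d -> ~ B r) -> countable B.
Proof.
move=> iso.
have H s : exists q : rat, B s -> s < ratr q /\ forall r, s < r -> r <= ratr q -> ~ B r.
  have [bs|nb] := pselect (B s); last by exists 0.
  have [d d0 h] := iso s bs.
  have sd : s < s + d by lra.
  have [q /[!in_itv] /= /andP[q1 q2]] := rat_in_itvoo sd.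
  exists q => _; split=> // r sr rq; apply: h.
  by rewrite distrC gtr0_norm; [apply/andP; split; lra|lra].
have [f hf] := choice H.
apply/countable_injP; exists (fun s => pickle (f s)) => s r /set_mem bs /set_mem br /(pcan_inj pickleK) E.
have [s1 s2] := hf s bs; have [r1 r2] := hf r br.
case: (ltgtP s r) => // sr; exfalso.
- by apply: (s2 r sr) => //; rewrite E ltW.
- by apply: (r2 s sr) => //; rewrite -E ltW.
Qed.

(** Off [B] the preimage is locally a full neighbourhood; what remains is a part of [B], hence
    countable. *)
Lemma preimage_off_countable (T : topologicalType) (B A : set R) (g : R -> T) (V : set T) :
  countable B -> measurable (A : set (measurableTypeR R)) ->
  (forall s, A s -> ~ B s -> {for s, continuous g}) -> open V ->
  measurable (A `&` g @^-1` V : set (measurableTypeR R)).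
Proof.
move=> cB mA cg oV.
have -> : A `&` g @^-1` V = (A `&` interior (g @^-1` V)) `|` (A `&` B `&` g @^-1` V).
  apply/seteqP; split=> s /=.
    move=> [As Vs]; have [bs|nb] := pselect (B s); first by right.
    left; split=> //; apply: (cg s As nb); exact: open_nbhs_nbhs.
  by move=> [[As /interior_subset]|[[As _]]].
apply: measurableU.
  by apply: measurableI => //; apply: open_measurable; exact: open_interior.
apply: countable_measurable; first by move=> t; exact: measurable_set1.
apply: sub_countable cB; apply: subset_card_le => s [[_ bs] _]; exact: bs.
Qed.

Lemma measurable_off_countable (B A : set R) (g : R -> R) :
  countable B -> measurable (A : set (measurableTypeR R)) ->
  (forall s, A s -> ~ B s -> {for s, continuous g}) ->
  measurable_fun (A : set (measurableTypeR R)) g.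
Proof.
move=> cB mA cg.
apply: (@measurability _ _ (measurableTypeR R) _ A g (@RGenOInfty.G R)).
  exact: RGenOInfty.measurableE.
move=> _ [_ [x ->] <-]; apply: (preimage_off_countable cB) => //.

Qed.

Lemma borel_off_countable (T : ptopologicalType) (B A : set R) (g : R -> T) :
  countable B -> measurable (A : set (measurableTypeR R)) ->
  (forall s, A s -> ~ B s -> {for s, continuous g}) ->
  @measurable_fun _ _ (measurableTypeR R) (g_sigma_algebraType (@open T)) A g.
Proof.
move=> cB mA cg.
apply: (@measurability _ _ (measurableTypeR R) (g_sigma_algebraType (@open T)) A g (@open T)) => //.
by move=> _ [V oV <-]; exact: (preimage_off_countable cB).
Qed.

(** An instance of the balance lemmas, with zero measure, empty [Z] and zero [f] and [N]. *)
Lemma primitive_diff (a b C : R) (h : R -> R) : a <= b ->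
  measurable_fun (oc a b) h -> (forall r, oc a b r -> `|h r| <= C) ->
  forall c d, a <= c -> c <= d -> d <= b -> forall h0 e : R,
  (forall r, c < r -> r <= d -> `|h r - h0| <= e) ->
  `|(\int[lam]_(r in oc a d) h r - \int[lam]_(r in oc a c) h r) - h0 * (d - c)| <= e * (d - c).
Proof.
move=> ab mh hC c d ac cd db h0 e he.
have D : balance_data mzero a b (Num.max C 0) set0 (fun=> 0) h (fun=> 0).
  split=> //.
  - by move=> c' d' _ _ _; rewrite setI0 subrr.
  - by move=> r _; rewrite normr0 le_max lexx orbT.
  - by move=> r hr; rewrite le_max hC.
have H1 := bal_PhiB (fun=> 0) D ac cd db; have H2 := bal_Ih D ac cd db he.
have E : \int[lam]_(r in oc a d) h r - \int[lam]_(r in oc a c) h r = \int[lam]_(r in oc c d) h r.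
  by move: H1; rewrite /bal_Phi !setI0 !Rintegral_set0; lra.
by rewrite E.
Qed.

Lemma primitive_lip (a b C : R) (h : R -> R) : a <= b ->
  measurable_fun (oc a b) h -> (forall r, oc a b r -> `|h r| <= C) ->
  forall c d, a <= c <= b -> a <= d <= b ->
  `|\int[lam]_(r in oc a d) h r - \int[lam]_(r in oc a c) h r| <= C * `|d - c|.
Proof.
move=> ab mh hC c d /andP[ac cb] /andP[ad db].
wlog cd : c d ac cb ad db / c <= d.
  move=> W; case: (leP c d) => [|/ltW] cd; first exact: W.
  by rewrite distrC (distrC d); exact: W.
have := primitive_diff ab mh hC ac cd db (h0 := 0) (e := C).
rewrite mul0r subr0 (ger0_norm (_ : 0 <= d - c)) ?subr_ge0 //; apply => r cr rd.
by rewrite subr0; apply: hC; rewrite /= in_itv /=; apply/andP; split; lra.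
Qed.

Lemma primitive_approx (a b C : R) (h : R -> R) s : a < s -> s < b ->
  measurable_fun (oc a b) h -> (forall r, oc a b r -> `|h r| <= C) ->
  {for s, continuous h} -> approx1 (fun s => \int[lam]_(r in oc a s) h r) s (h s).
Proof.
move=> as_ sb mh hC ch e e0.
have ab : a <= b by lra.
have /near_ball[d d0 hd] := near_preimage ch (nbhsx_ballx _ e e0).
have m0 : 0 < Num.min d (Num.min (s - a) (b - s)) by rewrite !lt_min d0 !subr_gt0 as_.
apply: (ball_near m0) => r; rewrite !lt_min => /and3P[r1 r2 r3].
have ra : a <= r by have := ler_norm (s - r); lra.
have rb : r <= b by have := ler_norm (r - s); rewrite distrC; lra.
case: (leP s r) => [sr|/ltW rs].
  have := primitive_diff ab mh hC (ltW as_) sr rb (h0 := h s) (e := e).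
  rewrite (ger0_norm (_ : 0 <= r - s)) ?subr_ge0 //; apply => r' r's r'r.
  apply: ball_dist; apply: hd; rewrite distrC ger0_norm; last by lra.
  by move: r1; rewrite distrC ger0_norm; lra.
have := primitive_diff ab mh hC ra rs (ltW sb) (h0 := h s) (e := e).
rewrite [`|r - s|]distrC (ger0_norm (_ : 0 <= s - r)) ?subr_ge0 // => H.
rewrite -normrN opprD opprB -mulrN opprB; apply: H => r' r's r'r.
apply: ball_dist; apply: hd; rewrite ger0_norm; last by lra.
by move: r1; rewrite ger0_norm; lra.
Qed.

Lemma bounded_integrable d (T : measurableType d) (m : {measure set T -> \bar R}) (E : set T)
  (f : T -> R) M : measurable E -> (m E < +oo)%E -> measurable_fun E f ->
  (forall x, E x -> `|f x| <= M) -> m.-integrable E (EFin \o f).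
Proof.
move=> mE fE mf hM; apply: measurable_bounded_integrable => //.
exists M; split; first exact: num_real.
by move=> x Mx r Er /=; apply: le_trans (hM r Er) (ltW Mx).
Qed.

(** [g] is measurable on [E] only. It is given a default value outside, which the image measure does
    not notice because [E] carries [m]. *)
Lemma pushforward_exists d d' (T : measurableType d) (U : measurableType d')
  (m : {measure set T -> \bar R}) (E : set T) (g : T -> U) :
  measurable E -> (m setT < +oo)%E -> m (~` E) = 0%E -> measurable_fun E g ->
  exists nu : {measure set U -> \bar R}, [/\ (nu setT < +oo)%E,
    (forall A, measurable A -> (forall x, E x -> A (g x)) -> nu (~` A) = 0%E) &
    forall (H : set U) (f : U -> R) M, measurable H -> (forall x, E x -> H (g x)) ->
      measurable_fun H f -> (forall x, H x -> `|f x| <= M) ->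
      \int[nu]_(x in H) f x = \int[m]_(x in E) f (g x)].
Proof.
move=> mE fm m0 mg.
pose g' : T -> U := g \_ E.
have mg' : measurable_fun setT g' by exact: ((measurable_restrictT _ _).1 _).
have gE x : E x -> g' x = g x by move=> Ex; rewrite /g' patchE mem_set.
pose nu0 : {measure set U -> \bar R} := pushforward m g'.
exists (nu0 mg'); split.
- exact: fm.
- move=> A mA hA; apply: (@subset_measure0 _ _ _ m _ (~` E)) => //.
  + by rewrite -[X in measurable X]setTI; apply: mg' => //; exact: measurableC.
  + exact: measurableC.
  + by move=> x /= nA Ex; apply: nA; rewrite gE //; exact: hA.
- move=> H f M mH gH mf hM; rewrite /Rintegral; congr fine.
  pose fH : U -> R := f \_ H.
  have fHE x : H x -> fH x = f x by move=> Hx; rewrite /fH patchE mem_set.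
  have mfH : measurable_fun setT fH by exact: ((measurable_restrictT _ _).1 _).
  pose F : U -> \bar R := EFin \o fH.
  have mF : measurable_fun setT F by exact/measurable_EFinP.
  have mgH : measurable (g' @^-1` H) by rewrite -[X in measurable X]setTI; exact: mg'.
  have iF : m.-integrable (g' @^-1` H) (F \o g').
    apply: (@bounded_integrable _ _ m _ (fH \o g') M) => //.
    - by apply: (le_lt_trans _ fm); apply: le_measure; rewrite ?inE.
    - by apply: measurableT_comp => //; exact: measurable_funTS.
    - by move=> x Hx; rewrite /= fHE //; exact: hM.
  transitivity (\int[nu0 mg']_(x in H) F x)%E.
    by apply: eq_integral => x /set_mem xH; rewrite /F /= fHE.
  rewrite [LHS](integral_pushforward mg' mF iF mH).
  rewrite (negligible_integral (measurableC mE) mgH iF m0).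
  have -> : g' @^-1` H `\` ~` E = E.
    by rewrite setDE setCK; apply/setIidPr => x Ex /=; rewrite gE //; exact: gH.
  apply: eq_integral => x /set_mem Ex.
  by rewrite /F /= gE // fHE //; exact: gH.
Qed.
End RealLine.

(** * Time as a parameter of the curve *)

Section Clock.
Context {R : realType} {n : nat} {G : geometry R n}.
Local Notation P := (pcoord R n).
Local Notation bM := (boundary (@Mset R n G)).
Local Notation qn := (quasi_normal (@Mset R n G) (@metric R n G)).
Local Notation HG := (@Hpar R n G `|` @Gpar R n G).
Implicit Types (c : chart R n G) (q : P) (rho : phase G) (x : G).
Variables (B : set R) (gamma : R -> phase G).
Hypothesis hgamma : gen_bichar [set: R] B gamma.
Local Notation Gam := (Gam B gamma).

Lemma Gam_in s : p (Gam s) = 0 /\ TL (Gam s).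
Proof.
have [bs|nb] := pselect (B s); last by rewrite (GamD _ nb); exact: (gamma_in hgamma nb).
by have [[[mx _] [pz _]] _ _] := GamB hgamma bs.
Qed.

Lemma Gam_mdom s : mdom (ph_x (Gam s)).
Proof. by apply: Mset_mdom; have [] := Gam_in s. Qed.

Lemma Gam_TLhat s : TLhat (Gam s).
Proof. by have [_ /M_sub_Mhat/interior_subset] := Gam_in s. Qed.

Lemma Gam_B_bTL s : B s -> bTL (Gam s).
Proof. by move=> bs; have [[]] := GamB hgamma bs. Qed.

(** The free and the gliding field differ by a multiple of H_z, whose only component is along zeta:
    t and tau obey the same equations in both regimes. *)
Lemma Gam_ttau s : ~ B s -> exists c v, [/\ atlas c, dom c (ph_x (Gam s)),
  approxP (lcrd c \o Gam) s v, co_t v = - 2 * ph_tau (Gam s) & co_tau v = 0].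
Proof.
move=> nb.
have tt c : atlas c -> dom c (ph_x (Gam s)) ->
   co_t (Ham (psy c) (lcrd c (Gam s))) = - 2 * ph_tau (Gam s) /\ co_tau (Ham (psy c) (lcrd c (Gam s))) = 0.
  move=> ac dx; have [-> _ ->] := Ham_psy ac (good_lcrd dx (Gam_mdom s)).
  by rewrite co_tau_lcrd.
have [gg|ng] := pselect (Ggl (Gam s)); last first.
  exists (pref_chart (ph_x (Gam s))); eexists; split.
  - exact: pref_chart_atlas.
  - exact: pref_chart_dom.
  - by apply: (Gam_free hgamma nb ng); [exact: pref_chart_atlas|exact: pref_chart_dom].
  - by apply: (tt _ _ _).1; [exact: pref_chart_atlas|exact: pref_chart_dom].
  - by apply: (tt _ _ _).2; [exact: pref_chart_atlas|exact: pref_chart_dom].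
have [[[bx _] _] _] := gg; have [qc dx] := qn_chartP bx; have ac := qn_atlas qc.
exists (qn_chart (ph_x (Gam s))), (HamG (qn_chart (ph_x (Gam s))) (lcrd (qn_chart (ph_x (Gam s))) (Gam s))).
have [t1 t2] := tt _ ac dx.
have gq := good_lcrd dx (Gam_mdom s).
split=> //; first exact: (Gam_gliding hgamma nb gg qc dx).
- rewrite (HamGE ac gq) linearD linearZ /= t1 e_zetaN co_tE [_ *: _]mulr0 addr0 //.
- rewrite (HamGE ac gq) linearD linearZ /= t2 e_zetaN co_tauE [_ *: _]mulr0 addr0 //.
Qed.

Lemma approxP_coord c s v (f : P -> R) (lf : linear f) : continuous f -> approxP (lcrd c \o Gam) s v ->
  approx1 (fun s => f (lcrd c (Gam s))) s (f v).
Proof.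
move=> cf h.
pose fl : {linear P -> R} := HB.pack f (GRing.isLinear.Build R P R _ f lf).
have df : differentiable fl (lcrd c (Gam s)) by exact: linear_differentiable.
have := approxP_comp h df; rewrite (diff_lin (f := fl)) //; exact.
Qed.

Lemma Gam_tau_continuous : continuous (@ph_tau R n G).
Proof.
move=> rho; have H := lcrd_continuous (pref_chart_atlas (ph_x rho)) (pref_chart_dom (ph_x rho)).
set c := pref_chart _ in H; have -> : @ph_tau R n G = co_tau \o lcrd c.
  by apply/funext => r; rewrite /= co_tau_lcrd.
exact: (cvg_for H (@co_tau_continuous R n _)).
Qed.

Lemma flat_cst (F : R -> R) : continuous F ->
  (forall s, ~ B s -> approx1 F s 0) -> forall a b, F a = F b.
Proof.
move=> cF h a b; wlog ab : a b / a <= b.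
  by move=> W; case: (leP a b) => [|/ltW] ab; [exact: W|exact: esym (W _ _ ab)].
have hf s : ~ B s -> flat `[a, b] F s.
  move=> nb e e0; apply: filterS (h s nb e e0) => r; by rewrite mul0r subr0.
apply: (flat_eq ab) => s sab; have [bs|nb] := pselect (B s); last by left; exact: hf.
right; split.
  have [d d0 hd] := B_isolated hgamma bs; exists d => // r _ rd; apply: hf; exact: hd.
move=> e e0; have := near_preimage (cF s) (nbhsx_ballx _ e e0).
by apply: filterS => r /ball_dist.
Qed.

Lemma Gam_tau s s' : ph_tau (Gam s) = ph_tau (Gam s').
Proof.
apply: (flat_cst (F := @ph_tau R n G \o Gam)).
  exact: (Gam_x_continuous hgamma Gam_tau_continuous (@set_zeta_tau R n G)).
move=> r nb; have [c [v [ac dx h _ v0]]] := Gam_ttau nb.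
have := approxP_coord (@co_tau_linear R n) (@co_tau_continuous R n) h; rewrite v0.
rewrite (_ : (fun s0 => _) = ph_tau (N := G) \o Gam) //.
by apply/funext => r' /=; rewrite co_tau_lcrd.
Qed.

Hypothesis hnontriv : exists2 s, ~ B s & (ph_tau (gamma s), ph_xi (gamma s)) <> (0, 0).

Definition tau0 : R := ph_tau (Gam 0).

(** If tau were 0, then p = 0 and positivity of the metric would force xi = 0 at the point where the
    curve is nontrivial. *)
Lemma tau0_neq0 : tau0 != 0.
Proof.
apply/eqP => t0; have [s nb nz] := hnontriv; apply: nz.
have ts : ph_tau (gamma s) = 0 by rewrite -(GamD _ nb) (Gam_tau s 0).
rewrite ts; congr (_, _).
have [pz mx] := gamma_in hgamma nb.
set rho := gamma s in ts pz mx *; set c := pref_chart (ph_x rho).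
have ac : atlas c := pref_chart_atlas _; have dx : dom c (ph_x rho) := pref_chart_dom _.
have xE : co_xi (lcrd c rho) = ph_xi rho.
  by rewrite co_xi_lcrd -/c (tjac_id dx) trmx1 mulmx1.
have gq : good c (lcrd c rho) by apply: good_lcrd => //; exact: Mset_mdom.
apply/eqP; apply: contrapT => /negP xi0.
have := ginv_pos ac gq xi0.
move: pz; rewrite (p_chart ac dx (Mset_mdom mx)) psy_def xE co_tau_lcrd ts expr0n oppr0 add0r => ->.
by rewrite ltxx.
Qed.

Lemma Gam_t s : ph_t (Gam s) = ph_t (Gam 0) - 2 * tau0 * s.
Proof.
suff E : ph_t (Gam s) + 2 * tau0 * s = ph_t (Gam 0) + 2 * tau0 * 0.
  by move: E; rewrite mulr0 addr0 => <-; rewrite addrK.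
apply: (flat_cst (F := fun s => ph_t (Gam s) + 2 * tau0 * s)).
  move=> r; apply: cvgD; last exact: mulrl_continuous.
  exact: (Gam_x_continuous hgamma (@ph_t_continuous R n G) (@set_zeta_t R n G)).
move=> r nb; have [c [v [ac dx h t0 v0]]] := Gam_ttau nb.
have := approxP_coord (@co_t_linear R n) (@co_t_continuous R n) h.
rewrite t0 (_ : (fun s0 => _) = ph_t (N := G) \o Gam); last first.
  by apply/funext => r' /=; rewrite co_t_lcrd.
rewrite (Gam_tau r 0) -/tau0 => H e e0; apply: filterS (H e e0) => r' /=.
by rewrite mul0r subr0 (_ : _ - _ - _ = ph_t (Gam r') + 2 * tau0 * r' - (ph_t (Gam r) + 2 * tau0 * r)) //; ring.
Qed.

(** Inverse of the affine function t along the curve, defined and continuous on the whole phase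
    space. It converts compactness into bounds on the parameter and keeps the pieces of nu apart. *)
Definition clock rho : R := (ph_t (Gam 0) - ph_t rho) / (2 * tau0).

Lemma clock_ph_t rho rho' : ph_t rho = ph_t rho' -> clock rho = clock rho'.
Proof. by rewrite /clock => ->. Qed.

Lemma clock_Gam s : clock (Gam s) = s.
Proof. by rewrite /clock (Gam_t s); field; exact: tau0_neq0. Qed.

Lemma clock_continuous : continuous clock.
Proof.
move=> rho; have ct := @ph_t_continuous R n G rho.
have FF := @nbhs_filter (phase G) rho.
have c1 : (ph_t (Gam 0) - ph_t r) @[r --> rho] --> ph_t (Gam 0) - ph_t rho.
  exact: (cvgB (cvg_cst _) ct).
exact: (cvgM c1 (cvg_cst _)).
Qed.

Lemma clock_set_zeta rho r : bTL rho -> clock (set_zeta rho r) = clock rho.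
Proof. by move=> bx; rewrite /clock set_zeta_t. Qed.

Lemma compact_clock (K : set (phase G)) : compact K ->
  exists k : nat, forall rho, K rho -> `|clock rho| <= k%:R.
Proof.
move=> cK; have [x Kx|M hM] := @compact_bounded R _ _ setT clock cK.
  exists (`|clock x| + 1).
  have := near_preimage (@clock_continuous x) (nbhsx_ballx _ 1 ltr01).
  by apply: filterS => y /ball_dist hy _; exact: dist_bound.
exists (Num.truncn `|M|).+1 => rho Kr; apply: (le_trans (hM rho Kr I)).
by apply: (le_trans (ler_norm M)); apply/ltW; exact: truncnS_gt.
Qed.

Lemma countable_B : countable B.
Proof. by apply: countable_isolated => s; exact: (B_isolated hgamma). Qed.

Lemma Gam_measurable (A : set R) : measurable (A : set (measurableTypeR R)) ->
  @measurable_fun _ _ (measurableTypeR R) (borel G) A Gam.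
Proof.
move=> mA; apply: (borel_off_countable countable_B mA) => s _; exact: (Gam_continuous hgamma).
Qed.

End Clock.

(** * The local balance *)

Lemma approx1_near (R : realType) (F F' : R -> R) (s l : R) :
  (\forall r \near s, F r = F' r) -> approx1 F s l -> approx1 F' s l.
Proof.
move=> E h e e0; near=> r.
rewrite -(nbhs_singleton E) -(_ : F r = F' r); last by near: r.
by near: r; exact: h.
Unshelve. all: by end_near. Qed.

Lemma approx1_cst (R : realType) (k s : R) : approx1 (fun=> k) s 0.
Proof.
move=> e e0; apply: filterE => r; rewrite subrr mul0r subr0 normr0.
by rewrite mulr_ge0 // ltW.
Qed.

Lemma approx1_half (R : realType) (F F' : R -> R) (s l l' : R) :
  approx1 F s l -> approx1 F' s l' -> approx1 (fun r => (F r - F' r) / 2) s ((l - l') / 2).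
Proof.
move=> h h' e e0; near=> r.
have H : `|F r - F s - l * (r - s)| <= e * `|r - s| by near: r; exact: h.
have H' : `|F' r - F' s - l' * (r - s)| <= e * `|r - s| by near: r; exact: h'.
rewrite (_ : _ - _ - _ = (F r - F s - l * (r - s)) / 2 - (F' r - F' s - l' * (r - s)) / 2); last by field.
apply: le_trans (ler_normB _ _) _; rewrite !normrM.
rewrite (gtr0_norm (_ : 0 < 2^-1)) ?invr_gt0 //; lra.
Unshelve. all: by end_near. Qed.

Section Local.
Context {R : realType} {n : nat} {G : geometry R n}.
Local Notation P := (pcoord R n).
Local Notation lam := (@lebesgue_measure R).
Local Notation oc c d := (`]c, d]%classic : set (measurableTypeR R)).
Local Notation bM := (boundary (@Mset R n G)).
Local Notation qn := (quasi_normal (@Mset R n G) (@metric R n G)).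
Local Notation HG := (@Hpar R n G `|` @Gpar R n G).
Implicit Types (c : chart R n G) (q : P) (rho : phase G) (x : G).
Variables (B : set R) (gamma : R -> phase G).
Hypothesis hgamma : gen_bichar [set: R] B gamma.
Hypothesis hnontriv : exists2 s, ~ B s & (ph_tau (gamma s), ph_xi (gamma s)) <> (0, 0).
Local Notation Gam := (Gam B gamma).
Local Notation clock := (clock B gamma).

Lemma Gam_near_dom c s : dom c (ph_x (Gam s)) -> \forall r \near s, dom c (ph_x (Gam r)).
Proof.
move=> dx; have xc := Gam_x_continuous hgamma (@ph_x_continuous R n G) (@set_zeta_x R n G) (x := s).
exact: (near_preimage xc (near_dom dx)).
Qed.

Lemma Gam_chart_near a c s l : atlas c -> dom c (ph_x (Gam s)) ->
  approx1 ((a \o ofcrd c) \o (lcrd c \o Gam)) s l -> approx1 (a \o Gam) s l.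
Proof.
move=> ac dx; apply: approx1_near; apply: filterS (Gam_near_dom dx) => r dr /=.
by congr a; exact: ofcrd_lcrd.
Qed.

Lemma free_approx a s : C1ph a -> ~ B s -> ~ Ggl (Gam s) ->
  approx1 (a \o Gam) s (Hp a (Gam s)).
Proof.
move=> ca nb ng; set c := pref_chart (ph_x (Gam s)).
have ac : atlas c := pref_chart_atlas _; have dx : dom c (ph_x (Gam s)) := pref_chart_dom _.
rewrite (Hp_chart ca ac dx (Gam_mdom hgamma s)).
apply: (Gam_chart_near ac dx); apply: approxP_comp; first exact: Gam_free.
by apply: C1pt_diff; apply: (C1ph_pt ca ac); exact: pcod_lcrd.
Qed.

Lemma Ggl_Hp2_z c s : Ggl (Gam s) -> qn c -> dom c (ph_x (Gam s)) ->
  Hp2_z c (lcrd c (Gam s)) < 0.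
Proof. by move=> [[bp _] h] qc dx; rewrite -(Hp2z_chart qc dx bp). Qed.

Lemma Ggl_HamG c s : Ggl (Gam s) -> qn c -> dom c (ph_x (Gam s)) ->
  HamG c (lcrd c (Gam s)) = Ham (psy c) (lcrd c (Gam s)) +
    (- Hp2_z c (lcrd c (Gam s)) / 2) *: e_zeta.
Proof.
move=> [[[bx _] _] _] qc dx; rewrite (HamGE (qn_atlas qc) (good_lcrd dx (Gam_mdom hgamma s))).
have -> : ginv c (co_x (lcrd c (Gam s))) ord_max ord_max = 1.
  rewrite co_x_lcrd; have He := ginv_qn qc dx bx.
  by have := congr1 (fun M : 'cV[R]_n.+1 => M ord_max 0) He; rewrite -colE !mxE !eqxx.
by rewrite mulr1 scalerN -scaleNr mulNr.
Qed.

(** The correction in [HamG] is a multiple of [e_zeta], and by [jump_Gpar] the derivative of [a]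
    along [e_zeta] is its jump at a glancing point. *)
Lemma glide_approx a c s : C1ph a -> ~ B s -> Ggl (Gam s) -> qn c -> dom c (ph_x (Gam s)) ->
  approx1 (a \o Gam) s (Hp a (Gam s) + (- Hp2_z c (lcrd c (Gam s)) / 2) * jump a (Gam s)).
Proof.
move=> ca nb gg qc dx; have ac := qn_atlas qc; have cq := pcod_lcrd dx.
have dq := C1pt_diff (C1ph_pt ca ac cq).
rewrite (Hp_chart ca ac dx (Gam_mdom hgamma s)) (jump_Gpar ca qc dx gg.1).
apply: (Gam_chart_near ac dx).
have := approxP_comp (Gam_gliding hgamma nb gg qc dx) dq.
by rewrite /= (Ggl_HamG gg qc dx) linearD linearZ.
Qed.

Lemma Hp_z_free c s : atlas c -> ~ B s -> ~ Ggl (Gam s) -> dom c (ph_x (Gam s)) ->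
  approx1 (fun r => Hp_z c (lcrd c (Gam r))) s (Hp2_z c (lcrd c (Gam s))).
Proof.
move=> ac nb ng dx; have gq := good_lcrd dx (Gam_mdom hgamma s).
exact: (approxP_comp (Gam_free hgamma nb ng ac dx) (C1pt_diff (Hp_z_C1 ac gq))).
Qed.

Lemma Hp_z_glide c s : qn c -> ~ B s -> Ggl (Gam s) -> dom c (ph_x (Gam s)) ->
  approx1 (fun r => Hp_z c (lcrd c (Gam r))) s 0.
Proof.
move=> qc nb gg dx; have ac := qn_atlas qc; have gq := good_lcrd dx (Gam_mdom hgamma s).
have := approxP_comp (Gam_gliding hgamma nb gg qc dx) (C1pt_diff (Hp_z_C1 ac gq)).
by rewrite /= (diff_Hp_z_HamG ac gq).
Qed.

Definition HG_clock (a b : R) : set (borel G) := [set rho | HG rho /\ a <= clock rho <= b].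

(** Demanding that [nu] be carried by the clocks in [[a, b]] is what makes the pieces locally finite
    once they are summed. *)
Definition balanced (a b : R) := exists nu : {measure set (borel G) -> \bar R},
  [/\ (nu setT < +oo)%E, nu (~` HG_clock a b) = 0%E &
    forall f, C1c f -> f (Gam b) - f (Gam a) =
      \int[lam]_(r in oc a b) Hp f (Gam r) + \int[nu]_(rho in HG) jump f rho].

Lemma closed_HG_clock a b : closed (HG_clock a b : set (phase G)).
Proof.
apply: closedI; first exact: closed_HG.
have E : clock @^-1` `[a, b]%classic = (fun rho : phase G => a <= clock rho <= b).
  by apply/seteqP; split=> r /=; rewrite in_itv.
apply: (eq_ind _ closed _ _ E).
apply: closed_comp; last exact: itv_closed.
by move=> r _; exact: clock_continuous.
Qed.

Lemma measurable_HG_clock a b : measurable (HG_clock a b).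
Proof. by apply: borel_closed; exact: closed_HG_clock. Qed.

Lemma measurable_HG : measurable (HG : set (borel G)).
Proof. by apply: borel_closed; exact: closed_HG. Qed.

Lemma Hp_Gam_continuous f s : C1ph f -> ~ B s -> {for s, continuous (Hp f \o Gam)}.
Proof.
move=> cf nb; exact: (cvg_for (Gam_continuous hgamma nb) (Hp_continuous cf (Gam_mdom hgamma s))).
Qed.

Lemma Hp_Gam_measurable f a b : C1ph f -> measurable_fun (oc a b) (Hp f \o Gam).
Proof.
move=> cf; apply: (measurable_off_countable (countable_B hgamma)); first exact: measurable_itv.
by move=> s _; exact: Hp_Gam_continuous.
Qed.

(** Reflections and gliding both take place at the boundary, so here the motion is free and [nu] is
    zero. *)
Lemma interior_balanced a b : a <= b -> (forall s, a <= s <= b -> ~ bTL (Gam s)) -> balanced a b.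
Proof.
move=> ab ni; exists mzero; split=> [||f cf]; [by rewrite /mzero ltry|by []|].
have [M hM] := Hp_bounded cf.
have D : balance_data mzero a b (Num.max M 0) set0 (fun=> 0) (Hp f \o Gam) (fun=> 0).
  split=> //.
  - by move=> c d _ _ _; rewrite setI0 subrr.
  - by move=> r _; rewrite normr0 le_max lexx orbT.
  - by apply: Hp_Gam_measurable; exact: cf.1.
  - by move=> r _; rewrite le_max hM //; exact: Gam_TLhat.
have := balance (f := f \o Gam) D; rewrite setI0 Rintegral_set0 => -> //.
  by rewrite [X in _ = _ + X](_ : _ = 0) // /Rintegral integral_measure_zero.
move=> s sab; left; have nbs := ni s sab.
have nb : ~ B s by move=> /(Gam_B_bTL hgamma).
exists (Hp f (Gam s)), 0; split.
- by apply: free_approx => //; [exact: cf.1|move=> [[[]]]].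
- exact: approx1_cst.
- move=> e e0; have := near_preimage (Hp_Gam_continuous cf.1 nb) (nbhsx_ballx _ e e0).
  by apply: filterS => r /ball_dist.
- by rewrite mul0r addr0.
- by left.
Qed.

End Local.

Lemma approx1_cont (R : realType) (F : R -> R) (s l : R) : approx1 F s l ->
  forall e : R, 0 < e -> \forall r \near s, `|F r - F s| <= e.
Proof.
move=> h e e0; have K0 : 0 < `|l| + 1 by have := normr_ge0 l; lra.
have d0 : 0 < e / (`|l| + 1) by rewrite divr_gt0.
have n2 : \forall r \near s, `|s - r| < e / (`|l| + 1) by apply: (ball_near d0).
near=> r.
have H : `|F r - F s - l * (r - s)| <= 1 * `|r - s| by near: r; exact: h.
have H2 : `|r - s| < e / (`|l| + 1) by rewrite distrC; near: r.
have := ler_normD (F r - F s - l * (r - s)) (l * (r - s)); rewrite subrK => H3.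
apply: le_trans H3 _; rewrite normrM.
move: H2; rewrite ltr_pdivlMr // => H2; move: H; rewrite mul1r => H.
by apply: (le_trans (lerD H (lexx _))); rewrite -{1}[`|r - s|]mul1r -mulrDl addrC mulrC ltW.
Unshelve. all: by end_near. Qed.

Lemma approx1_slope (R : realType) (F : R -> R) (s l : R) (A : set R) : approx1 F s l -> 0 <= l ->
  slope_ge0 A F s.
Proof.
move=> h l0 e e0; apply: filterS (h e e0) => r H _; split=> rs.
- have lr : l * (r - s) <= 0 by rewrite mulr_ge0_le0 // subr_le0.
  move: H; rewrite [`|r - s|]distrC ler_norml (ger0_norm (_ : 0 <= s - r)) ?subr_ge0 // => /andP[_]; lra.
- have lr : 0 <= l * (r - s) by rewrite mulr_ge0 // subr_ge0.
  move: H; rewrite ler_norml (ger0_norm (_ : 0 <= r - s)) ?subr_ge0 // => /andP[+ _]; lra.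
Qed.

(** * The balance in a quasi-normal chart *)

Section Boundary.
Context {R : realType} {n : nat} {G : geometry R n}.
Local Notation P := (pcoord R n).
Local Notation lam := (@lebesgue_measure R).
Local Notation oc c d := (`]c, d]%classic : set (measurableTypeR R)).
Local Notation bM := (boundary (@Mset R n G)).
Local Notation qn := (quasi_normal (@Mset R n G) (@metric R n G)).
Local Notation HG := (@Hpar R n G `|` @Gpar R n G).
Implicit Types (q : P) (rho : phase G) (x : G).
Lemma Sigma_Sigma rho : bTL rho -> Sigma (Sigma rho) = rho.
Proof.
move=> bx; have E : - zeta (Sigma rho) = zeta rho.
  by apply: (etrans (congr1 -%R (zeta_set_zeta (- zeta rho) bx))); rewrite opprK.
apply: (etrans (congr1 (set_zeta (Sigma rho)) E)).
exact: (etrans (set_zeta_set_zeta _ _ bx) (set_zeta_id bx erefl)).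
Qed.

Variables (B : set R) (gamma : R -> phase G).
Hypothesis hgamma : gen_bichar [set: R] B gamma.
Local Notation Gam := (Gam B gamma).

Lemma Hp_z_continuous c rho : atlas c -> dom c (ph_x rho) -> mdom (ph_x rho) ->
  {for rho, continuous (Hp_z c \o lcrd c)}.
Proof.
move=> ac dx mx.
exact: (cvg_for (lcrd_continuous ac dx) (differentiable_continuous (C1pt_diff (Hp_z_C1 ac (good_lcrd dx mx))))).
Qed.

Lemma Hp2_z_continuous c rho : atlas c -> dom c (ph_x rho) -> mdom (ph_x rho) ->
  {for rho, continuous (Hp2_z c \o lcrd c)}.
Proof.
move=> ac dx mx; have L := lcrd_continuous ac dx; have gq := good_lcrd dx mx.
have HL : (fun r => Ham (psy c) (lcrd c r)) @ rho --> Ham (psy c) (lcrd c rho).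
  exact: (@Ham_cvg R n _ (nbhs rho) _ _ _ _ (psy_C1 ac gq) L).
exact: (@cvg_diff R n _ (nbhs rho) _ _ _ _ _ _ (Hp_z_C1 ac gq) L HL).
Qed.

Lemma near_bound (T : topologicalType) (g : T -> R) (x : T) : {for x, continuous g} ->
  \forall y \near x, `|g y| <= `|g x| + 1.
Proof.
move=> cg; have := near_preimage cg (nbhsx_ballx _ 1 ltr01).
by apply: filterS => y /ball_dist hy; exact: dist_bound.
Qed.

(** Continuity is required on whole fibres, because the left limit at a reflection is another point
    over the same x. *)
Lemma Gam_bounded (g : phase G -> R) a b :
  (forall s rho, a <= s <= b -> ph_x rho = ph_x (Gam s) -> {for rho, continuous g}) ->
  exists M, forall s, a <= s <= b -> `|g (Gam s)| <= M.
Proof.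
move=> cg; have [s sab|M hM] := @compact_bounded R _ _ setT (g \o Gam) (@segment_compact R a b).
  have {}sab : a <= s <= b by move: sab; rewrite /= in_itv.
  have [bs|nb] := pselect (B s); last first.
    exists (`|g (Gam s)| + 1); have := near_bound (cvg_for (Gam_continuous hgamma nb) (cg s _ sab erefl)).
    exact: filterS.
  have [_ _ [l [[bl _] cl GE]]] := GamB hgamma bs.
  have lx : ph_x l = ph_x (Gam s) by rewrite GE set_zeta_x.
  have h1 := Gam_right hgamma bs (near_bound (cg s (Gam s) sab erefl)).
  have h2 := Gam_left hgamma bs cl (near_bound (cg s l sab lx)).
  exists (Num.max (`|g (Gam s)| + 1) (`|g l| + 1)).
  near=> r => _; rewrite le_max; case: (ltgtP r s) => [rs|sr|->].
  - by apply/orP; right; move: rs; near: r.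
  - by apply/orP; left; move: sr; near: r.
  - by rewrite lerDl ler01.
by exists M => s sab; apply: hM => //=; rewrite in_itv.
Unshelve. all: by end_near. Qed.

Lemma closed_Z : closed [set s | bTL (Gam s)].
Proof.
have -> : [set s | bTL (Gam s)] = (@ph_x R n G \o Gam) @^-1` bM by [].
apply: closed_comp; last first.
  apply: closedI; last by apply: open_closedC; exact: open_interior.
  by apply: compact_closed; [exact: mhausdorff|exact: M_compact].
move=> s _; exact: (Gam_x_continuous hgamma (@ph_x_continuous R n G) (@set_zeta_x R n G)).
Qed.

Hypothesis hnontriv : exists2 s, ~ B s & (ph_tau (gamma s), ph_xi (gamma s)) <> (0, 0).
Variables (a0 a b b0 : R) (c : chart R n G).
Hypotheses (a0a : a0 < a) (ab : a <= b) (bb0 : b < b0) (qc : qn c).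
Hypothesis hdom : forall s, a0 <= s <= b0 -> dom c (ph_x (Gam s)).

Let ac : atlas c := qn_atlas qc.
Let w s := Hp_z c (lcrd c (Gam s)).
Let h2 s := Hp2_z c (lcrd c (Gam s)).
Let I s := \int[lam]_(r in oc a0 s) h2 r.
(* The function N of the header, with base point a0 < a: it is differentiable up to a and b. *)
Let N s := (w s - I s) / 2.
Let Z : set (measurableTypeR R) := [set s | bTL (Gam s)].

Let h2_cont s : a0 <= s <= b0 -> ~ B s -> {for s, continuous h2}.
Proof.
move=> hs nb; exact: (cvg_for (Gam_continuous hgamma nb) (Hp2_z_continuous ac (hdom hs) (Gam_mdom hgamma s))).
Qed.

Let h2_bound : exists M, forall s, a0 <= s <= b0 -> `|h2 s| <= M.
Proof.
apply: (Gam_bounded (g := Hp2_z c \o lcrd c)) => s rho hs E.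
apply: Hp2_z_continuous => //; first by rewrite E; exact: hdom.
by rewrite E; exact: Gam_mdom.
Qed.

Let h2_meas : measurable_fun (oc a0 b0) h2.
Proof.
apply: (measurable_off_countable (countable_B hgamma)); first exact: measurable_itv.
by move=> s; rewrite /= in_itv /= => /andP[/ltW h1 h3] nb; apply: h2_cont => //; rewrite h1.
Qed.

Let a0b0 : a0 <= b0.
Proof. exact: ltW (lt_trans (lt_le_trans a0a ab) bb0). Qed.

Let inside s : a <= s -> s <= b -> a0 < s < b0.
Proof. by move=> h1 h3; rewrite (lt_le_trans a0a h1) (le_lt_trans h3 bb0). Qed.

Let I_approx s : a0 < s < b0 -> ~ B s -> approx1 I s (h2 s).
Proof.
move=> /andP[h1 h3] nb; have [M hM] := h2_bound.
apply: (@primitive_approx R a0 b0 M h2 s h1 h3 h2_meas).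
  by move=> r; rewrite /= in_itv /= => /andP[/ltW r1 r2]; apply: hM; rewrite r1.
by apply: h2_cont => //; rewrite !ltW.
Qed.

Let I_cont s : a0 < s < b0 -> forall e : R, 0 < e -> \forall r \near s, `|I r - I s| <= e.
Proof.
move=> /andP[h1 h3] e e0; have [M hM] := h2_bound.
have K0 : 0 < `|M| + 1 by have := normr_ge0 M; lra.
have d0 : 0 < Num.min (e / (`|M| + 1)) (Num.min (s - a0) (b0 - s)).
  by rewrite !lt_min divr_gt0 // !subr_gt0 h1.
apply: (ball_near d0) => r; rewrite !lt_min => /and3P[r1 r2 r3].
have ra : a0 <= r by have := ler_norm (s - r); lra.
have rb : r <= b0 by have := ler_norm (r - s); rewrite distrC; lra.
have hC r' : oc a0 b0 r' -> `|h2 r'| <= M.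
  by rewrite /= in_itv /= => /andP[/ltW k1 k2]; apply: hM; rewrite k1.
have s1 : a0 <= s <= b0 by rewrite !ltW.
have r4 : a0 <= r <= b0 by rewrite ra.
apply: le_trans (primitive_lip a0b0 h2_meas hC s1 r4) _.
move: r1; rewrite ltr_pdivlMr // distrC => r1; apply: le_trans (ltW r1).
by rewrite mulrC; apply: ler_wpM2l => //; have := ler_norm M; lra.
Qed.

Let N_free s : a0 < s < b0 -> ~ B s -> ~ Ggl (Gam s) -> approx1 N s 0.
Proof.
move=> hs nb ng; have dx : dom c (ph_x (Gam s)) by apply: hdom; case/andP: hs => *; rewrite !ltW.
have := approx1_half (Hp_z_free hgamma ac nb ng dx) (I_approx hs nb).
by rewrite subrr mul0r.
Qed.

Let N_glide s : a0 < s < b0 -> ~ B s -> Ggl (Gam s) -> approx1 N s (- h2 s / 2).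
Proof.
move=> hs nb gg; have dx : dom c (ph_x (Gam s)) by apply: hdom; case/andP: hs => *; rewrite !ltW.
have := approx1_half (Hp_z_glide hgamma qc nb gg dx) (I_approx hs nb).
by rewrite sub0r.
Qed.

Let half_diff (u u' v v' e : R) : `|u - u'| <= e -> `|v - v'| <= e ->
  `|(u - v) / 2 - (u' - v') / 2| <= e.
Proof.
move=> h1 h3; rewrite -mulrBl normrM (gtr0_norm (_ : 0 < 2^-1)) ?invr_gt0 //.
rewrite ler_pdivrMr // (_ : u - v - (u' - v') = (u - u') - (v - v')); last by ring.
by apply: le_trans (ler_normB _ _) _; lra.
Qed.

Let N_right S : a0 < S < b0 -> B S -> forall e : R, 0 < e ->
  \forall r \near S, S < r -> `|N r - N S| <= e.
Proof.
move=> hS bS e e0.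
have dx : dom c (ph_x (Gam S)) by apply: hdom; case/andP: hS => *; rewrite !ltW.
have cw := Hp_z_continuous ac dx (Gam_mdom hgamma S).
have h1 := Gam_right hgamma bS (near_preimage cw (nbhsx_ballx _ e e0)).
have h3 := I_cont hS e0.
near=> r => Sr; apply: half_diff; last by near: r.
by apply: ball_dist; move: Sr; near: r.
Unshelve. all: by end_near. Qed.

(** On the boundary [w] equals 2 zeta. The reflection reverses zeta, so [w] jumps by 4 zeta while
    the integral [I] is continuous; half of this remains. *)
Let N_left S l : a0 < S < b0 -> B S -> gamma @ S^'- --> l -> Hbminus l -> Gam S = Sigma l ->
  N S - (Hp_z c (lcrd c l) - I S) / 2 = 2 * zeta (Gam S) /\
  forall e : R, 0 < e -> \forall r \near S, r < S -> `|N r - (Hp_z c (lcrd c l) - I S) / 2| <= e.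
Proof.
move=> hS bS cl [bl _] GE.
have dx : dom c (ph_x (Gam S)) by apply: hdom; case/andP: hS => *; rewrite !ltW.
have lx : ph_x l = ph_x (Gam S) by rewrite GE set_zeta_x.
have dl : dom c (ph_x l) by rewrite lx.
have bS' := Gam_B_bTL hgamma bS.
have wE rho : dom c (ph_x rho) -> bTL rho -> Hp_z c (lcrd c rho) = 2 * zeta rho.
  move=> dr br; rewrite (Hp_z_qn qc (pcod_lcrd dr)); last by rewrite co_x_lcrd phiK.
  by rewrite (zeta_qn qc dr br).
split.
  rewrite /N /w !wE // (_ : zeta l = - zeta (Gam S)); first by field.
  by rewrite GE /Sigma zeta_set_zeta // opprK.
move=> e e0; have ml : mdom (ph_x l) by rewrite lx; exact: Gam_mdom.
have cw := Hp_z_continuous ac dl ml.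
have h1 := Gam_left hgamma bS cl (near_preimage cw (nbhsx_ballx _ e e0)).
have h3 := I_cont hS e0.
near=> r => rS; apply: half_diff; last by near: r.
by apply: ball_dist; move: rS; near: r.
Unshelve. all: by end_near. Qed.

Let h2_neg s : a0 < s < b0 -> Ggl (Gam s) -> h2 s < 0.
Proof.
move=> hs gg; apply: Ggl_Hp2_z => //; by apply: hdom; case/andP: hs => *; rewrite !ltW.
Qed.

Let N_slope_D A s : a0 < s < b0 -> ~ B s -> slope_ge0 A N s.
Proof.
move=> hs nb; have [gg|ng] := pselect (Ggl (Gam s)).
  apply: (approx1_slope _ (N_glide hs nb gg)); have := h2_neg hs gg; lra.
exact: (approx1_slope _ (N_free hs nb ng)).
Qed.

Let N_slope u v s : a <= u -> v <= b -> u <= s <= v -> slope_ge0 `[u, v] N s.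
Proof.
move=> au vb /andP[us sv].
have hs : a0 < s < b0 := inside (le_trans au us) (le_trans sv vb).
have [bs|nb] := pselect (B s); last exact: N_slope_D.
have [d d0 hd] := B_isolated hgamma bs.
have [Hs _ [l [hl cl GE]]] := GamB hgamma bs.
have [E Lf] := N_left hs bs cl hl GE.
apply: (slope_ge0_isolated (d := d)) => //; first by rewrite us.
  move=> r /andP[ur rv] rd; apply: N_slope_D; last exact: hd.
  exact: (inside (le_trans au ur) (le_trans rv vb)).
move=> e e0; have zp : 0 < zeta (Gam s) by have [_ []] := Hs.
near=> r => _; split=> rs.
- have : `|N r - (Hp_z c (lcrd c l) - I s) / 2| <= e by move: rs; near: r; exact: Lf.
  by rewrite ler_norml => /andP[_]; lra.
- have : `|N r - N s| <= e by move: rs; near: r; exact: N_right.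
  by rewrite ler_norml => /andP[]; lra.
Unshelve. all: by end_near. Qed.

Let N_nd u v : a <= u -> u <= v -> v <= b -> N u <= N v.
Proof.
by move=> au uv vb; apply: (slope_ge0_le uv) => s suv; exact: N_slope.
Qed.

Let N_rc s : a <= s -> s < b -> forall e : R, 0 < e ->
  \forall r \near s, s < r -> `|N r - N s| <= e.
Proof.
move=> as_ sb e e0; have hs := inside as_ (ltW sb).
have [bs|nb] := pselect (B s); first exact: N_right.
have [gg|ng] := pselect (Ggl (Gam s)).
  by apply: filterS (approx1_cont (N_glide hs nb gg) e0).
by apply: filterS (approx1_cont (N_free hs nb ng) e0).
Qed.

(** The curve meets the boundary in a closed set of parameters, so it is free on an interval around
    [s], where [N] has zero derivative. *)
Let N_cst s : a < s -> s <= b -> ~ Z s -> \forall r \near s, a <= r <= b -> N r = N s.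
Proof.
move=> as_ sb nZ.
have /near_ball[d d0 hd] : nbhs s (~` [set s | bTL (Gam s)]).
  by apply: open_nbhs_nbhs; split=> //; apply: closed_openC; exact: closed_Z.
have fl u v r : s - d < u -> v < s + d -> a <= u -> v <= b -> u <= r <= v -> flat `[u, v] N r.
  move=> su vs au vb /andP[ur rv].
  have nz : ~ bTL (Gam r) by apply: hd; rewrite ltr_norml; apply/andP; split; lra.
  have hr := inside (le_trans au ur) (le_trans rv vb).
  have ap : approx1 N r 0.
    by apply: N_free => //; [move=> /(Gam_B_bTL hgamma)|move=> [[[]]]].
  by move=> e e0; apply: filterS (ap e e0) => r'; rewrite mul0r subr0.
apply: (ball_near d0) => r; rewrite ltr_norml => /andP[r1 r2] /andP[ar rb].
case: (leP r s) => [rs|/ltW sr].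
  by apply: (flat_eq rs) => r' hr'; left; apply: fl => //; lra.
by apply: esym; apply: (flat_eq sr) => r' hr'; left; apply: fl => //; lra.
Qed.

Let mZ : measurable Z.
Proof. by apply: closed_measurable; exact: closed_Z. Qed.

Let mE : measurable (oc a b `&` Z).
Proof. by apply: measurableI => //; exact: measurable_itv. Qed.

Let sG s := par_proj (Gam s).

Let sG_meas : @measurable_fun _ _ (measurableTypeR R) (borel G) (oc a b `&` Z) sG.
Proof.
apply: (@measurable_comp _ _ _ (measurableTypeR R) (borel G) (borel G) (@bTL R n G) (@par_proj R n G) _ Gam).
- by apply: borel_closed; exact: closed_bTL.
- by move=> _ [s [_ zs] <-].
- exact: par_proj_measurable.
- exact: (Gam_measurable hgamma).
Qed.

Let sG_HG s : Z s -> HG (sG s).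
Proof. by move=> zs; apply: par_proj_HG => //; have [] := Gam_in hgamma s. Qed.

(** At a gliding point the projection fixes [Gam s], so continuity of [Gam], of the projection and
    of the jump combine. No such continuity is required where [N] has zero slope. *)
Let j_cont f s : C1ph f -> a0 < s < b0 -> ~ B s -> Ggl (Gam s) -> forall e : R, 0 < e ->
  \forall r \near s, (oc a b `&` Z) r -> `|jump f (sG r) - jump f (sG s)| <= e.
Proof.
move=> cf hs nb gg e e0; have [[bx _] _] := gg.1.
have E : sG s = Gam s by rewrite /sG par_proj_Gpar //; exact: gg.1.
have n1 := jump_continuous cf (or_intror gg.1 : HG (Gam s)) e0.
have n2 : nbhs (par_proj (Gam s)) (fun rho => HG rho -> `|jump f rho - jump f (Gam s)| <= e).
  by rewrite -/(sG s) E.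
have n3 := near_preimage (Gam_continuous hgamma nb) (par_proj_near bx n2).
by apply: filterS n3 => r h [_ zr]; rewrite E; apply: h => //; exact: sG_HG.
Qed.

(** The Stieltjes measure lives on the parameter line, [nu] on the phase space. [sG] carries one to
    the other, and the identity for [f] is [balance] after this change of variables. *)
Lemma boundary_balanced : balanced B gamma a b.
Proof.
have [m [mfin m0] mN] := @stieltjes_measure_exists R N a b Z ab mZ N_nd N_rc N_cst.
have [nu [nfin n0 nI]] := pushforward_exists mE mfin m0 sG_meas.
exists nu; split=> //.
  apply: n0; first exact: measurable_HG_clock.
  move=> s [/= +  zs]; rewrite in_itv /= => /andP[/ltW h1 h3]; split; first exact: sG_HG.
  by rewrite /sG /par_proj clock_set_zeta // clock_Gam // h1.
move=> f cf; have [M hM] := Hp_bounded cf; have [M' hM'] := jump_bounded cf.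
pose j s := jump f (sG s).
have mj : measurable_fun (oc a b `&` Z) j.
  apply: (@measurable_comp _ _ _ (measurableTypeR R) (borel G) _ HG (jump f) _ sG).
  - exact: measurable_HG.
  - by move=> _ [s [_ zs] <-]; exact: sG_HG.
  - apply: jump_measurable; exact: cf.1.
  - exact: sG_meas.
have D : balance_data m a b (Num.max M M') Z j (Hp f \o Gam) N.
  split=> //.
  - by move=> r [_ zr]; rewrite le_max hM' ?orbT //; exact: sG_HG.
  - by apply: (Hp_Gam_measurable hgamma); exact: cf.1.
  - by move=> r _; rewrite le_max hM //; exact: Gam_TLhat.
rewrite (nI HG (jump f) M') //; last 3 first.
- exact: measurable_HG.
- by move=> s [_ zs]; exact: sG_HG.
- apply: jump_measurable; exact: cf.1.
have reg s : a <= s <= b -> ~ B s -> balance_regular a b Z j (Hp f \o Gam) (f \o Gam) N s.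
  move=> /andP[as_ sb] nb; have hs := inside as_ sb.
  have dx : dom c (ph_x (Gam s)) by apply: hdom; case/andP: hs => *; rewrite !ltW.
  have hc e : 0 < e -> \forall r \near s, `|(Hp f \o Gam) r - (Hp f \o Gam) s| <= e.
    move=> e0; have := near_preimage (Hp_Gam_continuous hgamma cf.1 nb) (nbhsx_ballx _ e e0).
    by apply: filterS => r /ball_dist.
  have [gg|ng] := pselect (Ggl (Gam s)); last first.
    exists (Hp f (Gam s)), 0; split=> //; first exact: (free_approx hgamma cf.1 nb ng).
    - exact: N_free.
    - by rewrite mul0r addr0.
    - by left.
  exists (Hp f (Gam s) + (- h2 s / 2) * jump f (Gam s)), (- h2 s / 2); split=> //.
  - exact: (glide_approx hgamma cf.1 nb gg qc dx).
  - exact: N_glide.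
  - by rewrite /j /sG par_proj_Gpar //; exact: gg.1.
  - by right; apply: j_cont => //; exact: cf.1.
have cfc := C1ph_continuous cf.1.
apply: (balance (f := f \o Gam) D) => s sab; have [bs|nb] := pselect (B s); last by left; exact: reg.
right; case/andP: (sab) => as_ sb; have hs := inside as_ sb.
have [Hs _ [l [hl cl GE]]] := GamB hgamma bs.
have [E Lf] := N_left hs bs cl hl GE.
have [d d0 hd] := Gam_near hgamma bs.
have bl : bTL l by case: hl.
exists d, (f l), ((Hp_z c (lcrd c l) - I s) / 2); split.
- by split => //; exact: Gam_B_bTL.
- move=> r rab rd; have [nr _ nbr] := hd r rd; split; last exact: reg.
  by rewrite /Z /= (GamD _ nr).
- move=> e e0; have n1 := Gam_left hgamma bs cl (near_preimage (cfc l) (nbhsx_ballx _ e e0)).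
  have n2 := Lf e e0; near=> r => rs; split; last by move: rs; near: r.
  by apply: ball_dist; move: rs; near: r.
- move=> e e0; have n1 := Gam_right hgamma bs (near_preimage (cfc (Gam s)) (nbhsx_ballx _ e e0)).
  by apply: filterS n1 => r h /h; exact: ball_dist.
(* The mass 2 zeta of the atom is the factor in [jump_par_proj], and [l] is [Sigma (Gam s)] because
   [Sigma] is an involution. *)
- rewrite E /j -(jump_par_proj f Hs) /=; congr (_ - f _).
  by rewrite GE; exact: (esym (Sigma_Sigma bl)).
Unshelve. all: by end_near. Qed.

End Boundary.

(** * Globalization *)

Section MeasureSums.
Context {R : realType}.
Local Notation lam := (@lebesgue_measure R).
Local Notation oc c d := (`]c, d]%classic : set (measurableTypeR R)).

Lemma eseries_finite (u : nat -> \bar R) (m : nat) : (forall k, (m <= k)%N -> u k = 0%E) ->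
  (\sum_(k <oo) u k = \sum_(0 <= k < m) u k)%E.
Proof.
move=> u0; apply: lim_near_cst => //; exists m => // k /= mk.
rewrite (big_cat_nat (n := m)) //= [X in (_ + X)%E]big1_seq ?adde0 //.
by move=> i /andP[_]; rewrite mem_index_iota => /andP[mi _]; exact: u0.
Qed.

Lemma Rintegral_measure_add d (T : measurableType d) (m1 m2 : {measure set T -> \bar R})
    (H : set T) (g : T -> R) : measurable H -> m1.-integrable H (EFin \o g) ->
  m2.-integrable H (EFin \o g) ->
  \int[measure_add m1 m2]_(x in H) g x = \int[m1]_(x in H) g x + \int[m2]_(x in H) g x.
Proof.
move=> mH i1 i2; rewrite /Rintegral (integral_measure_add mH i1 i2).
by rewrite fineD //; exact: integrable_fin_num.
Qed.

(** The vanishing hypothesis concerns every [h] that vanishes with [g]: it thus covers the positive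
    part, the negative part and the absolute value of [g], and all the series involved are finite
    sums. *)
Lemma mseries_integral d (T : measurableType d) (nu : {measure set T -> \bar R}^nat)
    (H : set T) (g : T -> R) (m : nat) : measurable H ->
  (forall k, (nu k).-integrable H (EFin \o g)) ->
  (forall k (h : T -> \bar R), (m <= k)%N -> (nu k).-integrable H h ->
     (forall x, g x = 0 -> h x = 0%E) -> (\int[nu k]_(x in H) h x = 0)%E) ->
  (mseries nu 0).-integrable H (EFin \o g) /\
  (\int[mseries nu 0]_(x in H) (g x)%:E = (\sum_(0 <= k < m) \int[nu k]_(x in H) g x)%:E)%E.
Proof.
move=> mH ig z; have mg : measurable_fun H (EFin \o g) := measurable_int (nu 0) (ig 0).
have sub (h : nat -> T -> \bar R) : (forall k, (nu k).-integrable H (h k)) ->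
    (forall k x, g x = 0 -> h k x = 0%E) ->
    (\sum_(k <oo) `|\int[nu k]_(x in H) h k x| < +oo)%E.
  move=> ih h0; rewrite (eseries_finite (m := m)); last first.
    by move=> k mk; rewrite z ?abse0 //; exact: h0.
  apply/lte_sum_pinfty => k _; rewrite -ge0_fin_numE // abse_fin_num.
  exact: integrable_fin_num.
have E : (\int[mseries nu 0]_(x in H) (g x)%:E = \sum_(k <oo) \int[nu k]_(x in H) (g x)%:E)%E.
  apply: integral_measure_series => //.
  - apply: (sub (fun _ => (EFin \o g)^\-%E)) => [k|k x gx]; first exact: integrable_funeneg.
    by rewrite funenegE /= gx oppr0 maxxx.
  - apply: (sub (fun _ => (EFin \o g)^\+%E)) => [k|k x gx]; first exact: integrable_funepos.
    by rewrite funeposE /= gx maxxx.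
split.
  apply/integrableP; split=> //.
  rewrite ge0_integral_measure_series //; last by apply: measurableT_comp.
  have := sub (fun _ x => `|(g x)%:E|%E).
  under eq_eseriesr do rewrite gee0_abs ?integral_ge0 //.
  apply=> [k|k x /= ->]; last by rewrite normr0.
  exact: integrable_abse.
rewrite E (eseries_finite (m := m)); last by move=> k mk; rewrite z // => x ->.
rewrite -sumEFin; apply: eq_bigr => k _; rewrite /Rintegral fineK //.
exact: integrable_fin_num.
Qed.

Lemma pushforward_integral d d' (T : measurableType d) (U : measurableType d')
  (m : {measure set T -> \bar R}) (phi : T -> U) (D : set U) (g : U -> R) :
  measurable_fun setT phi -> measurable D -> measurable_fun D g -> (forall x, D (phi x)) ->
  m.-integrable setT (EFin \o (g \o phi)) ->
  (pushforward m phi).-integrable D (EFin \o g) /\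
  (\int[pushforward m phi]_(y in D) (g y)%:E = \int[m]_x (g (phi x))%:E)%E.
Proof.
move=> mphi mD mg hD ig.
pose gD : U -> R := g \_ D.
have gDE x : D x -> gD x = g x by move=> Dx; rewrite /gD patchE mem_set.
have mgD : measurable_fun setT gD by exact: ((measurable_restrictT _ _).1 _).
pose F : U -> \bar R := EFin \o gD.
have mF : measurable_fun setT F by exact/measurable_EFinP.
have DT : phi @^-1` D = setT by apply/seteqP; split=> x // _; exact: hD.
have FE : F \o phi = EFin \o (g \o phi) by apply/funext => x /=; rewrite /F /= gDE.
have iF : m.-integrable (phi @^-1` D) (F \o phi) by rewrite DT FE.
split.
  have := integrable_pushforward mphi mF iF mD; apply: eq_integrable => //.
  by move=> y; rewrite inE => Dy; rewrite /F /= gDE.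
transitivity (\int[pushforward m phi]_(y in D) F y)%E.
  by apply: eq_integral => // y; rewrite inE => Dy; rewrite /F /= gDE.
by rewrite (integral_pushforward mphi mF iF mD) DT FE.
Qed.

(** The half-open interval is enlarged by 1 so as to contain the end point [- k]. *)
Lemma lam_bounded_supp (h : R -> R) (M k : R) : 0 <= k ->
  measurable_fun (setT : set (measurableTypeR R)) h -> (forall s, `|h s| <= M) ->
  (forall s, k < `|s| -> h s = 0) ->
  [/\ lam.-integrable setT (EFin \o h), lam.-integrable (oc (- (k + 1)) (k + 1)) (EFin \o h) &
   (\int[lam]_s (h s)%:E = (\int[lam]_(s in oc (- (k + 1)) (k + 1)) h s)%:E)%E].
Proof.
move=> k0 mh hM h0; set I := oc _ _.
have mI : measurable I by exact: measurable_itv.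
have iI : lam.-integrable I (EFin \o h).
  apply: (@bounded_integrable _ _ _ _ _ _ M) => //; last exact: measurable_funTS.
  have IE : lam I = (k + 1 - - (k + 1))%:E by apply: bal_lam_oc; lra.
  by rewrite [X in (X < _)%E]IE ltry.
have E : (EFin \o h) \_ I = EFin \o h.
  apply/funext => s; rewrite patchE; case: ifPn => // /negP sI /=; rewrite h0 //.
  rewrite ltNge; apply/negP => sk; apply: sI; apply: mem_set.
  by rewrite /I /= in_itv /=; move: sk; rewrite ler_norml => /andP[? ?]; apply/andP; split; lra.
split=> //; first by rewrite -E; exact/(integrable_mkcond _ mI).1.
rewrite /Rintegral fineK; last exact: integrable_fin_num.
by rewrite [RHS]integral_mkcond E.
Qed.

End MeasureSums.

(** * Summation over shells of parameters *)

Section Global.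
Context {R : realType} {n : nat} {G : geometry R n}.
Local Notation lam := (@lebesgue_measure R).
Local Notation oc c d := (`]c, d]%classic : set (measurableTypeR R)).
Local Notation HG := (@Hpar R n G `|` @Gpar R n G).
Variables (B : set R) (gamma : R -> phase G).
Hypothesis hgamma : gen_bichar [set: R] B gamma.
Hypothesis hnontriv : exists2 s, ~ B s & (ph_tau (gamma s), ph_xi (gamma s)) <> (0, 0).
Local Notation Gam := (Gam B gamma).
Local Notation clock := (clock B gamma).
Local Notation HG_clock := (HG_clock B gamma).
Local Notation balanced := (balanced B gamma).

Lemma jump_integrable (nu : {measure set (borel G) -> \bar R}) f : (nu setT < +oo)%E ->
  C1c f -> nu.-integrable HG (EFin \o jump f).
Proof.
move=> fnu cf; have [M hM] := jump_bounded cf.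
apply: (@bounded_integrable _ _ _ nu _ (jump f) M) => //; first exact: measurable_HG.
  apply: (le_lt_trans _ fnu); apply: le_measure; rewrite ?inE //; exact: measurable_HG.
by apply: jump_measurable; exact: cf.1.
Qed.

Lemma Hp_Gam_integrable f a b : C1c f -> lam.-integrable (oc a b) (EFin \o (Hp f \o Gam)).
Proof.
move=> cf; have [M hM] := Hp_bounded cf.
apply: (@bounded_integrable _ _ _ _ _ _ M).
- exact: measurable_itv.
- have [ab|/ltW ba] := leP a b; first by rewrite [X in (X < _)%E](bal_lam_oc ab) ltry.
  by rewrite set_itv_ge ?measure0 ?ltry // bnd_simp -leNgt.
- by apply: (Hp_Gam_measurable hgamma); exact: cf.1.
- by move=> s _; apply: hM; exact: Gam_TLhat.
Qed.

Lemma Hp_Gam_additive f u v w : C1c f -> u <= v -> v <= w ->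
  \int[lam]_(r in oc u w) Hp f (Gam r) =
  \int[lam]_(r in oc u v) Hp f (Gam r) + \int[lam]_(r in oc v w) Hp f (Gam r).
Proof.
move=> cf uv vw.
have U : oc u w = oc u v `|` oc v w.
  apply/seteqP; split=> r /=; rewrite !in_itv /=.
    by move=> /andP[h1 h2]; case: (leP r v) => h; [left|right]; apply/andP.
  by move=> [] /andP[h1 h2]; apply/andP; split; lra.
have I := Hp_Gam_integrable u w cf.
rewrite U; apply: Rintegral_setU.
- exact: measurable_itv.
- exact: measurable_itv.
- by rewrite -U.
- by apply/disj_setPS => r [] /=; rewrite !in_itv /= => /andP[_ h1] /andP[h2 _]; lra.
Qed.

Lemma HG_clock_sub u v a b : u <= a -> b <= v -> HG_clock a b `<=` HG_clock u v.
Proof. by move=> ua bv rho [h /andP[h1 h2]]; split=> //; apply/andP; split; lra. Qed.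

Lemma HG_clock_null (nu : {measure set (borel G) -> \bar R}) u v a b : u <= a -> b <= v ->
  nu (~` HG_clock a b) = 0%E -> nu (~` HG_clock u v) = 0%E.
Proof.
move=> ua bv h; apply: (@subset_measure0 _ _ _ nu _ (~` HG_clock a b)) => //.
- by apply: measurableC; exact: measurable_HG_clock.
- by apply: measurableC; exact: measurable_HG_clock.
- by apply: subsetC; exact: HG_clock_sub.
Qed.

Lemma balanced_trans u v w : u <= v -> v <= w -> balanced u v -> balanced v w -> balanced u w.
Proof.
move=> uv vw [nu1 [f1 z1 E1]] [nu2 [f2 z2 E2]].
exists (measure_add nu1 nu2); split.
- exact: (eq_ind_r (fun x => (x < +oo)%E) (lte_add_pinfty f1 f2) (measure_addE nu1 nu2 setT)).
- apply: (etrans (measure_addE nu1 nu2 _)).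
  by rewrite (HG_clock_null (lexx u) vw z1) (HG_clock_null uv (lexx w) z2) adde0.
- move=> f cf; rewrite (Hp_Gam_additive cf uv vw).
  rewrite Rintegral_measure_add; [|exact: measurable_HG|exact: jump_integrable|exact: jump_integrable].
  rewrite (_ : f (Gam w) - f (Gam u) = (f (Gam v) - f (Gam u)) + (f (Gam w) - f (Gam v))); last by ring.
  by rewrite E1 // E2 //; ring.
Qed.

Lemma balanced_local s : exists2 d, 0 < d &
  forall u v, s - d < u -> u <= v -> v < s + d -> balanced u v.
Proof.
have [bx|nb] := pselect (bTL (Gam s)); last first.
  have /near_ball[d d0 hd] : nbhs s (~` [set s | bTL (Gam s)]).
    by apply: open_nbhs_nbhs; split=> //; apply: closed_openC; exact: closed_Z.
  exists d => // u v su uv vs; apply: (interior_balanced hgamma uv) => r /andP[ur rv].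
  by apply: hd; rewrite ltr_norml; apply/andP; split; lra.
have [qc dx] := qn_chartP bx.
have [d d0 hd] := near_ball (Gam_near_dom hgamma dx).
(* Halving leaves a margin: the chart must contain the curve on a closed interval reaching strictly
   beyond [u] and [v]. *)
exists (d / 2) => [|u v su uv vs]; first by rewrite divr_gt0.
have h1 : s - d / 2 < u by [].
apply: (@boundary_balanced _ _ _ _ _ hgamma hnontriv (s - d / 2) u v (s + d / 2) _ su uv vs qc).
move=> r /andP[r1 r2]; apply: hd; rewrite ltr_norml; apply/andP; split; lra.
Qed.

Lemma balanced_all a b : a <= b -> balanced a b.
Proof. by apply: interval_induction; [exact: balanced_local|exact: balanced_trans]. Qed.

(** The increment of the balance from [[- k, k]] to [[- (k + 1), k + 1]]. Shells telescope, and a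
    compact set meets only finitely many of them. *)
Definition is_shell (k : nat) (nu : {measure set (borel G) -> \bar R}) :=
  [/\ (nu setT < +oo)%E,
    nu (~` (HG_clock k%:R k.+1%:R `|` HG_clock (- k.+1%:R) (- k%:R))) = 0%E &
    forall f, C1c f -> (f (Gam k.+1%:R) - f (Gam (- k.+1%:R))) - (f (Gam k%:R) - f (Gam (- k%:R))) =
      \int[lam]_(r in oc k%:R k.+1%:R) Hp f (Gam r) +
      \int[lam]_(r in oc (- k.+1%:R) (- k%:R)) Hp f (Gam r) + \int[nu]_(rho in HG) jump f rho].

Lemma shell (k : nat) : exists nu : {measure set (borel G) -> \bar R}, is_shell k nu.
Proof.
have k1 : (k%:R : R) <= k.+1%:R by rewrite ler_nat.
have [nu1 [f1 z1 E1]] := balanced_all k1.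
have k2 : (- k.+1%:R : R) <= - k%:R by rewrite lerN2.
have [nu2 [f2 z2 E2]] := balanced_all k2.
have sub0 (m : {measure set (borel G) -> \bar R}) (A A' : set (borel G)) : measurable A -> measurable A' ->
    m (~` A) = 0%E -> A `<=` A' -> m (~` A') = 0%E.
  move=> mA mA' h AA'; apply: (@subset_measure0 _ _ _ m _ (~` A)) => //; try exact: measurableC.
  exact: subsetC.
have mU : measurable (HG_clock k%:R k.+1%:R `|` HG_clock (- k.+1%:R) (- k%:R)).
  by apply: measurableU; exact: measurable_HG_clock.
exists (measure_add nu1 nu2); split.
- exact: (eq_ind_r (fun x => (x < +oo)%E) (lte_add_pinfty f1 f2) (measure_addE nu1 nu2 setT)).
- apply: (etrans (measure_addE nu1 nu2 _)).
  rewrite (sub0 nu1 _ _ _ mU z1) ?(sub0 nu2 _ _ _ mU z2) ?adde0 //.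
  + exact: measurable_HG_clock.
  + exact: measurable_HG_clock.
- move=> f cf.
  rewrite Rintegral_measure_add; [|exact: measurable_HG|exact: jump_integrable|exact: jump_integrable].
  have := E1 f cf; have := E2 f cf; lra.
Qed.

Lemma supp_clock f : C1c f -> exists m : nat, forall rho,
  closure [set r | f r != 0] rho -> `|clock rho| <= m%:R.
Proof. by move=> cf; exact: (compact_clock B gamma cf.2). Qed.

Lemma f_far (f : phase G -> R) (m : nat) s : (forall rho, closure [set r | f r != 0] rho -> `|clock rho| <= m%:R) ->
  m%:R < `|s| -> f (Gam s) = 0.
Proof.
move=> hm ms; apply/eqP; apply: contrapT => /negP fs.
have := hm _ (subset_closure (fs : [set r | f r != 0] (Gam s))).
by rewrite clock_Gam // leNgt ms.
Qed.

Lemma Hp_far f (m : nat) s : C1c f ->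
  (forall rho, closure [set r | f r != 0] rho -> `|clock rho| <= m%:R) ->
  m%:R < `|s| -> Hp f (Gam s) = 0.
Proof.
move=> cf hm ms; apply/eqP; apply: contrapT => /negP fs.
have := hm _ (Hp_supp cf.1 (Gam_mdom hgamma s) fs).
by rewrite clock_Gam // leNgt ms.
Qed.

Lemma jump_far f (m : nat) rho : C1c f ->
  (forall rho, closure [set r | f r != 0] rho -> `|clock rho| <= m%:R) ->
  HG rho -> m%:R < `|clock rho| -> jump f rho = 0.
Proof.
move=> cf hm hr ms; apply/eqP; apply: contrapT => /negP fs.
have [k Kk kt] := jump_supp cf hr fs; have := hm _ Kk.
rewrite (clock_ph_t B gamma kt).
by rewrite leNgt ms.
Qed.

Variable nu : {measure set (borel G) -> \bar R}^nat.
Hypothesis nuP : forall k, is_shell k (nu k).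

Let mS k : measurable (HG_clock k%:R k.+1%:R `|` HG_clock (- k.+1%:R) (- k%:R)).
Proof. by apply: measurableU; exact: measurable_HG_clock. Qed.

Lemma shells_sum f (m : nat) : C1c f ->
  \sum_(0 <= k < m) \int[nu k]_(rho in HG) jump f rho =
  f (Gam m%:R) - f (Gam (- m%:R)) - \int[lam]_(r in oc (- m%:R) m%:R) Hp f (Gam r).
Proof.
move=> cf; elim: m => [|m IH].
  by rewrite big_geq // oppr0 subrr set_itvoc0 Rintegral_set0 subr0.
rewrite big_nat_recr //= IH; have [_ _ /(_ f cf)] := nuP m.
have h1 : (- m.+1%:R : R) <= - m%:R by rewrite lerN2 ler_nat.
have h2 : (- m%:R : R) <= m%:R by rewrite (le_trans (_ : _ <= 0)) ?oppr_le0.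
have h3 : (m%:R : R) <= m.+1%:R by rewrite ler_nat.
rewrite (Hp_Gam_additive cf h1 (le_trans h2 h3)) (Hp_Gam_additive cf h2 h3); lra.
Qed.

Lemma shell_clock k rho : (HG_clock k%:R k.+1%:R `|` HG_clock (- k.+1%:R) (- k%:R)) rho ->
  HG rho /\ k%:R <= `|clock rho|.
Proof.
move=> [] [hr /andP[h1 h2]]; split=> //.
  by apply: (le_trans h1); exact: ler_norm.
by rewrite -normrN; apply: le_trans (ler_norm _); rewrite lerNr.
Qed.

Lemma shell_null k (A : set (borel G)) : measurable A ->
  (forall rho, HG rho -> k%:R <= `|clock rho| -> A rho) -> nu k (~` A) = 0%E.
Proof.
move=> mA h; have [_ z _] := nuP k.
apply: (@subset_measure0 _ _ _ (nu k) _ _ _ _ _ z).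
- exact: measurableC.
- by apply: measurableC; exact: mS.
- by apply: subsetC => rho /shell_clock[]; exact: h.
Qed.

(** Past the clock bound of the support of [f], the end values of [f], [Hp f] and the jumps all
    vanish, and the telescoped identity reduces to its two integrals. *)
Lemma nu_transport f : C1c f -> exists m : nat,
  [/\ forall s, m%:R < `|s| -> Hp f (Gam s) = 0,
    (mseries nu 0).-integrable HG (EFin \o jump f) &
    (\int[mseries nu 0]_(rho in HG) (jump f rho)%:E =
      (- \int[lam]_(r in oc (- (m%:R + 1)) (m%:R + 1)) Hp f (Gam r))%:E)%E].
Proof.
move=> cf; have [m hm] := supp_clock cf; exists m.
have ij k : (nu k).-integrable HG (EFin \o jump f).
  by apply: jump_integrable => //; have [] := nuP k.
(* The sum stops at [m.+1], not at [m]: the support allows clocks of size [m], and these still occur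
   in shell [m]. *)
have [k h mk ih h0|i1 i2] := mseries_integral (g := (jump f : borel G -> R)) (m := m.+1) (@measurable_HG R n G) ij.
  rewrite (negligible_integral (measurableC (mS k)) (@measurable_HG R n G) ih); last first.
    by have [] := nuP k.
  apply: integral0_eq => rho [hr]; rewrite /= notK => /shell_clock[_ hk].
  apply: h0; apply: (jump_far cf hm hr); apply: lt_le_trans hk.
  by rewrite ltr_nat.
split=> [s|//|]; first exact: Hp_far.
rewrite i2 shells_sum // !(f_far hm) ?normrN ?normr_nat ?ltr_nat // subrr sub0r.
by rewrite -natr1.
Qed.

(** Shell [k] is carried by clocks of size at least [k], whereas the clock is bounded on a compact
    set: finitely many finite terms remain. *)
Lemma nu_radon : radon_on (@bparTL R n G) (mseries nu 0).
Proof.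
split.
  move=> K cK; have [m hm] := compact_clock B gamma cK.
  have mK : measurable (K : set (borel G)).
    by apply: borel_closed; apply: compact_closed => //; exact: phase_hausdorff.
  rewrite /= /mseries (eseries_finite (m := m.+1)); last first.
    move=> k mk; rewrite -[K]setCK; apply: shell_null; first exact: measurableC.
    move=> rho _ hk Kr; have := le_trans hk (hm _ Kr).
    by rewrite ler_nat leqNgt mk.
  apply/lte_sum_pinfty => k _; have [fk _ _] := nuP k.
  by apply: (le_lt_trans _ fk); apply: le_measure; rewrite ?inE.
rewrite /= /mseries; apply: eseries0 => k _ _; apply: shell_null.
  by apply: borel_closed; exact: closed_bparTL.
by move=> rho [] [].
Qed.

End Global.

Theorem theoremA1 (R : realType) (n : nat) (G : geometry R n)
    (B : set R) (gamma : R -> phase G)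
    (hgamma : gen_bichar [set: R] B gamma)
    (hnontriv : exists2 s, ~ B s &
       (ph_tau (gamma s), ph_xi (gamma s)) <> (0, 0)) :
  exists2 mu : {measure set (borel G) -> \bar R}, is_delta B gamma mu &
    exists2 nu : {measure set (borel G) -> \bar R},
      radon_on (@bparTL R n G) nu & transport_eq mu nu.
Proof.
pose Gm : measurableTypeR R -> borel G := Gam B gamma.
have mGm : measurable_fun setT Gm := Gam_measurable hgamma measurableT.
have mTL : measurable (@TLhat R n G : set (borel G)) by apply: borel_closed; exact: closed_TLhat.
have hTL s : TLhat (Gm s) := Gam_TLhat hgamma s.
have cB := countable_B hgamma.
pose mu0 : {measure set (borel G) -> \bar R} := pushforward (@lebesgue_measure R) Gm.
have [nu nuP] := choice (shell hgamma hnontriv).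
exists (mu0 mGm); last first.
  exists (mseries nu 0); first exact: (nu_radon nuP).
  move=> f cf; have [m [h1 h2 h3]] := nu_transport hgamma hnontriv nuP cf.
  have [M hM] := Hp_bounded cf.
  have mH : measurable_fun (setT : set (measurableTypeR R)) (Hp f \o Gm).
    by apply: (measurable_off_countable cB) => // s _; apply: Hp_Gam_continuous => //; exact: cf.1.
  have [i1 _ i3] := lam_bounded_supp (ler0n R m) mH (fun s => hM _ (hTL s)) h1.
  have [j1 j2] := pushforward_integral mGm mTL (Hp_measurable cf.1) hTL i1.
  split; [exact: j1|exact: h2|].
  by rewrite [LHS]j2 [LHS]i3 [X in (- X)%E]h3 EFinN oppeK.
split.
  split.
    move=> K cK; have [m hm] := compact_clock B gamma cK.
    have mK : measurable (K : set (borel G)).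
      by apply: borel_closed; apply: compact_closed => //; exact: phase_hausdorff.
    (* Parameters in the preimage of [K] lie in [[- m, m]]; the left end is moved by 1 because the
       interval is open there. *)
    apply: (@le_lt_trans _ _ ((@lebesgue_measure R) `](- m%:R - 1), m%:R]%classic)).
      have mGK : measurable (Gm @^-1` K) by rewrite -[X in measurable X]setTI; exact: mGm.
      apply: (@le_measure _ _ _ (@lebesgue_measure R) (Gm @^-1` K)); rewrite ?inE //.
      move=> s /hm; rewrite clock_Gam // ler_norml => /andP[s1 s2].
      by rewrite /= in_itv /=; apply/andP; split; lra.
    by rewrite [X in (X < _)%E]bal_lam_oc ?ltry //; have := ler0n R m; lra.
  have E : Gm @^-1` (~` @TLhat R n G) = set0.
    by rewrite -subset0 => s; apply; exact: hTL.
  by rewrite /= /pushforward E measure0.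
move=> a [ca sa].
have [m hm] := compact_clock B gamma sa.
have [M hM] : exists M, forall rho, `|a rho| <= M.
  have [x _|M hM] := @compact_bounded R _ _ setT a sa.
    by exists (`|a x| + 1); apply: filterS (near_bound (ca x)).
  exists (Num.max M 0) => rho; rewrite le_max; have [->|ar] := eqVneq (a rho) 0.
    by rewrite normr0 lexx orbT.
  by rewrite hM //; exact: subset_closure.
have mh : measurable_fun (setT : set (measurableTypeR R)) (a \o Gm).
  apply: (measurable_off_countable cB) => // s _ nb.
  exact: (cvg_for (Gam_continuous hgamma nb) (ca _)).
have far s : m%:R < `|s| -> (a \o Gm) s = 0 by exact: (f_far hgamma hnontriv hm).
have [i1 _ _] := lam_bounded_supp (ler0n R m) mh (fun s => hM _) far.
have ma : measurable_fun (@TLhat R n G : set (borel G)) a.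
  apply: borel_measurable_fun; first exact: closed_TLhat.
  move=> x e _ e0; have := near_preimage (ca x) (nbhsx_ballx _ e e0).
  by apply: filterS => y /ball_dist.
have [_ j2] := pushforward_integral mGm mTL ma hTL i1.
(* [Gam] and [gamma] agree off the countable set [B], which is Lebesgue null, so the integral over
   the line becomes the one over the complement of [B]. *)
have mB : measurable (B : set (measurableTypeR R)).
  by apply: countable_measurable => // t; exact: measurable_set1.
have eqB : {in ~` B, (fun s => (a (Gm s))%:E) =1 (fun s => (a (gamma s))%:E)}.
  by move=> s; rewrite inE => nb; rewrite /Gm GamD.
split.
  have i4 : (@lebesgue_measure R).-integrable (~` B) (fun s => (a (Gm s))%:E).
    by apply: (integrableS _ _ _ i1) => //; exact: measurableC.
  by move: i4; apply: eq_integrable; [exact: measurableC|exact: eqB].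
rewrite [LHS]j2 (negligible_integral mB measurableT i1 (countable_lebesgue_measure0 cB)).
by rewrite setTD; apply: eq_integral; exact: eqB.
Qed.
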